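(* Suppose prices are bounded: there are constants $0<p_-\le p_+$ with $p_-\le P^i_t\le p_+$ a.s. for all $i,t$. Suppose both $U^a$ and $U^p$ are constructed by pasting optimized certainty equivalents with loss functions $H^a_t$, resp. $H^p_t$, i.e. on one-step variables $U^l_t(X)=\operatorname*{ess\,sup}_{s\in\mathbb{R}}\{s-\mathbb{E}[H^l_t(s-X)\mid\mathcal{F}_t]\}$, $l=a,p$, and that for each $t$: $1\in int(dom((H^a_t)^* ))\cap int(dom((H^p_t)^* ))$ and $H^a_t,H^p_t$ are bounded from below. Assume $\lim_{|a|\to\infty}c_t(a)/|a|=\infty$ for every $t$. Then for every $t\in\mathbb{T}$ the Principal's one-step problem $h_t=\operatorname*{ess\,sup}_{\beta,(A,\Gamma)\in\mathbb{C}_t(\beta)}\{U^a_t(\Gamma)-c_t(A)+U^p_t(h_{t+1}+A\Delta\tilde P_{t+1}-\Gamma)\}$ (with $h_T=0$) is attained with $\beta_t=1$, and the dynamic Principal–Agent problem has a solution in which $\beta_t=1$ for all $t$: the Agent keeps the generated wealth and the Principal receives a (possibly path-dependent) derivative on the price path.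
   Context: Setting: $T\in\mathbb{N}$, $\mathbb{T}:=\{0,\dots,T-1\}$; a probability space carrying an $\mathbb{R}^N$-valued strictly positive price process $P=(P_t)_{t=0}^T$ with generated filtration $(\mathcal{F}_t)$; $\Delta\tilde P_{t+1}:=diag(P_t)^{-1}(P_{t+1}-P_t)$; $c_t:\mathbb{R}^N\to\mathbb{R}$ strictly convex. The Agent chooses efforts $A_t\in L^0(\mathcal{F}_t)^N$ with cost $c_t(A_t)$; wealth increments are $\Delta W^A_{t+1}=A_t\Delta\tilde P_{t+1}$. Contracts pay $\Theta+\sum_t\beta_t\Delta W^A_{t+1}$, $\Theta$ $\mathcal{F}_T$-measurable, $\beta_t\in L^0(\mathcal{F}_t)$. Optimized certainty equivalent (OCE): $H_t:\mathbb{R}\to\mathbb{R}\cup\{+\infty\}$ convex, lower semicontinuous, nondecreasing with $H_t^*(1):=\sup_s[s-H_t(s)]=0$ (here $H^*$ denotes the convex conjugate $H^*(x)=\sup_s[xs-H(s)]$). The one-step functional $\tilde U_t(X):=\operatorname*{ess\,sup}_{s\in\mathbb{R}}\{s-\mathbb{E}[H_t(s-X)\mid\mathcal{F}_t]\}$ for bounded $\mathcal{F}_{t+1}$-measurable $X$ is extended to $\mathcal{F}_{t+1}$-measurable $X$ with values in $\mathbb{R}\cup\{-\infty\}$ by $X\mapsto\lim_{n\to\infty}\lim_{m\to-\infty}\tilde U_t((X\wedge n)\vee m)$; the pasted family is $U_t:=\tilde U_t\circ\tilde U_{t+1}\circ\dots\circ\tilde U_{T-1}$. $\mathbb{C}_t(\beta)$: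 set of $(A,\Gamma)\in L^0(\mathcal{F}_t)^N\times L^0(\mathcal{F}_{t+1})$ with $U^a_t(\Gamma)-c_t(A)\ge U^a_t(\Gamma+\beta(\bar A-A)\Delta\tilde P_{t+1})-c_t(\bar A)$ for all $\bar A\in L^0(\mathcal{F}_t)^N$. A solution of the dynamic problem is a contract maximizing the Principal's time-0 utility $U^p_0(W^A_T-\text{payment})$ among incentive compatible (the Agent's recursive optima $H_t=\operatorname*{ess\,sup}_A\{U^a_t(H_{t+1}+\beta_tA\Delta\tilde P_{t+1})-c_t(A)\}$, $H_T=\Theta$, are attained) and individually rational (Agent's optimal utility $\ge R\in\mathbb{R}$) contracts. *)

(* Defs.v *)
From HB Require Import structures.
From mathcomp Require Import all_boot all_order all_algebra.
From mathcomp Require Import all_classical all_reals all_analysis.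
From mathcomp Require Import measurable_realfun.
Import Order.TTheory GRing.Theory Num.Theory.
Import numFieldNormedType.Exports.
Local Open Scope classical_set_scope.
Local Open Scope ring_scope.

Set Implicit Arguments.
Unset Strict Implicit.
Unset Printing Implicit Defensive.

Section Deterministic.
Context {R : realType}.

Definition strictly_convex (N : nat) (c : 'rV[R]_N -> R) :=
  forall (x y : 'rV[R]_N) (l : R), x != y -> 0 < l < 1 ->
    c (l *: x + (1 - l) *: y) < l * c x + (1 - l) * c y.

Definition enorm (N : nat) (a : 'rV[R]_N) : R :=
  Num.sqrt (\sum_(i < N) a ord0 i ^+ 2).

Definition superlinear (N : nat) (c : 'rV[R]_N -> R) :=
  forall M : R, exists r : R, forall a : 'rV[R]_N,
    r <= enorm a -> M <= c a / enorm a.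

Definition convex_ext (H : R -> \bar R) :=
  forall (x y l : R), 0 < l < 1 ->
    (H (l * x + (1 - l) * y)%R <= l%:E * H x + (1 - l)%R%:E * H y)%E.

Definition nondecreasing_ext (H : R -> \bar R) :=
  forall x y : R, x <= y -> (H x <= H y)%E.

Definition conj_ext (H : R -> \bar R) (x : R) : \bar R :=
  ereal_sup (range (fun s : R => ((x * s)%:E - H s)%E)).

Definition dom_ext (f : R -> \bar R) : set R := [set x | (f x < +oo)%E].

Definition OCE_loss (H : R -> \bar R) :=
  [/\ convex_ext H, lower_semicontinuous H, nondecreasing_ext H
    & conj_ext H 1 = 0%E].

End Deterministic.

Section Stochastic.
Context {d : measure_display} {Omega : measurableType d} {R : realType}.
Variable (Pr : probability Omega R).

Definition meas_wrt (G : set (set Omega)) {d' : measure_display}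
  {T' : measurableType d'} (X : Omega -> T') :=
  forall B : set T', measurable B -> G (X @^-1` B).

(* Y is a version of E[X | G] (X bounded below in all uses) *)
Definition condexp (G : set (set Omega)) (X Y : Omega -> \bar R) :=
  meas_wrt G Y /\
  forall A, G A -> (\int[Pr]_(w in A) Y w = \int[Pr]_(w in A) X w)%E.

Definition esssup (G : set (set Omega)) (Fam : set (Omega -> \bar R))
  (Y : Omega -> \bar R) :=
  [/\ meas_wrt G Y,
      (forall Z, Fam Z -> {ae Pr, forall w, (Z w <= Y w)%E}) &
      (forall W : Omega -> \bar R, measurable_fun setT W ->
         (forall Z, Fam Z -> {ae Pr, forall w, (Z w <= W w)%E}) ->
         {ae Pr, forall w, (Y w <= W w)%E})].

Variable (N : nat) (P : nat -> Omega -> 'rV[R]_N).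

Definition Filt (t : nat) : set (set Omega) :=
  <<s [set A | exists (s : nat) (i : 'I_N) (B : set R),
         [/\ (s <= t)%N, measurable B & A = (fun w => P s w ord0 i) @^-1` B]] >>.

Definition adapted_vec (t : nat) (A : Omega -> 'rV[R]_N) :=
  forall i : 'I_N, meas_wrt (Filt t) (fun w => A w ord0 i).

Definition gain (a : 'rV[R]_N) (t : nat) (w : Omega) : R :=
  \sum_(i < N) a ord0 i * ((P t.+1 w ord0 i - P t w ord0 i) / P t w ord0 i).

Definition OCE1 (H : R -> \bar R) (t : nat) (X : Omega -> R)
  (Y : Omega -> \bar R) :=
  exists V : R -> Omega -> \bar R,
    (forall s : R, condexp (Filt t) (fun w => H (s - X w)) (V s)) /\
    esssup (Filt t) (range (fun s : R => fun w => (s%:E - V s w)%E)) Y.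

Definition OCE1ext (H : R -> \bar R) (t : nat) (X Y : Omega -> \bar R) :=
  exists (V : nat -> nat -> Omega -> \bar R) (W : nat -> Omega -> \bar R),
    [/\ (forall n m : nat,
           OCE1 H t (fun w => fine (maxe (mine (X w) n%:R%:E) (- m%:R)%:E))
                (V n m)),
        (forall n : nat,
           {ae Pr, forall w, V n m w @[m --> \oo] --> W n w}) &
        {ae Pr, forall w, W n w @[n --> \oo] --> Y w}].

Definition pasted (H : nat -> R -> \bar R) (T t : nat) (X Y : Omega -> \bar R) :=
  exists Z : nat -> Omega -> \bar R,
    [/\ Z T = X,
        (forall s, (t <= s < T)%N -> OCE1ext (H s) s (Z s.+1) (Z s)) &
        Z t = Y].

Definition inC (Ha : nat -> R -> \bar R) (c : nat -> 'rV[R]_N -> R)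
  (T t : nat) (beta : Omega -> R) (A : Omega -> 'rV[R]_N) (Gam : Omega -> R) :=
  [/\ adapted_vec t A, meas_wrt (Filt t.+1) Gam &
      forall Abar : Omega -> 'rV[R]_N, adapted_vec t Abar ->
      forall Y Y' : Omega -> \bar R,
        pasted Ha T t (fun w => (Gam w)%:E) Y ->
        pasted Ha T t
          (fun w => (Gam w + beta w * gain (Abar w - A w) t w)%:E) Y' ->
        {ae Pr, forall w,
           (Y' w - (c t (Abar w))%:E <= Y w - (c t (A w))%:E)%E}].

Definition principal_family (Ha Hp : nat -> R -> \bar R)
  (c : nat -> 'rV[R]_N -> R) (T t : nat) (hnext : Omega -> \bar R) :
  set (Omega -> \bar R) :=
  [set Z | exists (beta : Omega -> R) (A : Omega -> 'rV[R]_N)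
                  (Gam : Omega -> R) (Ya Yp : Omega -> \bar R),
     [/\ meas_wrt (Filt t) beta, inC Ha c T t beta A Gam,
         pasted Ha T t (fun w => (Gam w)%:E) Ya,
         pasted Hp T t (fun w => (hnext w + (gain (A w) t w - Gam w)%:E)%E) Yp
       & Z = (fun w => Ya w - (c t (A w))%:E + Yp w)%E]].

Definition principal_recursion (Ha Hp : nat -> R -> \bar R)
  (c : nat -> 'rV[R]_N -> R) (T : nat) (h : nat -> Omega -> \bar R) :=
  h T = (fun _ => 0%E) /\
  forall t, (t < T)%N -> esssup (Filt t) (principal_family Ha Hp c T t (h t.+1)) (h t).

Definition attained_beta1 (Ha Hp : nat -> R -> \bar R)
  (c : nat -> 'rV[R]_N -> R) (T t : nat) (h : nat -> Omega -> \bar R) :=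
  exists (A : Omega -> 'rV[R]_N) (Gam : Omega -> R) (Ya Yp : Omega -> \bar R),
    [/\ inC Ha c T t (fun _ => 1) A Gam,
        pasted Ha T t (fun w => (Gam w)%:E) Ya,
        pasted Hp T t (fun w => (h t.+1 w + (gain (A w) t w - Gam w)%:E)%E) Yp
      & {ae Pr, forall w, h t w = (Ya w - (c t (A w))%:E + Yp w)%E}].

Definition contract (T : nat) (Theta : Omega -> R) (beta : nat -> Omega -> R) :=
  meas_wrt (Filt T) Theta /\ forall t, (t < T)%N -> meas_wrt (Filt t) (beta t).

Definition incentive_compatible (Ha : nat -> R -> \bar R)
  (c : nat -> 'rV[R]_N -> R) (T : nat) (Theta : Omega -> R)
  (beta : nat -> Omega -> R) (A : nat -> Omega -> 'rV[R]_N)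
  (Hag : nat -> Omega -> \bar R) :=
  Hag T = (fun w => (Theta w)%:E) /\
  forall t, (t < T)%N ->
    [/\ adapted_vec t (A t),
        esssup (Filt t)
          [set Z | exists (Abar : Omega -> 'rV[R]_N) (Y : Omega -> \bar R),
             [/\ adapted_vec t Abar,
                 pasted Ha T t
                   (fun w => (Hag t.+1 w + (beta t w * gain (Abar w) t w)%:E)%E) Y
               & Z = (fun w => Y w - (c t (Abar w))%:E)%E]]
          (Hag t)
      & exists Y : Omega -> \bar R,
          pasted Ha T t
            (fun w => (Hag t.+1 w + (beta t w * gain (A t w) t w)%:E)%E) Y /\
          {ae Pr, forall w, Hag t w = (Y w - (c t (A t w))%:E)%E}].

Definition individually_rational (Rres : R) (Hag : nat -> Omega -> \bar R) :=
  {ae Pr, forall w, (Rres%:E <= Hag 0%N w)%E}.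

(* W^A_T - payment, with W^A_0 = 0 *)
Definition principal_payoff (T : nat) (Theta : Omega -> R)
  (beta : nat -> Omega -> R) (A : nat -> Omega -> 'rV[R]_N) (w : Omega) : R :=
  \sum_(t < T) gain (A t w) t w
  - (Theta w + \sum_(t < T) beta t w * gain (A t w) t w).

Definition PA_solution (Ha Hp : nat -> R -> \bar R) (c : nat -> 'rV[R]_N -> R)
  (T : nat) (Rres : R) (Theta : Omega -> R) (beta : nat -> Omega -> R)
  (A : nat -> Omega -> 'rV[R]_N) :=
  exists (Hag : nat -> Omega -> \bar R) (Y : Omega -> \bar R),
    [/\ contract T Theta beta, incentive_compatible Ha c T Theta beta A Hag,
        individually_rational Rres Hag,
        pasted Hp T 0 (fun w => (principal_payoff T Theta beta A w)%:E) Y &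
        forall (Theta' : Omega -> R) (beta' : nat -> Omega -> R)
               (A' : nat -> Omega -> 'rV[R]_N) (Hag' : nat -> Omega -> \bar R)
               (Y' : Omega -> \bar R),
          contract T Theta' beta' ->
          incentive_compatible Ha c T Theta' beta' A' Hag' ->
          individually_rational Rres Hag' ->
          pasted Hp T 0 (fun w => (principal_payoff T Theta' beta' A' w)%:E) Y' ->
          {ae Pr, forall w, (Y' w <= Y w)%E}].

End Stochastic.

(* Main.v *)
(* Whatever the contract, U^a_t(G) - c_t(A) and U^p_t(X) add up to at most the first-best value
     h_t = sup_(A, s) { s - c_t(A) - E[(Ha_t # Hp_t)(s - h_(t+1) - A dP) | F_t] },
   where Ha # Hp is the infimal convolution of the losses: if G + X <= h_(t+1) + A dP, then
   Ha(g1 - G) + Hp(g2 - X) >= (Ha # Hp)(g1 + g2 - h_(t+1) - A dP).  The supremum is attained by a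
   measurable (A, s), and the infimal convolution at z = s - h_(t+1) - A dP by some x*; paying the
   agent Gam = -x* (up to an F_t-measurable constant) then reaches the first best.  With beta = 1 the
   sum of Gam + (Abar - A) dP and of the principal's share h_(t+1) + A dP - Gam is
   h_(t+1) + Abar dP, so the same bound applied to Abar shows that the agent cannot gain by
   deviating.  Both U's are cash invariant, so the steps can be chained: the agent's wealth process
   W_t = R + sum_(s < t) (Gam_s - A_s dP_s) is his utility and h_t - W_t is the principal's. *)

Require Import Defs.
From HB Require Import structures.
From mathcomp Require Import all_boot all_order all_algebra.
From mathcomp Require Import all_classical all_reals all_analysis.
From mathcomp Require Import measurable_realfun ring lra.
Import Order.TTheory GRing.Theory Num.Theory.
Import numFieldNormedType.Exports.
Local Open Scope classical_set_scope.
Local Open Scope ring_scope.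

Set Implicit Arguments.
Unset Strict Implicit.
Unset Printing Implicit Defensive.

(** The supremum over random [(A, s)] cannot be taken pointwise: each choice of [(A, s)] has its own
    conditional expectation, known only up to a null set. The device is a tree of boxes in the space
    of [(a, s)]. Every cell carries one conditional expectation, that of the loss at a lower bound
    of its argument on the cell; only countably many occur, so all inequalities between them hold
    off one null set. Descending to the better child yields a limit point that is measurable by
    construction. Values converge along the descent because a nondecreasing lower semicontinuous
    loss is left continuous, so that conditional monotone convergence applies even where the loss
    jumps to [+oo]. The same tree in dimension 1 selects the minimiser of the infimal convolution
    and shows that this convolution is left continuous, hence again an admissible loss. The search
    is confined to a box for three reasons: [1] being interior to the domain of the conjugate bounds
    [s] above, the lower bound of the loss bounds [s] below, and superlinear costs against bounded
    returns bound [a]. *)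

Section AeIntegral.
Context d (T : measurableType d) (R : realType) (mu : {measure set T -> \bar R}).
Local Open Scope ereal_scope.
Import HBNNSimple.

(** No measurability is assumed, since [condexp] asks none of its first argument. A simple function
    below [f], set to 0 on the exceptional null set, lies below [g] everywhere and keeps its
    integral. *)
Lemma ae_le_ge0_integral (f g : T -> \bar R) :
  (forall x, 0 <= f x) -> (forall x, 0 <= g x) ->
  {ae mu, forall x, f x <= g x} -> \int[mu]_x f x <= \int[mu]_x g x.
Proof.
move=> f0 g0 [N [mN N0 sN]].
rewrite ge0_integralTE// ge0_integralTE//.
apply: ge_ereal_sup => _ [h /= hf <-].
pose k : {nnsfun T >-> R} := proj_nnsfun h (measurableC mN).
apply: le_ereal_sup_tmp; exists (sintegral mu k).
  exists k => //= x; rewrite /proj_nnsfun/= /mindic indicE.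
  have [xN|xN] := pselect (N x).
    by rewrite memNset ?mulr0//; apply: contrapT; rewrite -/(setC _ _).
  rewrite mem_set// mulr1 (le_trans (hf x))//.
  by apply: contrapT => fg; apply: xN; apply: sN.
rewrite -!integralT_nnsfun.
rewrite le_eqVlt; apply/orP; left; apply/eqP.
apply: ae_eq_integral => //; [exact/measurable_EFinP|exact/measurable_EFinP|].
exists N; split => // x /= /not_implyP [_ hk].
apply: contrapT => xN; apply: hk; congr EFin.
by rewrite /proj_nnsfun/= /mindic indicE mem_set// mulr1.
Qed.

Lemma ae_le_integral (D : set T) (f g : T -> \bar R) :
  {ae mu, forall x, D x -> f x <= g x} ->
  \int[mu]_(x in D) f x <= \int[mu]_(x in D) g x.
Proof.
move=> fg; rewrite integral_mkcond [leRHS]integral_mkcond.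
have {}fg : {ae mu, forall x, (f \_ D) x <= (g \_ D) x}.
  apply: filterS fg => x; rewrite /patch; case: ifPn => // /set_mem Dx; exact.
rewrite integralE [leRHS]integralE.
apply: leeB; apply: ae_le_ge0_integral => //; apply: filterS fg => x fg.
  by rewrite /= !funeposE ge_max !le_max lexx fg/= orbT.
by rewrite /= !funenegE ge_max !le_max lexx leeN2 fg/= orbT.
Qed.

Lemma ae_eq_integralW (D : set T) (f g : T -> \bar R) :
  {ae mu, forall x, D x -> f x = g x} ->
  \int[mu]_(x in D) f x = \int[mu]_(x in D) g x.
Proof.
move=> fg; apply/eqP; rewrite eq_le !ae_le_integral//;
  by apply: filterS fg => x + Dx => /(_ Dx) ->.
Qed.

End AeIntegral.

Section Shift.
Context d (T : measurableType d) (R : realType) (mu : {finite_measure set T -> \bar R}).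
Local Open Scope ereal_scope.

(** The delicate case is an infinite integral with [c] negative: the negative part of [f + c] is at
    most [|c|], and its positive part must have infinite integral, for [f] is below that part plus
    [|c|]. *)
Lemma integral_shift (D : set T) (f : T -> \bar R) (c : R) :
  measurable D -> measurable_fun setT f -> (forall x, 0 <= f x) ->
  \int[mu]_(x in D) (f x + c%:E) = \int[mu]_(x in D) f x + c%:E * mu D.
Proof.
move=> mD mf f0.
have mfD : measurable_fun D f by exact: measurable_funTS.
have muD : mu D < +oo by rewrite ltey_eq fin_num_measure.
have [foo|] := ltP (\int[mu]_(x in D) f x) +oo.
  rewrite integralD//.
  - by rewrite -integral_cst.
  - apply/integrableP; split => //.
    by under eq_integral do rewrite gee0_abs//.
  - apply/integrableP; split => //.
    by rewrite integral_cst// lte_mul_pinfty.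
rewrite leye_eq => /eqP foo; rewrite foo addye; last first.
  by rewrite -ltNye ltNye_eq fin_numM// fin_num_measure.
rewrite integralE.
have neg : \int[mu]_(x in D) (fun x => f x + c%:E)^\- x < +oo.
  apply: (@le_lt_trans _ _ (\int[mu]_(x in D) (cst `|c|%:E) x)); last first.
    by rewrite integral_cst// lte_mul_pinfty.
  apply: ae_le_integral; apply: aeW => x _.
  rewrite funenegE ge_max; apply/andP; split; last by rewrite lee_fin.
  rewrite leeNl; apply: (@le_trans _ _ c%:E); last by rewrite leeDr.
  by rewrite -EFinN lee_fin lerNl -normrN ler_norm.
have pos : \int[mu]_(x in D) (fun x => f x + c%:E)^\+ x = +oo.
  apply/eqP; rewrite -leye_eq leNgt; apply/negP => posoo.
  have : \int[mu]_(x in D) f x <= \int[mu]_(x in D) ((fun x => f x + c%:E)^\+ x + `|c|%:E).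
    apply: ae_le_integral; apply: aeW => x _.
    rewrite -leeBlDr// funeposE le_max; apply/orP; left.
    by rewrite leeD2l// -EFinN lee_fin lerNl -normrN ler_norm.
  have mfp : measurable_fun D (fun x => f x + c%:E)^\+.
    apply: measurable_funepos; apply: emeasurable_funD => //.
  rewrite ge0_integralD//.
  rewrite foo leye_eq => /eqP; rewrite integral_cst// => h.
  suff : \int[mu]_(x in D) (fun x => f x + c%:E)^\+ x + `|c|%:E * mu D < +oo by rewrite h ltxx.
  by rewrite lte_add_pinfty// lte_mul_pinfty.
rewrite pos addye// -ltNye lteNr//.
Qed.

End Shift.

Lemma ereal_between_rat (R : realType) (a b : \bar R) : (a < b)%E ->
  exists p : rat * rat, [/\ (p.1 < p.2)%R, (a <= (ratr p.1)%:E)%E & ((ratr p.2)%:E <= b)%E].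
Proof.
move=> ab; have [x [y [xy ax yb]]] : exists x y : R, [/\ x < y, (a <= x%:E)%E & (y%:E <= b)%E].
  case: a b ab => [r| |] [s| |]//= rs.
  - by exists r, s; split => //; rewrite -lte_fin.
  - by exists r, (r + 1); rewrite leey; split => //; lra.
  - by exists (s - 1), s; rewrite leNye; split => //; lra.
  - by exists 0, 1; rewrite leey leNye.
have [q /andP[/= + +]] := rat_in_itvoo xy; rewrite !bnd_simp => xq qy.
have [q' /andP[/= + +]] := rat_in_itvoo qy; rewrite !bnd_simp => qq' q'y.
exists (q, q') => /=; split; first by rewrite -(ltr_rat R).
  by apply: (le_trans ax); rewrite lee_fin ltW.
by apply: le_trans yb; rewrite lee_fin ltW.
Qed.

Lemma ae_forall_count (I : countType) d (T : measurableType d) (R : realType)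
    (mu : {measure set T -> \bar R}) (Q : I -> T -> Prop) :
  (forall i, {ae mu, forall w, Q i w}) -> {ae mu, forall w, forall i, Q i w}.
Proof.
move=> h; have : {ae mu, forall w, forall n, if unpickle n is Some i then Q i w else True}.
  by apply: ae_foralln => n; case: unpickle => [i|]; [exact: h|exact: aeW].
by apply: filterS => w hw i; have := hw (pickle i); rewrite pickleK.
Qed.

(** * Conditional expectation *)

Section CondExp.
Context d (Omega : measurableType d) (R : realType) (Pr : probability Omega R).
Variable Gen : set (set Omega).
Hypothesis Gsub : <<s Gen >> `<=` (@measurable _ Omega).
Local Notation G := (<<s Gen >>).
Local Notation OG := (g_sigma_algebraType Gen).
Local Open Scope ereal_scope.

Lemma meas_wrtP d' (T' : measurableType d') (X : Omega -> T') :
  meas_wrt G X <-> measurable_fun [set: OG] (X : OG -> T').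
Proof.
split=> [h _ B mB|h B mB]; first by rewrite setTI; exact: h.
by have := h measurableT B mB; rewrite setTI.
Qed.

Lemma meas_wrt_measurable d' (T' : measurableType d') (X : Omega -> T') :
  meas_wrt G X -> measurable_fun [set: Omega] X.
Proof. by move=> h _ B mB; rewrite setTI; apply: Gsub; exact: h. Qed.

Lemma meas_wrt_le (X Y : Omega -> \bar R) : meas_wrt G X -> meas_wrt G Y ->
  G [set w | X w <= Y w].
Proof.
move=> /meas_wrtP mX /meas_wrtP mY.
have := @emeasurable_fun_le _ OG R setT measurableT X Y mX mY.
by rewrite setTI.
Qed.

Lemma Gcap A B : G A -> G B -> G (A `&` B).
Proof. exact: (@measurableI _ OG). Qed.

(** The event [Y' < Y] is a countable union of events [E] on which two rationals [q < q'] separate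
    the values. The premise bounds [q' * Pr E] by [q * Pr E], so each of them is null. *)
Lemma ce_le_gap (B : set Omega) (Y Y' : Omega -> \bar R) :
  G B -> meas_wrt G Y -> meas_wrt G Y' ->
  (forall q q' E, (q < q')%R -> G E -> E `<=` B -> (forall w, E w -> Y' w <= q%:E) ->
    (forall w, E w -> q'%:E <= Y w) -> q'%:E * Pr E <= q%:E * Pr E) ->
  {ae Pr, forall w, B w -> Y w <= Y' w}.
Proof.
move=> GB mY mY' h.
pose E (p : rat * rat) := B `&` ([set w | Y' w <= (ratr p.1)%:E] `&` [set w | (ratr p.2)%:E <= Y w]).
have GE p : G (E p).
  apply: Gcap => //; apply: Gcap; apply: meas_wrt_le => //;
  by apply/meas_wrtP; exact: measurable_cst.
have E0 p : (p.1 < p.2)%R -> Pr (E p) = 0.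
  move=> lt; have lt' : (ratr p.1 < ratr p.2 :> R)%R by rewrite ltr_rat.
  have hE : (ratr p.2)%:E * Pr (E p) <= (ratr p.1)%:E * Pr (E p).
    apply: h => //; first exact: subIsetl.
    - by move=> w [_ []].
    - by move=> w [_ []].
  have fE : Pr (E p) \is a fin_num by rewrite fin_num_measure//; exact: (Gsub (GE p)).
  move: hE; rewrite -(fineK fE) -!EFinM !lee_fin => hE; congr EFin.
  have : (0 <= fine (Pr (E p)))%R by exact: fine_ge0.
  nra.
have : {ae Pr, forall w, forall p : rat * rat, (p.1 < p.2)%R -> ~ E p w}.
  apply: ae_forall_count => p; have [lt|_] := boolP (p.1 < p.2)%R; last exact: aeW.
  exists (E p); split; [exact: (Gsub (GE p))|exact: E0|move=> w /= h'; apply: contrapT => nE].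
  by apply: h' => _.
apply: filterS => w hw Bw; rewrite leNgt; apply/negP => /ereal_between_rat [p [lt p1 p2]].
exact: (hw p lt).
Qed.

(** The localisation to an event of [G] is what later reduces random nodes and random competitors to
    deterministic cells. *)
Lemma ce_le (B : set Omega) (X X' Y Y' : Omega -> \bar R) :
  condexp Pr G X Y -> condexp Pr G X' Y' -> G B ->
  {ae Pr, forall w, B w -> X w <= X' w} -> {ae Pr, forall w, B w -> Y w <= Y' w}.
Proof.
move=> [mY hY] [mY' hY'] GB XX'; apply: ce_le_gap => // q q' E qq' GE EB Eq Eq'.
have mE := Gsub GE.
rewrite -!integral_cst//.
apply: (@le_trans _ _ (\int[Pr]_(w in E) Y w)).
  by apply: ae_le_integral; apply: aeW => w /Eq'.
apply: (@le_trans _ _ (\int[Pr]_(w in E) Y' w)); last first.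
  by apply: ae_le_integral; apply: aeW => w /Eq.
rewrite hY// hY'//; apply: ae_le_integral.
by apply: filterS XX' => w + Ew; apply; exact: EB.
Qed.

Lemma ce_leT (X X' Y Y' : Omega -> \bar R) :
  condexp Pr G X Y -> condexp Pr G X' Y' ->
  {ae Pr, forall w, X w <= X' w} -> {ae Pr, forall w, Y w <= Y' w}.
Proof.
move=> h h' XX'; have GT : G setT by exact: (@measurableT _ OG).
have : {ae Pr, forall w, setT w -> Y w <= Y' w}.
  by apply: ce_le h h' GT _; apply: filterS XX' => w.
by apply: filterS => w; exact.
Qed.

Lemma ce_eq (X X' Y Y' : Omega -> \bar R) :
  condexp Pr G X Y -> condexp Pr G X' Y' ->
  {ae Pr, forall w, X w = X' w} -> {ae Pr, forall w, Y w = Y' w}.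
Proof.
move=> h h' XX'.
have : {ae Pr, forall w, X w <= X' w} by apply: filterS XX' => w ->.
have : {ae Pr, forall w, X' w <= X w} by apply: filterS XX' => w ->.
move=> /(ce_leT h' h) + /(ce_leT h h'); apply: filterS2 => w a b; by apply/eqP; rewrite eq_le a b.
Qed.

Lemma ce_ae (X X' Y : Omega -> \bar R) :
  {ae Pr, forall w, X w = X' w} -> condexp Pr G X Y -> condexp Pr G X' Y.
Proof.
move=> XX' [mY hY]; split => // A GA; rewrite hY//.
by apply: ae_eq_integralW; apply: filterS XX'.
Qed.

Lemma ce_meas (X Y : Omega -> \bar R) :
  condexp Pr G X Y -> measurable_fun [set: OG] (Y : OG -> \bar R).
Proof. by move=> [/meas_wrtP]. Qed.

Lemma ce_self (X : Omega -> \bar R) : meas_wrt G X -> condexp Pr G X X.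
Proof. by []. Qed.

Lemma ce_cst (c : \bar R) : condexp Pr G (cst c) (cst c).
Proof. by apply: ce_self; apply/meas_wrtP; exact: measurable_cst. Qed.

Lemma ce_exists_bounded (X : Omega -> \bar R) (b : R) :
  measurable_fun setT X -> (forall w, `|X w| <= b%:E) ->
  exists Y, condexp Pr G X Y.
Proof.
move=> mX Xb.
have iX : Pr.-integrable setT X.
  apply/integrableP; split => //.
  apply: (@le_lt_trans _ _ (\int[Pr]_w (cst b%:E) w)).
    by apply: ae_le_integral; apply: aeW.
  by rewrite integral_cst//= probability_setT mule1 ltry.
(* Pushing forward along the identity into the coarser space restricts both the charge [X dPr] and
   [Pr] to [G]; the conditional expectation is the Radon-Nikodym density of the restrictions. *)
pose f : Omega -> OG := id.
have mf : measurable_fun setT f by move=> _ B mB; rewrite setTI; exact: Gsub.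
pose fm : {mfun Omega >-> OG} := HB.pack f (isMeasurableFun.Build _ _ _ _ _ mf).
pose nu0 : {charge set OG -> \bar R} := pushforward (induced_charge iX) fm.
pose nu := nu0 mf.
pose mu : probability OG R := distribution Pr fm.
have numu : nu `<< mu.
  apply/null_content_dominatesP => A mA mA0.
  rewrite /nu /= /pushforward /induced_charge.
  rewrite (@ae_eq_integralW _ _ _ Pr _ _ (cst 0)) ?integral0//.
  by exists A; split; [exact: (Gsub mA)|exact: mA0|move=> w /= /not_implyP[]].
exists (Radon_Nikodym nu mu).
have iRN := Radon_Nikodym_integrable numu.
split; first by apply/meas_wrtP; exact: (measurable_int _ iRN).
move=> A GA.
have -> : \int[Pr]_(w in A) X w = nu A by [].
rewrite (Radon_Nikodym_integral numu GA) /mu /=.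
rewrite /distribution (@integral_pushforward _ _ _ _ _ fm)//.
apply: (@integrableS _ _ _ _ setT) => //; first exact: Gsub.
have [mRN lRN] := integrableP _ _ _ iRN.
apply/integrableP; split; first exact: (measurableT_comp mRN mf).
rewrite (le_lt_trans _ lRN)//.
by rewrite /mu/= /distribution (@ge0_integral_pushforward _ _ _ _ _ fm)//; exact: measurableT_comp.
Qed.

Lemma ce_ge_cst (c : R) (X Y : Omega -> \bar R) : condexp Pr G X Y ->
  {ae Pr, forall w, c%:E <= X w} -> {ae Pr, forall w, c%:E <= Y w}.
Proof. exact: ce_leT (ce_cst _). Qed.

Lemma ce_shift (c : R) (X Y : Omega -> \bar R) : measurable_fun setT X ->
  (forall w, 0 <= X w) -> condexp Pr G X Y ->
  condexp Pr G (fun w => X w + c%:E) (fun w => Y w + c%:E).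
Proof.
move=> mX X0 cXY; have [mY hY] := cXY; split.
  by apply/meas_wrtP; apply: emeasurable_funD; [exact/meas_wrtP|exact: measurable_cst].
move=> A GA; have mA := Gsub GA.
have Y0 : {ae Pr, forall w, 0 <= Y w} by apply: (ce_ge_cst cXY); exact: aeW.
have mY' := meas_wrt_measurable mY.
rewrite [RHS]integral_shift// -hY//.
have YE : {ae Pr, forall w, Y w = maxe (Y w) 0}.
  by apply: filterS Y0 => w Y0; rewrite max_l.
rewrite (@ae_eq_integralW _ _ _ Pr _ Y (fun w => maxe (Y w) 0)); last first.
  by apply: filterS YE => w + _.
rewrite -integral_shift//; last 2 first.
- by apply: measurable_maxe => //; exact: measurable_cst.
- by move=> w; rewrite le_max lexx orbT.
by apply: ae_eq_integralW; apply: filterS YE => w <-.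
Qed.

Lemma ce_mono0 (X_ : nat -> Omega -> \bar R) (X : Omega -> \bar R)
    (Y_ : nat -> Omega -> \bar R) :
  (forall n, measurable_fun setT (X_ n)) -> (forall n w, 0 <= X_ n w) ->
  (forall w, nondecreasing_seq (X_ ^~ w)) ->
  (forall w, X_ n w @[n --> \oo] --> X w) ->
  (forall n, condexp Pr G (X_ n) (Y_ n)) ->
  exists2 L, condexp Pr G X L & {ae Pr, forall w, Y_ n w @[n --> \oo] --> L w}.
Proof.
move=> mX X0 ndX cX cY.
(* The versions [Y_ n] increase only almost surely. Their running maxima, started at 0, increase
   everywhere, so the limit exists at every point and is [G]-measurable. *)
pose Z := fix Z n := if n is k.+1 then fun w => maxe (Z k w) (Y_ k.+1 w) else fun w => maxe (Y_ 0%N w) 0.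
have mZ n : measurable_fun [set: OG] (Z n : OG -> _).
  elim: n => [|n IH] /=; first by apply: measurable_maxe; [exact: ce_meas (cY 0%N)|exact: measurable_cst].
  by apply: measurable_maxe => //; exact: ce_meas (cY n.+1).
have ndZ w : nondecreasing_seq (Z ^~ w).
  by apply/nondecreasing_seqP => n /=; rewrite le_max lexx.
have Z0 n w : 0 <= Z n w.
  by apply: le_trans (ndZ w _ _ (leq0n n)); rewrite /= le_max lexx orbT.
have ZY : {ae Pr, forall w, forall n, Z n w = Y_ n w}.
  have h1 : {ae Pr, forall w, forall n, Y_ n w <= Y_ n.+1 w}.
    apply: ae_forall_count => n; apply: (ce_leT (cY n) (cY n.+1)); apply: aeW => w; exact: ndX.
  have h2 : {ae Pr, forall w, 0 <= Y_ 0%N w}.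
    by apply: (ce_ge_cst (cY 0%N)); exact: aeW.
  apply: filterS2 h1 h2 => w h1 h2; elim => [|n IH] /=; first by rewrite max_l.
  by rewrite IH max_r.
pose L w := limn (Z ^~ w).
have cL w : Z n w @[n --> \oo] --> L w by apply: ereal_nondecreasing_is_cvgn; exact: ndZ.
have mL : measurable_fun [set: OG] (L : OG -> _) by apply: (emeasurable_fun_cvg _ _ mZ) => w _; exact: cL.
exists L; last by apply: filterS ZY => w hw; have := cL w; under eq_fun do rewrite hw.
split; first exact/meas_wrtP.
move=> A GA; have mA := Gsub GA.
have XE : X = fun w => limn (X_ ^~ w) by apply/funext => w; apply/esym/cvg_lim => //; exact: cX.
have mXA n : measurable_fun A (X_ n) by apply: measurable_funTS; exact: mX.
have mZA n : measurable_fun A (Z n).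
  by apply: measurable_funTS; apply: meas_wrt_measurable; exact/meas_wrtP.
rewrite XE (monotone_convergence Pr mA mXA) //.
rewrite (monotone_convergence Pr mA mZA) //.
congr (limn _); apply/funext => n; rewrite -(proj2 (cY n))//.
by apply: ae_eq_integralW; apply: filterS ZY => w + _.
Qed.

Lemma ce_exists0 (X : Omega -> \bar R) :
  measurable_fun setT X -> (forall w, 0 <= X w) -> exists Y, condexp Pr G X Y.
Proof.
move=> mX X0; pose X_ n w := mine (X w) n%:R%:E.
have mX_ n : measurable_fun setT (X_ n) by apply: measurable_mine => //; exact: measurable_cst.
have X_0 n w : 0 <= X_ n w by rewrite le_min X0 lee_fin/=.
have ndX w : nondecreasing_seq (X_ ^~ w).
  move=> n m nm; rewrite /X_ le_min ge_min lexx/= ge_min lee_fin ler_nat nm orbT//.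
have cX w : X_ n w @[n --> \oo] --> X w.
  rewrite /X_; have := X0 w; case: (X w) => [r _|_|//].
  - apply: cvg_near_cst; near=> n; rewrite min_l// lee_fin.
    by near: n; exact: nbhs_infty_ger.
  - under eq_fun do rewrite min_r ?leey//.
    by apply/cvgenyP; exact: cvg_id.
have /choice[Y_ cY] n : exists Y, condexp Pr G (X_ n) Y.
  apply: (@ce_exists_bounded _ n%:R) => // w.
  by rewrite gee0_abs// /X_ ge_min lexx orbT.
have [L hL _] := ce_mono0 mX_ X_0 ndX cX cY.
by exists L.
Unshelve. all: by end_near.
Qed.

Lemma ce_exists (X : Omega -> \bar R) (c : R) :
  measurable_fun setT X -> (forall w, c%:E <= X w) -> exists Y, condexp Pr G X Y.
Proof.
move=> mX Xc; pose X' w := X w - c%:E.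
have mX' : measurable_fun setT X' by apply: emeasurable_funB => //; exact: measurable_cst.
have X'0 w : 0 <= X' w by rewrite sube_ge0.
have [Y hY] := ce_exists0 mX' X'0.
exists (fun w => Y w + c%:E).
suff -> : X = fun w => X' w + c%:E by exact: ce_shift.
by apply/funext => w; rewrite /X' subeK.
Qed.

Lemma ce_mono (c : R) (X_ : nat -> Omega -> \bar R) (X : Omega -> \bar R)
    (Y_ : nat -> Omega -> \bar R) (Y : Omega -> \bar R) :
  (forall n, measurable_fun setT (X_ n)) -> (forall n w, c%:E <= X_ n w) ->
  (forall w, nondecreasing_seq (X_ ^~ w)) ->
  (forall w, X_ n w @[n --> \oo] --> X w) ->
  (forall n, condexp Pr G (X_ n) (Y_ n)) -> condexp Pr G X Y ->
  {ae Pr, forall w, Y_ n w @[n --> \oo] --> Y w}.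
Proof.
move=> mX Xc ndX cX cY cXY.
pose X' n w := X_ n w - c%:E.
have mX' n : measurable_fun setT (X' n) by apply: emeasurable_funB => //; exact: measurable_cst.
have X'0 n w : 0 <= X' n w by rewrite sube_ge0.
have ndX' w : nondecreasing_seq (X' ^~ w) by move=> n m nm; apply: leeB => //; exact: ndX.
have cX' w : X' n w @[n --> \oo] --> X w - c%:E.
  by apply: cvgeD => //; [exact: fin_num_adde_defl|exact: cvg_cst].
have /choice[Z cZ] n : exists Z, condexp Pr G (X' n) Z by exact: ce_exists0.
have [L hL aeL] := ce_mono0 mX' X'0 ndX' cX' cZ.
have EL : {ae Pr, forall w, Y w = L w + c%:E}.
  have X0 w : 0 <= X w - c%:E.
    by rewrite -(cvg_lim _ (cX' w))//; apply: lime_ge; [apply/cvg_ex; eexists; exact: cX'|exact: nearW].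
  have mXX : measurable_fun setT (fun w => X w - c%:E).
    by apply: (emeasurable_fun_cvg _ _ mX') => w _; exact: cX'.
  apply: (ce_eq cXY (ce_shift c mXX X0 hL)); apply: aeW => w.
  by rewrite subeK.
have EZ : {ae Pr, forall w, forall n, Y_ n w = Z n w + c%:E}.
  apply: ae_forall_count => n.
  apply: (ce_eq (cY n) (ce_shift c (mX' n) (X'0 n) (cZ n))); apply: aeW => w.
  by rewrite subeK.
apply: filterS3 EL EZ aeL => w -> e h; under eq_fun do rewrite e.
by apply: cvgeD => //; [exact: fin_num_adde_defl|exact: cvg_cst].
Qed.

Lemma ce_add0 (X X' Y Y' : Omega -> \bar R) :
  measurable_fun setT X -> measurable_fun setT X' ->
  (forall w, 0 <= X w) -> (forall w, 0 <= X' w) ->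
  condexp Pr G X Y -> condexp Pr G X' Y' ->
  condexp Pr G (fun w => X w + X' w) (fun w => Y w + Y' w).
Proof.
move=> mX mX' X0 X'0 cY cY'; split.
  by apply/meas_wrtP; apply: emeasurable_funD; [exact: ce_meas cY|exact: ce_meas cY'].
move=> A GA; have mA := Gsub GA.
have pos Z Z' : condexp Pr G Z Z' -> (forall w, 0 <= Z w) -> {ae Pr, forall w, Z' w = maxe (Z' w) 0}.
  move=> cZ Z0; have : {ae Pr, forall w, 0 <= Z' w} by apply: (ce_ge_cst cZ); exact: aeW.
  by apply: filterS => w h; rewrite max_l.
have mp Z Z' : condexp Pr G Z Z' -> measurable_fun A (fun w => maxe (Z' w) 0).
  move=> [mZ _]; apply: measurable_funTS; apply: measurable_maxe; last exact: measurable_cst.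
  exact: meas_wrt_measurable.
rewrite (@ae_eq_integralW _ _ _ Pr _ _ (fun w => maxe (Y w) 0 + maxe (Y' w) 0)); last first.
  by apply: filterS2 (pos _ _ cY X0) (pos _ _ cY' X'0) => w <- <-.
rewrite !ge0_integralD//; try exact: measurable_funTS; try exact: (mp _ _ cY); try exact: (mp _ _ cY').
- rewrite -(proj2 cY)// -(proj2 cY')//; congr (_ + _); apply: ae_eq_integralW.
  + by apply: filterS (pos _ _ cY X0) => w <-.
  + by apply: filterS (pos _ _ cY' X'0) => w <-.
- by move=> w _; rewrite le_max lexx orbT.
- by move=> w _; rewrite le_max lexx orbT.
Qed.

Lemma ce_add (c : R) (X X' Y Y' : Omega -> \bar R) :
  measurable_fun setT X -> measurable_fun setT X' ->
  (forall w, c%:E <= X w) -> (forall w, c%:E <= X' w) ->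
  condexp Pr G X Y -> condexp Pr G X' Y' ->
  exists2 Z, condexp Pr G (fun w => X w + X' w) Z & {ae Pr, forall w, Z w = Y w + Y' w}.
Proof.
move=> mX mX' Xc X'c cY cY'.
have mB (Z : Omega -> \bar R) : measurable_fun setT Z -> measurable_fun setT (fun w => Z w - c%:E).
  by move=> mZ; apply: emeasurable_funB => //; exact: measurable_cst.
have pB (Z : Omega -> \bar R) : (forall w, c%:E <= Z w) -> forall w : Omega, 0 <= Z w - c%:E.
  by move=> h w; rewrite sube_ge0.
have [V cV] := ce_exists0 (mB _ mX) (pB _ Xc).
have [V' cV'] := ce_exists0 (mB _ mX') (pB _ X'c).
have cVV := ce_add0 (mB _ mX) (mB _ mX') (pB _ Xc) (pB _ X'c) cV cV'.
have eY : {ae Pr, forall w, Y w = V w + c%:E}.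
  by apply: (ce_eq cY (ce_shift c (mB _ mX) (pB _ Xc) cV)); apply: aeW => w; rewrite subeK.
have eY' : {ae Pr, forall w, Y' w = V' w + c%:E}.
  by apply: (ce_eq cY' (ce_shift c (mB _ mX') (pB _ X'c) cV')); apply: aeW => w; rewrite subeK.
have E (x y : \bar R) : (x + c%:E) + (y + c%:E) = x + y + (c + c)%:E.
  by rewrite EFinD addeACA.
exists (fun w => V w + V' w + (c + c)%:E).
  suff -> : (fun w => X w + X' w) = (fun w => (X w - c%:E) + (X' w - c%:E) + (c + c)%:E).
    apply: ce_shift => //; first by apply: emeasurable_funD; exact: mB.
    by move=> w; apply: adde_ge0; exact: pB.
  by apply/funext => w; rewrite -E !subeK.
by apply: filterS2 eY eY' => w -> ->; rewrite E.
Qed.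

End CondExp.

(** * Optimized certainty equivalents *)

Section Loss.
Context {R : realType}.
Implicit Types (H : R -> \bar R) (m e C s : R).

(* [loss_up] is the finiteness of the conjugate at [1 + e], with [C] its value. *)
Record loss H m e C (s0 : R) : Prop := Loss {
  loss_e : 0 < e;
  loss_lb : forall s, (m%:E <= H s)%E;
  loss_up : forall s, (((1 + e) * s - C)%:E <= H s)%E;
  loss_id : forall s, (s%:E <= H s)%E;
  loss_nd : nondecreasing_ext H;
  loss_lc : forall z (u : nat -> R), nondecreasing_seq u -> u n @[n --> \oo] --> z ->
    H (u n) @[n --> \oo] --> H z;
  loss_fin : (H s0 < +oo)%E }.

Lemma nondecreasing_ext_measurable H : nondecreasing_ext H -> measurable_fun setT H.
Proof.
move=> nd; apply: (measurability _ (ErealGenOInfty.measurableE R)).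
move=> /= _ [_ [a ->]] <-; apply: measurableI => //; apply: is_interval_measurable.
move=> x y /= + _ z /andP[xz _]; rewrite !in_itv/= !andbT => /lt_le_trans; apply.
exact: nd.
Qed.

(** For a nondecreasing function lower semicontinuity amounts to left continuity: a limit strictly
    below [H z] would contradict the neighbourhood of [z] on which [H] exceeds a rational between
    the two. *)
Lemma lsc_left_cvg H : lower_semicontinuous H -> nondecreasing_ext H ->
  forall z (u : nat -> R), nondecreasing_seq u -> u n @[n --> \oo] --> z ->
  H (u n) @[n --> \oo] --> H z.
Proof.
move=> lsc nd z u ndu uz.
have ndHu : nondecreasing_seq (H \o u) by move=> i j ij; apply: nd; exact: ndu.
have uleq n : u n <= z.
  rewrite -(cvg_lim _ uz)//; apply: nondecreasing_cvgn_le => //.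
  by apply/cvg_ex; exists z.
have := ereal_nondecreasing_cvgn ndHu.
set l := ereal_sup _ => cl.
suff -> : H z = l by [].
apply/eqP; rewrite eq_le; apply/andP; split; last first.
  by apply: ge_ereal_sup => _ [n _ <-]; apply: nd.
rewrite leNgt; apply/negP => /[dup] lH.
move=> /ereal_between_rat [p [p12 lp pH]].
have lt2 : ((ratr p.1)%:E < H z)%E.
  by apply: lt_le_trans pH; rewrite lte_fin ltr_rat.
have [V nV hV] := lsc _ _ lt2.
have : \forall n \near \oo, V (u n) by exact: uz.
move=> [k _ hk]; have := hV _ (hk k (leqnn k)).
apply/negP; rewrite -leNgt (le_trans _ lp)//.
by apply: ereal_sup_ubound; exists k.
Qed.

Lemma OCE_loss_loss H : OCE_loss H -> interior (dom_ext (conj_ext H)) 1 ->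
  (exists m, forall s, (m%:E <= H s)%E) ->
  exists m e C s0, loss H m e C s0.
Proof.
move=> [cH lscH ndH H1] i1 [m hm].
have Hid s : (s%:E <= H s)%E.
  have : ((1 * s)%:E - H s <= 0)%E by rewrite -H1; apply: ereal_sup_ubound; exists s.
  have := hm s; case: (H s) => [r| |]//=; rewrite ?leey// mul1r -EFinB !lee_fin => _; lra.
have [s0 hs0] : exists s0, (H s0 < +oo)%E.
  apply: contrapT => h; have : (conj_ext H 1 <= -oo)%E.
    apply: ge_ereal_sup => _ [s _ <-]; have := h; case E : (H s) => [r| |]//=.
    - by move=> h0; exfalso; apply: h; exists s; rewrite E ltry.
    - by move: (hm s); rewrite E.
  by rewrite H1.
(* Interiority of [1] is used only to its right: half the radius of the ball keeps [1 + e] strictly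
   inside it. *)
have [e e0 he] : exists2 e : R, 0 < e & dom_ext (conj_ext H) (1 + e).
  move/nbhs_ballP : i1 => [e /= e0 he]; exists (e / 2); first by rewrite divr_gt0.
  apply: he; rewrite /ball/= opprD addrA subrr add0r normrN gtr0_norm ?divr_gt0//.
  by rewrite ltr_pdivrMr// ltr_pMr// ltr1n.
have [C hC] : exists C : R, conj_ext H (1 + e) = C%:E.
  have : (((1 + e) * s0)%:E - H s0 <= conj_ext H (1 + e))%E by apply: ereal_sup_ubound; exists s0.
  move: he; rewrite /dom_ext/=; case: (conj_ext H (1 + e)) => [r| |]//=.
    by move=> _ _; exists r.
  have := hm s0; move: hs0; case: (H s0) => [r| |]//=.
exists m, e, C, s0; split => //; last exact: lsc_left_cvg.
move=> s; have : (((1 + e) * s)%:E - H s <= C%:E)%E by rewrite -hC; apply: ereal_sup_ubound; exists s.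
have := hm s; case: (H s) => [r| |]//=; rewrite ?leey// -EFinB !lee_fin => _; lra.
Qed.

(** This is the half of [conj_ext H 1 = 0] that [s <= H s] does not express. It makes the certainty
    equivalent of a known amount equal to that amount. *)
Lemma OCE_loss_tight H : OCE_loss H -> forall k : R, 0 < k -> exists s, (H s < (s + k)%:E)%E.
Proof.
move=> [cH lscH ndH H1] k k0; apply: contrapT => h.
have : (conj_ext H 1 <= (- k)%:E)%E.
  apply: ge_ereal_sup => _ [s _ <-].
  have : ((s + k)%:E <= H s)%E by rewrite leNgt; apply/negP => hs; apply: h; exists s.
  case: (H s) => [r| |]//=; rewrite ?leNye// mul1r -EFinB !lee_fin => h'; lra.
by rewrite H1 lee_fin; move: k0; lra.
Qed.

End Loss.

Lemma measurable_bigmaxe d (T : measurableType d) (R : realType) (I : Type) (l : seq I)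
    (f : I -> T -> \bar R) : (forall i, measurable_fun setT (f i)) ->
  measurable_fun setT (fun x => \big[maxe/-oo%E]_(i <- l) f i x).
Proof.
move=> mf; elim: l => [|i l IH].
  have -> : (fun x => \big[maxe/-oo%E]_(i <- [::]) f i x) = cst -oo%E.
    by apply/funext => x; rewrite big_nil.
  exact: measurable_cst.
have -> : (fun x => \big[maxe/-oo%E]_(j <- i :: l) f j x) =
    (fun x => maxe (f i x) (\big[maxe/-oo%E]_(j <- l) f j x)).
  by apply/funext => x; rewrite big_cons.
exact: measurable_maxe.
Qed.

Section OneStepOCE.
Context d (Omega : measurableType d) (R : realType) (Pr : probability Omega R).
Context (N : nat) (P : nat -> Omega -> 'rV[R]_N) (t : nat).
Hypothesis Fsub : Filt P t `<=` (@measurable _ Omega).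
Local Notation F := (Filt P t).
Local Open Scope ereal_scope.

(** Approximation from below suits a nondecreasing loss: for [q <= s] the conditional loss at [q] is
    almost surely at most the one at [s], so bounds at the countably many rationals control every
    real [s], and even a random one. *)
Lemma rat_approx (s : R) (v y : \bar R) :
  (forall q : rat, (ratr q <= s)%R -> (ratr q)%:E - v <= y) -> s%:E - v <= y.
Proof.
move=> h; have near (e : R) : (0 < e)%R -> exists2 q : rat, (s - e < ratr q)%R & (ratr q <= s)%R.
  move=> e0; have [|q /andP[/= + +]] := @rat_in_itvoo _ (s - e)%R s; first by lra.
  by rewrite !bnd_simp => q1 /ltW q2; exists q.
case: v h => [v| |] h; last 2 first.
- by rewrite addeNy leNye.
- by have [q _ /h] := near 1%R ltr01; rewrite !addey.
apply/lee_addgt0Pr => e e0; have [q q1 q2] := near e e0.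
apply: le_trans (leeD2r e%:E (h _ q2)).
by rewrite -EFinB -EFinB -EFinD lee_fin; lra.
Qed.

Lemma ce_loss_exists H m e C s0 (X : Omega -> R) : loss H m e C s0 ->
  measurable_fun setT X -> exists V, condexp Pr F (fun w => H (X w)) V.
Proof.
move=> lH mX; apply: (@ce_exists _ _ _ Pr _ Fsub _ m) => [|w]; last exact: loss_lb lH _.
by apply: measurableT_comp mX; apply: nondecreasing_ext_measurable; exact: loss_nd lH.
Qed.

Lemma OCE1_le H (X X' : Omega -> R) (Y Y' : Omega -> \bar R) :
  nondecreasing_ext H -> {ae Pr, forall w, (X w <= X' w)%R} ->
  OCE1 Pr P H t X Y -> OCE1 Pr P H t X' Y' -> {ae Pr, forall w, Y w <= Y' w}.
Proof.
move=> nd XX' [V [cV [mY _ leastY]]] [V' [cV' [mY' ubY' _]]].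
apply: leastY; first exact: (meas_wrt_measurable Fsub).
move=> _ [s _ <-].
have VV' : {ae Pr, forall w, V' s w <= V s w}.
  apply: (ce_leT Fsub (cV' s) (cV s)).
  by apply: filterS XX' => w le; apply: nd; rewrite lerB.
have := ubY' _ (ex_intro2 _ _ s I erefl).
by apply: filterS2 VV' => w le; apply: le_trans; apply: leeB.
Qed.

Lemma OCE1_ae H (X X' : Omega -> R) (Y : Omega -> \bar R) :
  {ae Pr, forall w, X w = X' w} -> OCE1 Pr P H t X Y -> OCE1 Pr P H t X' Y.
Proof.
move=> XX' [V [cV eY]]; exists V; split => // s; apply: ce_ae (cV s).
by apply: filterS XX' => w ->.
Qed.

Definition trunc n m' (x : \bar R) : R := fine (maxe (mine x n%:R%:E) (- m'%:R)%:E).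

Lemma truncE n m' x : (trunc n m' x)%:E = maxe (mine x n%:R%:E) (- m'%:R)%:E.
Proof.
rewrite fineK// fin_numE -ltNye -ltey lt_max ltNyr orbT/=.
by rewrite gt_max ltry gt_min ltry orbT.
Qed.

Lemma trunc_le n m' x y : x <= y -> (trunc n m' x <= trunc n m' y)%R.
Proof.
move=> xy; rewrite -lee_fin !truncE ge_max !le_max lexx orbT andbT.
by apply/orP; left; rewrite le_min !ge_min xy lexx orbT.
Qed.

Lemma trunc_bnd n m' x : (- m'%:R <= trunc n m' x <= n%:R)%R.
Proof.
rewrite -!lee_fin truncE le_max lexx orbT/= ge_max ge_min lexx orbT/= lee_fin.
by rewrite (@le_trans _ _ 0%R)// lerNl oppr0.
Qed.

Lemma measurable_trunc n m' (X : Omega -> \bar R) : measurable_fun setT X ->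
  measurable_fun setT (fun w => trunc n m' (X w)).
Proof.
move=> mX; apply/measurable_EFinP.
rewrite (_ : EFin \o _ = (fun w => maxe (mine (X w) n%:R%:E) (- m'%:R)%:E)); last first.
  by apply/funext => w /=; rewrite truncE.
by apply: measurable_maxe; [apply: measurable_mine|]; rewrite //; exact: measurable_cst.
Qed.

Lemma OCE1ext_le H (X X' Y Y' : Omega -> \bar R) :
  nondecreasing_ext H -> {ae Pr, forall w, X w <= X' w} ->
  OCE1ext Pr P H t X Y -> OCE1ext Pr P H t X' Y' -> {ae Pr, forall w, Y w <= Y' w}.
Proof.
move=> nd XX' [V [W [hV hW hY]]] [V' [W' [hV' hW' hY']]].
have VV' : {ae Pr, forall w, forall nm : nat * nat, V nm.1 nm.2 w <= V' nm.1 nm.2 w}.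
  apply: ae_forall_count => nm; apply: (OCE1_le nd _ (hV _ _) (hV' _ _)).
  by apply: filterS XX' => w; exact: trunc_le.
have WW : {ae Pr, forall w, forall n, V n m w @[m --> \oo] --> W n w} by exact: ae_forall_count.
have WW' : {ae Pr, forall w, forall n, V' n m w @[m --> \oo] --> W' n w} by exact: ae_forall_count.
have : {ae Pr, forall w, forall n, W n w <= W' n w}.
  apply: filterS3 VV' WW WW' => w h1 h2 h3 n.
  by apply: lee_cvg_to (h2 n) (h3 n) _; apply: nearW => m; exact: (h1 (n, m)).
move: hY hY'; apply: filterS3 => w h1 h2 h3.
by apply: lee_cvg_to h1 h2 _; apply: nearW => n; exact: h3.
Qed.

Lemma OCE1ext_ae H (X X' Y Y' : Omega -> \bar R) :
  {ae Pr, forall w, X w = X' w} -> {ae Pr, forall w, Y w = Y' w} ->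
  OCE1ext Pr P H t X Y -> OCE1ext Pr P H t X' Y'.
Proof.
move=> XX' YY' [V [W [hV hW hY]]]; exists V, W; split => //.
- by move=> n m; apply: OCE1_ae (hV n m); apply: filterS XX' => w ->.
- by move: YY' hY; apply: filterS2 => w ->.
Qed.

Lemma OCE1ext_unique H (X Y Y' : Omega -> \bar R) : nondecreasing_ext H ->
  OCE1ext Pr P H t X Y -> OCE1ext Pr P H t X Y' -> {ae Pr, forall w, Y w = Y' w}.
Proof.
move=> nd hY hY'; have XX : {ae Pr, forall w, X w <= X w} by exact: aeW.
have := OCE1ext_le nd XX hY hY'; have := OCE1ext_le nd XX hY' hY.
by apply: filterS2 => w a b; apply/eqP; rewrite eq_le a b.
Qed.

(** [Y] is only an almost sure double limit and need not be measurable; the iterated upper limit of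
    the truncated values is a measurable version. *)
Lemma OCE1ext_meas H (X Y : Omega -> \bar R) : OCE1ext Pr P H t X Y ->
  exists2 Y', meas_wrt F Y' & {ae Pr, forall w, Y w = Y' w}.
Proof.
move=> [V [W [hV hW hY]]].
pose W' n w := limn_esup (V n ^~ w); pose Y' w := limn_esup (W' ^~ w).
exists Y'.
  apply/meas_wrtP; apply: measurable_fun_limn_esup => n.
  apply: measurable_fun_limn_esup => m; apply/meas_wrtP.
  by have [? [_ []]] := hV n m.
have WW : {ae Pr, forall w, forall n, V n m w @[m --> \oo] --> W n w} by exact: ae_forall_count.
apply: filterS2 WW hY => w h1 h2; rewrite /Y'.
have -> : W' ^~ w = W ^~ w by apply/funext => n; rewrite /W' (cvg_limn_einf_sup (h1 n)).2.
by rewrite (cvg_limn_einf_sup h2).2.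
Qed.

(** The definition takes constants [s] only. A random [s] is reached by comparing with each rational
    [q] on the event [q <= s], which belongs to [F]. Cash invariance enters the development through
    this. *)
Lemma OCE1_lower H (X s : Omega -> R) (V Y : Omega -> \bar R) : nondecreasing_ext H ->
  OCE1 Pr P H t X Y -> meas_wrt F s ->
  condexp Pr F (fun w => H (s w - X w)%R) V ->
  {ae Pr, forall w, (s w)%:E - V w <= Y w}.
Proof.
move=> nd [V0 [cV0 [mY ubY _]]] ms cV.
have h1 : {ae Pr, forall w, forall q : rat, (ratr q <= s w)%R -> V0 (ratr q) w <= V w}.
  apply: ae_forall_count => q.
  have Gq : F [set w | (ratr q <= s w)%R].
    rewrite (_ : [set w | _] = s @^-1` `[ratr q, +oo[%classic); first exact: ms.
    by apply/seteqP; split => w /=; rewrite in_itv/= andbT.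
  apply: (ce_le Fsub (cV0 _) cV Gq); apply: aeW => w /= qs.
  by apply: nd; rewrite lerB.
have h2 : {ae Pr, forall w, forall q : rat, (ratr q)%:E - V0 (ratr q) w <= Y w}.
  by apply: ae_forall_count => q; apply: ubY; exists (ratr q).
apply: filterS2 h1 h2 => w h1 h2; apply: rat_approx => q qs.
by apply: le_trans (h2 q); apply: leeB => //; exact: h1.
Qed.

Lemma OCE1_upper H (X : Omega -> R) (Y B : Omega -> \bar R) :
  OCE1 Pr P H t X Y -> measurable_fun setT B ->
  (forall (s : R) V, condexp Pr F (fun w => H (s - X w)%R) V ->
    {ae Pr, forall w, s%:E - V w <= B w}) -> {ae Pr, forall w, Y w <= B w}.
Proof. by move=> [V [cV [_ _ least]]] mB h; apply: least => // _ [s _ <-]; apply: h (cV s). Qed.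

Lemma OCE1_exists H m e C s0 (X : Omega -> R) : loss H m e C s0 ->
  measurable_fun setT X -> exists Y, OCE1 Pr P H t X Y.
Proof.
move=> lH mX; have nd := loss_nd lH.
have /choice[V cV] s : exists V, condexp Pr F (fun w => H (s - X w)%R) V.
  by apply: (@ce_loss_exists H m e C s0 (fun w => s - X w)%R lH); apply: measurable_funB.
(* The essential supremum over the reals is realised as a supremum over an enumeration of the
   rationals; [-oo] at codes of no rational does not affect it. *)
pose f n w := if @unpickle rat n is Some q then (ratr q)%:E - V (ratr q) w else -oo.
pose Y w := esups (f ^~ w) 0%N.
have Yub (q : rat) w : (ratr q)%:E - V (ratr q) w <= Y w.
  by apply: ereal_sup_ubound; exists (pickle q) => //; rewrite /f pickleK.
have mY : meas_wrt F Y.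
  apply/meas_wrtP; apply: measurable_fun_esups => n; rewrite /f; case: unpickle => [q|].
    by apply: emeasurable_funB; [exact: measurable_cst|exact: ce_meas (cV _)].
  exact: measurable_cst.
exists Y, V; split => //; split => //.
- move=> _ [s _ <-].
  have h1 : {ae Pr, forall w, forall q : rat, (ratr q <= s)%R -> V (ratr q) w <= V s w}.
    apply: ae_forall_count => q; have [qs|] := boolP (ratr q <= s)%R; last by move=> _; exact: aeW.
    suff : {ae Pr, forall w, V (ratr q) w <= V s w} by apply: filterS => w + _.
    by apply: (ce_leT Fsub (cV _) (cV _)); apply: aeW => w; apply: nd; rewrite lerB.
  apply: filterS h1 => w h1; apply: rat_approx => q qs.
  by apply: le_trans (Yub q w); apply: leeB => //; exact: h1.
- move=> W mW ubW.
  have : {ae Pr, forall w, forall q : rat, (ratr q)%:E - V (ratr q) w <= W w}.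
    by apply: ae_forall_count => q; apply: ubW; exists (ratr q).
  apply: filterS => w h; apply: ge_ereal_sup => _ [n _ <-]; rewrite /f.
  by case: unpickle => [q|]; [exact: h|exact: leNye].
Qed.

(** For bounded [X] the truncations are stationary from an integer [k >= b] on, so the double limit
    is the value at levels [(k, k)]. That value is clamped to obtain a version that is real and
    bounded everywhere. *)
Lemma OCE1ext_exists H m e C s0 (X : Omega -> \bar R) (b : R) : loss H m e C s0 ->
  measurable_fun setT X -> {ae Pr, forall w, `|X w| <= b%:E} ->
  exists Y : Omega -> R, [/\ meas_wrt F Y, exists b', forall w, (`|Y w| <= b')%R,
    OCE1ext Pr P H t X (EFin \o Y) &
    forall (s : Omega -> R) V, meas_wrt F s ->
      condexp Pr F (fun w => H (s w - fine (X w))%R) V ->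
      {ae Pr, forall w, (s w)%:E - V w <= (Y w)%:E}].
Proof.
move=> lH mX Xb; have nd := loss_nd lH.
have /choice[V hV] (nm : nat * nat) : exists Y, OCE1 Pr P H t (fun w => trunc nm.1 nm.2 (X w)) Y.
  by apply: (OCE1_exists lH); exact: measurable_trunc.
have [k kb] : exists k : nat, (b <= k%:R)%R.
  by exists (Num.truncn `|b|).+1; rewrite (le_trans (ler_norm b))// ltW// truncnS_gt.
have Xk : {ae Pr, forall w, (- k%:R)%:E <= X w <= k%:R%:E}.
  apply: filterS Xb => w; case: (X w) => [r| |]; rewrite ?lee_fin//= => rb.
  by have := le_trans rb kb; rewrite ler_norml.
have Tm n m' : (k <= m')%N -> {ae Pr, forall w, trunc n m' (X w) = trunc n k (X w)}.
  move=> km; apply: filterS Xk => w /andP[h1 h2]; apply/EFin_inj.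
  rewrite !truncE; have h : (- k%:R)%:E <= mine (X w) n%:R%:E :> \bar R.
    by rewrite le_min h1 lee_fin (@le_trans _ _ 0%R)// lerNl oppr0.
  rewrite !max_l//; apply: le_trans h; by rewrite lee_fin lerN2 ler_nat.
have Tn n : (k <= n)%N -> {ae Pr, forall w, trunc n k (X w) = trunc k k (X w)}.
  move=> km; apply: filterS Xk => w /andP[h1 h2]; apply/EFin_inj.
  by rewrite !truncE !min_l// (le_trans h2)// lee_fin ler_nat.
have Tf : {ae Pr, forall w, trunc k k (X w) = fine (X w)}.
  apply: filterS Xk => w /andP[h1 h2]; apply/EFin_inj; rewrite truncE min_l// max_l//.
  by rewrite fineK// fin_numElt (lt_le_trans _ h1) ?ltNyr// (le_lt_trans h2)// ltry.
have eqV n m' n' : {ae Pr, forall w, trunc n m' (X w) = trunc n' k (X w)} ->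
    {ae Pr, forall w, V (n, m') w = V (n', k) w}.
  move=> h; have h1 : {ae Pr, forall w, (trunc n m' (X w) <= trunc n' k (X w))%R} by apply: filterS h => w ->.
  have h2 : {ae Pr, forall w, (trunc n' k (X w) <= trunc n m' (X w))%R} by apply: filterS h => w ->.
  have := OCE1_le nd h1 (hV (_, _)) (hV (_, _)); have := OCE1_le nd h2 (hV (_, _)) (hV (_, _)).
  by apply: filterS2 => w a b'; apply/eqP; rewrite eq_le a b'.
have kk (w : Omega) := trunc_bnd k k (X w).
have /fineK lo_fin : H s0 \is a fin_num.
  by rewrite fin_numElt (lt_le_trans _ (loss_lb lH _)) ?ltNyr//= (loss_fin lH).
(* The value of the choice [s = s0 - k]: the truncated variable is at least [-k], so the argument of
   the loss is at most [s0], where [H] is finite. The bound above, [k], comes from [loss_id]. *)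
pose lo := (s0 - k%:R - fine (H s0))%R.
have Vlo : {ae Pr, forall w, lo%:E <= V (k, k) w}.
  have [V1 cV1] : exists V1, condexp Pr F (fun w => H ((s0 - k%:R) - trunc k k (X w))%R) V1.
    apply: (@ce_loss_exists H m e C s0 (fun w => (s0 - k%:R) - trunc k k (X w))%R lH).
    by apply: measurable_funB => //; exact: measurable_trunc.
  have mc : meas_wrt F (cst (s0 - k%:R)%R : Omega -> R) by apply/meas_wrtP; exact: measurable_cst.
  have V1le : {ae Pr, forall w, V1 w <= (fine (H s0))%:E}.
    apply: (ce_leT Fsub cV1 (ce_cst Pr _ _)).
    by apply: aeW => w /=; rewrite lo_fin; apply: nd; have /andP[] := kk w; lra.
  have := OCE1_lower nd (hV (k, k)) mc cV1; move: V1le; apply: filterS2 => w h1; apply: le_trans.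
  by rewrite /lo EFinB; apply: leeB.
have Vhi : {ae Pr, forall w, V (k, k) w <= k%:R%:E}.
  apply: (OCE1_upper (hV (k, k))); first exact: measurable_cst.
  move=> s V1 cV1; have : {ae Pr, forall w, (s - k%:R)%:E <= V1 w}.
    apply: (ce_ge_cst Fsub cV1); apply: aeW => w; apply: le_trans (loss_id lH _).
    by rewrite lee_fin; have /andP[] := kk w; lra.
  apply: filterS => w; case: (V1 w) => [r| |]//=; rewrite ?leNye//.
  by rewrite -EFinB !lee_fin; lra.
pose Y w := Num.max (Num.min (fine (V (k, k) w)) k%:R) lo.
have VY : {ae Pr, forall w, V (k, k) w = (Y w)%:E}.
  apply: filterS2 Vlo Vhi => w h1 h2.
  have fV : V (k, k) w \is a fin_num.
    by rewrite fin_numElt (lt_le_trans _ h1) ?ltNyr// (le_lt_trans h2)// ltry.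
  rewrite /Y; move: h1 h2; rewrite -(fineK fV)/= !lee_fin => h1 h2.
  by rewrite min_l// max_l.
exists Y; split.
- apply/meas_wrtP; apply: measurable_maxr; last exact: measurable_cst.
  apply: measurable_minr; last exact: measurable_cst.
  by apply: measurableT_comp => //; apply/meas_wrtP; have [? [_ []]] := hV (k, k).
- exists (k%:R + `|lo|)%R => w.
  have h1 : (lo <= Y w)%R by rewrite /Y le_max lexx orbT.
  have h2 : (Y w <= Num.max k%:R lo)%R by rewrite /Y ge_max !le_max ge_min lexx orbT lexx !orbT.
  have k0 : (0 <= k%:R :> R)%R by [].
  have l1 := ler_norm lo; have l2 := ler_norm (- lo)%R; rewrite normrN in l2.
  have l3 : (0 <= `|lo|)%R by [].
  rewrite ler_norml; apply/andP; split; first by lra.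
  by apply: (le_trans h2); rewrite ge_max; apply/andP; split; lra.
- exists (fun n m => V (n, m)), (fun n => V (n, k)); split.
  + by move=> n m'; exact: (hV (n, m')).
  + move=> n; have : {ae Pr, forall w, forall m', (k <= m')%N -> V (n, m') w = V (n, k) w}.
      apply: ae_forall_count => m'; have [km|_] := boolP (k <= m')%N; last exact: aeW.
      by apply: filterS (eqV _ _ _ (Tm n m' km)) => w + _.
    apply: filterS => w h; apply: cvg_near_cst; near=> m'; apply: h.
    by near: m'; exact: nbhs_infty_ge.
  + have : {ae Pr, forall w, forall n, (k <= n)%N -> V (n, k) w = V (k, k) w}.
      apply: ae_forall_count => n; have [km|_] := boolP (k <= n)%N; last exact: aeW.
      by apply: filterS (eqV _ _ _ (Tn n km)) => w + _.
    move: VY; apply: filterS2 => w /= <- h; apply: cvg_near_cst; near=> n; apply: h.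
    by near: n; exact: nbhs_infty_ge.
- move=> s V1 ms cV1.
  have cV1' : condexp Pr F (fun w => H (s w - trunc k k (X w))%R) V1.
    by apply: ce_ae cV1; apply: filterS Tf => w ->.
  by have := OCE1_lower nd (hV (k, k)) ms cV1'; move: VY; apply: filterS2 => w ->.
Unshelve. all: by end_near. Qed.

Lemma trunc_cvg n x : (trunc n m' x)%:E @[m' --> \oo] --> mine x n%:R%:E.
Proof.
under eq_fun do rewrite truncE.
case: x => [r| |].
- rewrite -EFin_min; set a := Num.min _ _; apply: cvg_near_cst; near=> m'.
  rewrite max_l// lee_fin lerNl (le_trans (ler_norm _))//.
  by near: m'; exact: nbhs_infty_ger.
- rewrite min_r ?leey//; apply: cvg_near_cst; apply: nearW => m'.
  by rewrite max_l// lee_fin (@le_trans _ _ 0%R)// lerNl oppr0.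
- rewrite min_l ?leNye//; under eq_fun do rewrite max_r ?leNye//.
  apply/cvgeNyPle => A; near=> m'; rewrite lee_fin lerNl (le_trans (ler_norm _))//.
  by near: m'; exact: nbhs_infty_ger.
Unshelve. all: by end_near. Qed.

Lemma mine_cvg (x : \bar R) : mine x n%:R%:E @[n --> \oo] --> x.
Proof.
case: x => [r| |].
- apply: cvg_near_cst; near=> n; rewrite min_l// lee_fin (le_trans (ler_norm _))//.
  by near: n; exact: nbhs_infty_ger.
- under eq_fun do rewrite min_r ?leey//.
  by apply/cvgenyP; exact: cvg_id.
- by apply: cvg_near_cst; apply: nearW => n; rewrite min_l ?leNye.
Unshelve. all: by end_near. Qed.

(** For known [X] the loss is its own conditional expectation. Then [loss_id] bounds the value by
    [X], and the random choices [X + s] with [H s] close to [s] approach [X]. *)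
Lemma OCE1_adapted H m e C s0 (X X' : Omega -> R) (Y : Omega -> \bar R) :
  loss H m e C s0 -> (forall k : R, (0 < k)%R -> exists s, H s < (s + k)%:E) ->
  meas_wrt F X' -> {ae Pr, forall w, X w = X' w} -> OCE1 Pr P H t X Y ->
  {ae Pr, forall w, Y w = (X w)%:E}.
Proof.
move=> lH tight mX' XX' hY; have mH := nondecreasing_ext_measurable (loss_nd lH).
have mX'' := proj1 (meas_wrtP _ _) mX'.
have up : {ae Pr, forall w, Y w <= (X' w)%:E}.
  apply: (OCE1_upper hY); first by apply/measurable_EFinP; exact: (meas_wrt_measurable Fsub).
  move=> s V cV.
  have c' : condexp Pr F (fun w => H (s - X' w)%R) (fun w => H (s - X' w)%R).
    apply: ce_self; apply/meas_wrtP; apply: measurableT_comp => //.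
    by apply: measurable_funB => //; exact: measurable_cst.
  have : {ae Pr, forall w, V w = H (s - X' w)%R}.
    by apply: (ce_eq Fsub cV c'); apply: filterS XX' => w ->.
  apply: filterS => w ->; have := loss_id lH (s - X' w)%R.
  case: (H _) => [r| |]//=; rewrite ?leNye// -EFinB !lee_fin; lra.
have lo : {ae Pr, forall w, forall k : nat, (X' w - k.+1%:R^-1)%:E <= Y w}.
  apply: ae_forall_count => k; have k0 : (0 < k.+1%:R^-1 :> R)%R by rewrite invr_gt0.
  have [s hs] := tight _ k0.
  have ms : meas_wrt F (fun w => X' w + s)%R.
    by apply/meas_wrtP; apply: measurable_funD => //; exact: measurable_cst.
  have cs : condexp Pr F (fun w => H (X' w + s - X w)%R) (cst (H s)).
    apply: ce_ae (ce_cst _ _ _); apply: filterS XX' => w ->.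
    by rewrite addrAC subrr add0r.
  have := OCE1_lower (loss_nd lH) hY ms cs; apply: filterS => w; apply: le_trans.
  move: hs (loss_lb lH s); rewrite /cst; case: (H s) => [r| |]//=.
  rewrite -EFinB lte_fin lee_fin => h _; rewrite lee_fin; move: h; move: (k.+1%:R^-1)%R => z; lra.
apply: filterS3 XX' up lo => w -> h1 h2; apply/eqP; rewrite eq_le h1/=.
apply/lee_addgt0Pr => k k0.
have [j hj] : exists j : nat, (j.+1%:R^-1 <= k)%R.
  exists (Num.truncn k^-1); rewrite -[leRHS]invrK lef_pV2 ?posrE ?invr_gt0//.
  by rewrite ltW// truncnS_gt.
rewrite -leeBlDr//; by apply: le_trans (h2 j); rewrite -EFinB lee_fin lerB.
Qed.

Lemma OCE1ext_adapted H m e C s0 (X X' Y : Omega -> \bar R) :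
  loss H m e C s0 -> (forall k : R, (0 < k)%R -> exists s, H s < (s + k)%:E) ->
  meas_wrt F X' -> {ae Pr, forall w, X w = X' w} -> OCE1ext Pr P H t X Y ->
  {ae Pr, forall w, Y w = X w}.
Proof.
move=> lH tight mX' XX' [V [W [hV hW hY]]].
have VE : {ae Pr, forall w, forall nm : nat * nat, V nm.1 nm.2 w = (trunc nm.1 nm.2 (X w))%:E}.
  apply: ae_forall_count => nm.
  apply: (@OCE1_adapted H m e C s0 _ (fun w => trunc nm.1 nm.2 (X' w)) _ lH tight _ _ (hV _ _)).
    apply/meas_wrtP/measurable_EFinP.
    rewrite (_ : EFin \o _ = (fun w => maxe (mine (X' w) nm.1%:R%:E) (- nm.2%:R)%:E)); last first.
      by apply/funext => w /=; rewrite truncE.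
    apply: measurable_maxe; [apply: measurable_mine|]; rewrite //; try exact: measurable_cst.
    exact/meas_wrtP.
  by apply: filterS XX' => w ->.
have WW : {ae Pr, forall w, forall n, V n m w @[m --> \oo] --> W n w} by exact: ae_forall_count.
apply: filterS3 VE WW hY => w h1 h2 h3.
have WE : W ^~ w = fun n => mine (X w) n%:R%:E.
  apply/funext => n; have := h2 n; under eq_fun do rewrite (h1 (n, _)).
  by move=> h; rewrite -(cvg_lim _ h)//; apply/cvg_lim => //; exact: trunc_cvg.
by move: h3; rewrite WE => h; rewrite -(cvg_lim _ h)//; apply/cvg_lim => //; exact: mine_cvg.
Qed.


Lemma le_of_forall_gt (a b : \bar R) :
  (forall c : R, b < c%:E -> a <= c%:E) -> a <= b.
Proof.
move=> h; rewrite leNgt; apply/negP => /ereal_between_rat [p [lt p1 p2]].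
have := h ((ratr p.1 + ratr p.2) / 2)%R.
have lt' : (ratr p.1 < ratr p.2 :> R)%R by rewrite ltr_rat.
have l1 : (ratr p.1 < (ratr p.1 + ratr p.2) / 2 :> R)%R by lra.
have l2 : ((ratr p.1 + ratr p.2) / 2 < ratr p.2 :> R)%R by lra.
move=> /(_ (le_lt_trans p1 _)); rewrite lte_fin => /(_ l1) /(le_trans p2).
by rewrite lee_fin leNgt l2.
Qed.

(** At [+oo] the value is forced by [loss_id]. At [-oo] it is a mere default: the arguments used,
    [g%:E - mine x n%:R%:E], are never [-oo]. *)
Definition loss_ext H (x : \bar R) : \bar R := if x is r%:E then H r else +oo.

Lemma loss_ext_cvg H m e C s0 n (g : R) x : loss H m e C s0 ->
  H (g - trunc n m' x)%R @[m' --> \oo] --> loss_ext H (g%:E - mine x n%:R%:E).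
Proof.
move=> lH; have fin : mine x n%:R%:E \is a fin_num ->
    H (g - trunc n m' x)%R @[m' --> \oo] --> loss_ext H (g%:E - mine x n%:R%:E).
  move=> fx; rewrite -(fineK fx) -EFinB/=; apply: cvg_near_cst; near=> m'.
  congr (H (g - _)%R); rewrite /trunc max_l//.
  case E : (mine x n%:R%:E) => [r| |]; rewrite ?leey//.
    rewrite lee_fin lerNl (le_trans (ler_norm _))// normrN -[r]/(fine r%:E) -E.
    by near: m'; exact: nbhs_infty_ger.
  by rewrite E in fx.
case: x fin => [r| |] fin; [by apply: fin; rewrite -EFin_min|by apply: fin; rewrite min_r ?leey|].
rewrite min_l ?leNye//= /loss_ext/=.
apply/cvgeyPge => A; near=> m'.
rewrite /trunc min_l ?leNye// max_r ?leNye//= opprK.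
apply: le_trans (loss_id lH _); rewrite lee_fin -lerBlDl (le_trans (ler_norm _))//.
by near: m'; exact: nbhs_infty_ger.
Unshelve. all: by end_near. Qed.

Lemma measurable_loss_ext H m e C s0 n (g : R) (X : Omega -> \bar R) : loss H m e C s0 ->
  measurable_fun setT X ->
  measurable_fun setT (fun w => loss_ext H (g%:E - mine (X w) n%:R%:E)).
Proof.
move=> lH mX.
apply: (emeasurable_fun_cvg (fun m' w => H (g - trunc n m' (X w))%R)) => [m'|w _]; last first.
  apply: loss_ext_cvg; exact: lH.
apply: measurableT_comp; first exact: nondecreasing_ext_measurable (loss_nd lH).
by apply: measurable_funB => //; exact: measurable_trunc.
Qed.

Lemma loss_ext_lb H m e C s0 x : loss H m e C s0 -> m%:E <= loss_ext H x.
Proof. by move=> lH; case: x => [r| |]; rewrite ?leey//; exact: loss_lb lH _. Qed.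

(** For large positive [s] the slope [1 + e] beats slope 1, and for very negative [s] the constant
    lower bound suffices; the two terms of [S] are the respective thresholds. The bound is uniform
    over [x <= n]. *)
Lemma loss_tail H m e C s0 (n : nat) (K : R) : loss H m e C s0 ->
  exists2 S : R, (0 <= S)%R & forall (s x : R) , (x <= n%:R)%R -> (S < `|s|)%R ->
  (s + K)%:E <= H (s - x)%R.
Proof.
move=> lH; have e0 := loss_e lH.
exists (Num.max `|(K + (1 + e) * n%:R + C) / e| `|m - K|)%R; first by rewrite le_max normr_ge0.
move=> s x xn; rewrite gt_max => /andP[h1 h2].
have [s0'|s0'] := leP 0%R s.
  apply: le_trans (loss_nd lH (lerB (lexx s) xn)); apply: le_trans (loss_up lH _).
  rewrite lee_fin; move: h1; rewrite (ger0_norm s0') => /(le_lt_trans (ler_norm _)).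
  rewrite ltr_pdivrMr// => h; lra.
apply: le_trans (loss_lb lH _); rewrite lee_fin.
move: h2; rewrite (ltr0_norm s0') => h; have := ler_norm (- (m - K))%R; rewrite normrN => h'; lra.
Qed.

Lemma grid_exists (S : R) (j : nat) : (0 <= S)%R -> exists M, forall s, (`|s| <= S)%R ->
  exists2 i, (i < M)%N & (- S + i%:R * j.+1%:R^-1 <= s <= - S + i%:R * j.+1%:R^-1 + j.+1%:R^-1)%R.
Proof.
move=> S0; exists (Num.truncn ((S + S) * j.+1%:R)).+1 => s; rewrite ler_norml => /andP[s1 s2].
have j0 : (0 < j.+1%:R :> R)%R by [].
exists (Num.truncn ((s + S) * j.+1%:R)).
  by rewrite ltnS; apply: le_truncn; rewrite ler_wpM2r// lerD2r.
have /truncn_itv/andP[h1 h2] : (0 <= (s + S) * j.+1%:R)%R by rewrite mulr_ge0// -lerBlDr sub0r.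
apply/andP; split.
  by rewrite -lerBrDl opprK ler_pdivrMr.
rewrite -addrA -[X in (_ / _ + X)%R]mul1r -mulrDl natr1 -lerBlDl opprK ler_pdivlMr//; exact: ltW.
Qed.

(** The point is to exchange the limit in the lower truncation with the supremum over [s]. By
    [loss_tail] only a bounded range of [s] matters, up to a level [-K]. By monotonicity of the
    loss, a grid of mesh [1 / (j + 1)] loses at most the mesh there. A finite maximum commutes with
    the limit, and [K] and [j] are then sent to infinity. *)
Lemma OCE1ext_up H m e C s0 (X Y : Omega -> \bar R) :
  loss H m e C s0 -> measurable_fun setT X -> OCE1ext Pr P H t X Y ->
  exists2 W : nat -> Omega -> \bar R, {ae Pr, forall w, W n w @[n --> \oo] --> Y w} &
  forall n (B : Omega -> \bar R),
  (forall (g : R) V', condexp Pr F (fun w => loss_ext H (g%:E - mine (X w) n%:R%:E)) V' ->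
     {ae Pr, forall w, g%:E - V' w <= B w}) ->
  {ae Pr, forall w, W n w <= B w}.
Proof.
move=> lH mX [V [W [hV hW hY]]]; exists W => // n B hB.
have nd := loss_nd lH; have mH := nondecreasing_ext_measurable nd.
have /choice[Vf cVf] (gm : R * nat) :
    exists V1, condexp Pr F (fun w => H (gm.1 - trunc n gm.2 (X w))%R) V1.
  apply: (@ce_loss_exists H m e C s0 (fun w => gm.1 - trunc n gm.2 (X w))%R lH).
  by apply: measurable_funB => //; exact: measurable_trunc.
have /choice[V' cV'] (g : R) : exists V1, condexp Pr F (fun w => loss_ext H (g%:E - mine (X w) n%:R%:E)) V1.
  apply: (@ce_exists _ _ _ Pr _ Fsub _ m); first exact: measurable_loss_ext lH mX.
  by move=> w; apply: loss_ext_lb lH.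
have VfV' (g : R) : {ae Pr, forall w, Vf (g, m') w @[m' --> \oo] --> V' g w}.
  apply: (@ce_mono _ _ _ Pr _ Fsub m (fun m' w => H (g - trunc n m' (X w))%R) _ _ _ _ _ _ _
    (fun m' => cVf (g, m')) (cV' g)) => //.
  - by move=> m'; apply: measurableT_comp => //; apply: measurable_funB => //; exact: measurable_trunc.
  - by move=> m' w; exact: loss_lb lH _.
  - move=> w i j ij; apply: nd; rewrite lerB// -lee_fin !truncE ge_max !le_max lexx/=.
    by rewrite lee_fin lerN2 ler_nat ij orbT.
  - by move=> w; apply: loss_ext_cvg; exact: lH.
have main : {ae Pr, forall w, forall Kj : nat * nat, W n w <= maxe (- Kj.1%:R)%:E (B w + Kj.2.+1%:R^-1%:E)}.
  apply: ae_forall_count => -[K j] /=.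
  have [S S0 tail] := loss_tail n K%:R lH.
  have [M grid] := grid_exists j S0.
  pose gr (i : 'I_M) := (- S + i%:R * j.+1%:R^-1)%R.
  pose T m' w := maxe (- K%:R)%:E (\big[maxe/-oo]_(i < M) (j.+1%:R^-1%:E + ((gr i)%:E - Vf (gr i, m') w))).
  have VT m' : {ae Pr, forall w, V n m' w <= T m' w}.
    apply: (OCE1_upper (hV n m')).
      apply: (@meas_wrt_measurable _ _ _ Fsub); apply/meas_wrtP; apply: measurable_maxe; first exact: measurable_cst.
      apply: measurable_bigmaxe => i.
      apply: emeasurable_funD; first exact: measurable_cst.
      by apply: emeasurable_funB; [exact: measurable_cst|exact: ce_meas (cVf _)].
    move=> s V1 cV1; have [sS|Ss] := leP `|s|%R S.
      have [i iM /andP[i1 i2]] := grid s sS.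
      have : {ae Pr, forall w, Vf (gr (Ordinal iM), m') w <= V1 w}.
        by apply: (ce_leT Fsub (cVf _) cV1); apply: aeW => w /=; apply: nd; rewrite lerB.
      apply: filterS => w h; rewrite /T le_max; apply/orP; right.
      apply: le_trans (@le_bigmax _ _ _ -oo (fun i => (j.+1%:R^-1%:E + ((gr i)%:E - Vf (gr i, m') w))) (Ordinal iM)).
      rewrite addeA; apply: leeB => //; rewrite -EFinD lee_fin addrC; exact: i2.
    have : {ae Pr, forall w, (s + K%:R)%:E <= V1 w}.
      apply: (ce_ge_cst Fsub cV1); apply: aeW => w; apply: tail => //.
      by have /andP[] := trunc_bnd n m' (X w).
    apply: filterS => w h; rewrite /T le_max; apply/orP; left.
    by move: h; case: (V1 w) => [r| |]; rewrite ?leNye ?lee_fin// => h; lra.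
  have VT' : {ae Pr, forall w, forall m', V n m' w <= T m' w} by apply: ae_forall_count.
  have cvg' : {ae Pr, forall w, forall i : 'I_M, Vf (gr i, m') w @[m' --> \oo] --> V' (gr i) w}.
    by apply: ae_forall_count => i; exact: VfV'.
  have gB : {ae Pr, forall w, forall i : 'I_M, (gr i)%:E - V' (gr i) w <= B w}.
    by apply: ae_forall_count => i; exact: hB (cV' _).
  apply: filterS3 (filterI cvg' gB) (hW n) VT' => w [h3 h4] h1 h2.
  apply: le_of_forall_gt => c; rewrite gt_max => /andP[cK cB].
  apply: cvge_le h1; near=> m'; apply: le_trans (h2 m') _.
  rewrite /T ge_max (ltW cK)/=; apply/bigmax_leP; split; first exact: leNye.
  move=> i _; apply: ltW; move: i.
  near: m'; apply: filter_forall => i.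
  have lt : j.+1%:R^-1%:E + ((gr i)%:E - V' (gr i) w) < c%:E.
    by apply: le_lt_trans cB; rewrite addeC leeD2r.
  have : j.+1%:R^-1%:E + ((gr i)%:E - Vf (gr i, m') w) @[m' --> \oo] -->
      j.+1%:R^-1%:E + ((gr i)%:E - V' (gr i) w).
    by apply: cvgeD; [exact: fin_num_adde_defr|exact: cvg_cst|apply: cvgeB;
      [exact: fin_num_adde_defr|exact: cvg_cst|exact: h3]].
  by move=> cv; exact: (cv [set y | y < c%:E] (open_ereal_lt' lt)).
apply: filterS main => w h; apply: le_of_forall_gt => c Bc.
have [K hK] : exists K : nat, (- K%:R <= c)%R.
  by exists (Num.truncn `|c|).+1; rewrite lerNl (le_trans (ler_norm _))// normrN ltW// truncnS_gt.
have [j hj] : exists j : nat, B w + j.+1%:R^-1%:E <= c%:E.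
  move: Bc; case: (B w) => [b| |]//=; last by move=> _; exists 0%N; rewrite leNye.
  rewrite lte_fin => bc; exists (Num.truncn (c - b)^-1); rewrite -EFinD lee_fin -lerBrDl.
  by rewrite -[leRHS]invrK lef_pV2 ?posrE ?invr_gt0 ?subr_gt0// ltW// truncnS_gt.
by apply: le_trans (h (K, j)) _; rewrite ge_max hj lee_fin hK.
Unshelve. all: by end_near. Qed.

End OneStepOCE.

(** * Measurable selection by bisection *)

Section Tree.
Context {R : realType}.
Local Open Scope ereal_scope.
Implicit Types (phi : seq bool -> \bar R) (u : seq bool).

(* Nodes of the binary tree are lists, the head being the last turn.  For [phi] decreasing along
   branches, a branch that always turns to a child with the larger [tinf] keeps [phi] above the
   value [tinf] of the root; unlike a maximizer, it is a measurable function of [phi]. *)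
Fixpoint tmax phi k u : \bar R :=
  if k is k'.+1 then maxe (tmax phi k' (false :: u)) (tmax phi k' (true :: u)) else phi u.

Definition tinf phi u : \bar R := ereal_inf (range (fun k => tmax phi k u)).

Definition tchoice phi u : bool := tinf phi (false :: u) < tinf phi (true :: u).

Fixpoint tpath phi k u : seq bool :=
  if k is k'.+1 then tpath phi k' (tchoice phi u :: u) else u.

Definition tdec phi := forall b u, phi (b :: u) <= phi u.

Lemma tmaxS phi k u : tdec phi -> tmax phi k.+1 u <= tmax phi k u.
Proof.
move=> dec; elim: k u => [|k IH] u; first by rewrite /= ge_max !dec.
by rewrite [leLHS]/= [leRHS]/= ge_max !le_max !IH orbT.
Qed.

Lemma tmax_dec phi k k' u : tdec phi -> (k <= k')%N -> tmax phi k' u <= tmax phi k u.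
Proof.
move=> dec /subnK <-; elim: (k' - k)%N => [|n IH]//.
by rewrite addSn (le_trans (tmaxS _ _ dec)).
Qed.

Lemma tinf_le phi k u : tinf phi u <= tmax phi k u.
Proof. by apply: ereal_inf_lbound; exists k. Qed.

Lemma lt_tinf phi u c : tinf phi u < c -> exists k, tmax phi k u < c.
Proof. by move/ereal_inf_lt => [_ [k _ <-] h]; exists k. Qed.

(** If both children fell strictly below the parent, each would do so at a finite depth; at the
    larger of the two depths both do, and so does the parent one level deeper. *)
Lemma tinf_split phi u : tdec phi -> tinf phi u <= tinf phi (tchoice phi u :: u).
Proof.
move=> dec; have -> : tinf phi (tchoice phi u :: u) = maxe (tinf phi (false :: u)) (tinf phi (true :: u)).
  by rewrite /tchoice /Order.max; case: ifP.
rewrite leNgt; apply/negP; rewrite gt_max => /andP[/lt_tinf[k1 h1] /lt_tinf[k2 h2]].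
have := tinf_le phi (maxn k1 k2).+1 u; rewrite leNgt => /negP; apply.
rewrite /= gt_max; apply/andP; split.
  by apply: le_lt_trans h1; apply: tmax_dec => //; exact: leq_maxl.
by apply: le_lt_trans h2; apply: tmax_dec => //; exact: leq_maxr.
Qed.

Lemma tpathS phi k u : tpath phi k.+1 u = tchoice phi (tpath phi k u) :: tpath phi k u.
Proof. by elim: k u => [|k IH] u //; rewrite [LHS]/= -IH. Qed.

Lemma tinf_tpath phi k u : tdec phi -> tinf phi u <= phi (tpath phi k u).
Proof.
move=> dec; apply: (@le_trans _ _ (tinf phi (tpath phi k u))); last exact: (tinf_le _ 0).
elim: k => [|k IH] //; apply: le_trans IH _; rewrite tpathS; exact: tinf_split.
Qed.

Section measurable_tree.
Context d (T : measurableType d) (phi : seq bool -> T -> \bar R).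
Hypothesis mphi : forall u, measurable_fun setT (phi u).
Local Notation ph w := (phi ^~ w).

Lemma measurable_tmax k u : measurable_fun setT (fun w => tmax (ph w) k u).
Proof. by elim: k u => [|k IH] u //=; apply: measurable_maxe. Qed.

Lemma measurable_tinf u : measurable_fun setT (fun w => tinf (ph w) u).
Proof.
rewrite (_ : (fun w => _) = (fun w => einfs (fun k => tmax (ph w) k u) 0%N)); last first.
  apply/funext => w; rewrite /tinf /einfs; congr ereal_inf.
  by apply/seteqP; split => _ [k _ <-]; exists k.
by apply: measurable_fun_einfs => k; exact: measurable_tmax.
Qed.

Lemma measurable_tchoice u : measurable_fun setT (fun w => tchoice (ph w) u).
Proof.
apply: (measurable_fun_bool true).
exact: (@emeasurable_fun_lt _ T R setT measurableT _ _ (measurable_tinf (false :: u)) (measurable_tinf (true :: u))).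
Qed.

(** The node at depth [k] results from finitely many measurable binary decisions, so every function
    [f] of it is measurable. *)
Lemma measurable_tpath d' (T' : measurableType d') (f : seq bool -> T') k u :
  measurable_fun setT (fun w => f (tpath (ph w) k u)).
Proof.
elim: k u => [|k IH] u /=; first exact: measurable_cst.
rewrite (_ : (fun w => _) = (fun w => if tchoice (ph w) u
  then f (tpath (ph w) k (true :: u)) else f (tpath (ph w) k (false :: u)))).
  by apply: measurable_fun_ifT => //; exact: measurable_tchoice.
by apply/funext => w; case: tchoice.
Qed.

End measurable_tree.
End Tree.

(** * Dyadic boxes attached to the nodes of the tree *)

Section Box.
Context {R : realType}.
Variables (dd : nat) (B : R).
Hypothesis B0 : 0 <= B.
Implicit Types (u : seq bool) (x : nat -> R).

Definition upd (f : nat -> R) (j : nat) (v : R) (i : nat) : R := if i == j then v else f i.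

(** The pair holds the lower and upper corners, with coordinates indexed by all naturals to avoid
    dependent types. For positive [dd] the coordinates below [dd] are halved cyclically with the
    depth, and the others keep [[- B, B]]. *)
Fixpoint box u : (nat -> R) * (nat -> R) :=
  if u is b :: v then
    let p := box v in let j := (size v %% dd)%N in
    let mid := (p.1 j + p.2 j) / 2 in
    if b then (upd p.1 j mid, p.2) else (p.1, upd p.2 j mid)
  else (fun=> - B, fun=> B).

Definition inbox u x := forall j, (box u).1 j <= x j <= (box u).2 j.

Lemma box_le u j : (box u).1 j <= (box u).2 j.
Proof.
elim: u j => [|b u IH] j /=; first by rewrite (@le_trans _ _ 0) ?oppr_le0.
by case: b => /=; rewrite /upd; case: eqP => // ->; have := IH (size u %% dd)%N; lra.
Qed.

Lemma box_lo b u j : (box u).1 j <= (box (b :: u)).1 j.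
Proof. by case: b => //=; rewrite /upd; case: eqP => // ->; have := box_le u (size u %% dd)%N; lra. Qed.

Lemma box_hi b u j : (box (b :: u)).2 j <= (box u).2 j.
Proof. by case: b => //=; rewrite /upd; case: eqP => // ->; have := box_le u (size u %% dd)%N; lra. Qed.

Lemma inbox_sub b u x : inbox (b :: u) x -> inbox u x.
Proof.
move=> h j; have /andP[h1 h2] := h j; apply/andP; split.
  exact: le_trans (box_lo b u j) h1.
exact: le_trans h2 (box_hi b u j).
Qed.

Lemma inbox_split u x : inbox u x -> exists b, inbox (b :: u) x.
Proof.
move=> h; exists (((box u).1 (size u %% dd)%N + (box u).2 (size u %% dd)%N) / 2 <= x (size u %% dd)%N).
move=> j; have /andP[h1 h2] := h j; rewrite /=.
case: (leP (((box u).1 _ + _) / 2)) => h3 /=; rewrite /upd.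
  by rewrite h2 andbT; case: (eqVneq j (size u %% dd)%N) => [e|_]; [rewrite e|exact: h1].
by rewrite h1; case: (eqVneq j (size u %% dd)%N) => [e|_]; [rewrite e ltW|exact: h2].
Qed.

(** Some child always contains [x], so a branch of cells around [x] reaches every depth. This gives
    the bound of [tinf] from below by the value at any point, opposite to [tinf_tpath]. *)
Lemma tmax_ge_inbox (phi : seq bool -> \bar R) (v : \bar R) x k u :
  (forall u', inbox u' x -> (v <= phi u')%E) -> inbox u x -> (v <= tmax phi k u)%E.
Proof.
move=> h; elim: k u => [|k IH] u ux /=; first exact: h.
by have [[] b] := inbox_split ux; rewrite le_max (IH _ b) ?orbT.
Qed.

(** The exponent counts the halvings of coordinate [j]: the completed rounds, plus one if the
    current round has passed [j]. *)
Lemma box_width u j : (j < dd)%N ->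
  (box u).2 j - (box u).1 j = (B + B) / 2 ^+ (size u %/ dd + (j < size u %% dd)).
Proof.
move=> jd; have d0 : (0 < dd)%N by apply: leq_trans jd.
elim: u => [|b u IH]; first by rewrite /= div0n mod0n ltn0 expr0 divr1; lra.
have half : (box (b :: u)).2 j - (box (b :: u)).1 j =
    ((box u).2 j - (box u).1 j) / (if j == (size u %% dd)%N then 2 else 1).
  by case: b => /=; rewrite /upd; case: eqP => [->|_]; rewrite ?divr1//; field.
rewrite half IH [size (b :: u)]/= divnS// modnS; set n := size u.
have nd : (n %% dd < dd)%N by rewrite ltn_pmod.
have nE : n = (n %/ dd * dd + n %% dd)%N by exact: divn_eq.
have [dn|dn] := boolP (dd %| n.+1)%N.
  have r : (n %% dd = dd.-1)%N.
    have h0 : ((n %% dd).+1 %% dd = 0)%N by rewrite -addn1 modnDml addn1; exact/eqP.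
    have := nd; rewrite leq_eqVlt => /orP[/eqP e|lt]; first by rewrite -[in RHS]e.
    by move: h0; rewrite modn_small.
  rewrite r ltn0 addn0 add1n; have [->|jr] := eqVneq j dd.-1.
    by rewrite ltnn addn0 exprS; field.
  have -> : (j < dd.-1)%N by rewrite ltn_neqAle jr -ltnS prednK.
  by rewrite addn1 divr1.
rewrite add0n ltnS [(j <= n %% dd)%N]leq_eqVlt; have [->|jr] := eqVneq j (n %% dd)%N.
  by rewrite ltnn addn0 addn1 exprS; field.
by rewrite divr1.
Qed.

Lemma box_bnd u j : - B <= (box u).1 j /\ (box u).2 j <= B.
Proof.
elim: u => [|b u [h1 h2]]; first by split.
split; first exact: le_trans (box_lo _ _ _).
exact: le_trans (box_hi _ _ _) _.
Qed.

Lemma box_cvg (w : nat -> seq bool) : w 0%N = [::] ->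
  (forall k, exists b, w k.+1 = b :: w k) ->
  exists x : nat -> R, [/\ forall k, inbox (w k) x,
    forall j, (fun k => (box (w k)).1 j) @ \oo --> x j,
    forall j, (j < dd)%N -> (fun k => (box (w k)).2 j) @ \oo --> x j &
    forall j, nondecreasing_seq (fun k => (box (w k)).1 j) /\
      nonincreasing_seq (fun k => (box (w k)).2 j)].
Proof.
move=> w0 wS.
have nd j : nondecreasing_seq (fun k => (box (w k)).1 j).
  by apply/nondecreasing_seqP => k; have [b ->] := wS k; exact: box_lo.
have ni j : nonincreasing_seq (fun k => (box (w k)).2 j).
  by apply/nonincreasing_seqP => k; have [b ->] := wS k; exact: box_hi.
have cv j : cvgn (fun k => (box (w k)).1 j).
  apply: nondecreasing_is_cvgn => //; exists B => _ [k _ <-].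
  by apply: le_trans (box_le _ _) _; have [] := box_bnd (w k) j.
have sz k : size (w k) = k by elim: k => [|k IH]; [rewrite w0|have [b ->] := wS k; rewrite /= IH].
exists (fun j => limn (fun k => (box (w k)).1 j)); split => //.
- move=> k j; apply/andP; split; first exact: (nondecreasing_cvgn_le (nd j) (cv j) k).
  apply: limr_le => //; near=> i.
  have ki : (k <= i)%N by near: i; exact: nbhs_infty_ge.
  exact: le_trans (box_le _ _) (ni j _ _ ki).
- move=> j jd; have -> : (fun k => (box (w k)).2 j) =
      (fun k => (box (w k)).1 j) \+ (fun k => (B + B) / 2 ^+ (k %/ dd + (j < k %% dd))).
    by apply/funext => k /=; have := box_width (w k) jd; rewrite sz => <-; rewrite addrC subrK.
  rewrite -[X in _ --> X]addr0; apply: cvgD; first exact: cv.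
  pose e k := (k %/ dd + (j < k %% dd))%N.
  have d0 : (0 < dd)%N by apply: leq_trans jd.
  have ce : e k @[k --> \oo] --> \oo.
    apply/cvgnyPge => A; near=> k; rewrite /e (leq_trans _ (leq_addr _ _))// leq_divRL//.
    by near: k; exact: nbhs_infty_ge.
  have cg : (B + B) / 2 ^+ q @[q --> \oo] --> (0 : R).
    rewrite -[X in _ --> X](mulr0 (B + B)); apply: cvgMr.
    under eq_fun do rewrite -exprVn.
    by apply: cvg_expr; rewrite gtr0_norm ?invr_gt0// invf_lt1// ltr1n.
  exact: (@cvg_comp _ _ _ e (fun q => (B + B) / 2 ^+ q) _ \oo _ ce cg).
Unshelve. all: by end_near. Qed.

End Box.

(** * Infimal convolution of two losses *)

Section InfConv.
Context {R : realType}.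
Local Open Scope ereal_scope.

Lemma conv_coeff (x y z : R) : (z - x != 0)%R ->
  (y = (z - y) / (z - x) * x + (1 - (z - y) / (z - x)) * z)%R.
Proof. by move=> h; field. Qed.

Definition tight (H : R -> \bar R) := forall k : R, (0 < k)%R -> exists s, H s < (s + k)%:E.

(* [s - H s] is concave with supremum [0] and tends to [-oo] on both sides *)
Lemma loss_slopes (H : R -> \bar R) m e C s0 : loss H m e C s0 -> convex_ext H -> tight H ->
  exists X : R, [/\ (0 <= X)%R,
    forall x y, (X <= y)%R -> (y <= x)%R -> H y <= H x - (x - y)%:E &
    forall x y, (y <= - X)%R -> (x <= y)%R -> H y <= H x + (y - x)%:E].
Proof.
move=> lH cH tH; have [x1 hx1] := tH 1%R ltr01; have e0 := loss_e lH.
(* Beyond [X] the growth bounds give [y - H y <= -1], strictly less than the value at [x1]; the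
   summand 1 places [x1] strictly inside. *)
pose X := (`|x1| + 1 + `|(C + 1) / e| + `|m - 1|)%R.
have Xgt : (`|x1| < X)%R.
  by rewrite /X -!addrA ltrDl; have := normr_ge0 ((C + 1) / e)%R; have := normr_ge0 (m - 1)%R; lra.
have X0 : (0 <= X)%R by rewrite (le_trans _ (ltW Xgt)).
have far (y : R) : (X <= `|y|)%R -> (y + 1)%:E <= H y.
  move=> Xy; have [y0|y0] := leP 0%R y.
    apply: le_trans (loss_up lH y); rewrite lee_fin.
    have : ((C + 1) / e <= y)%R.
      apply: (le_trans (ler_norm _)); rewrite (ger0_norm y0) in Xy; apply: le_trans Xy.
      by rewrite /X; have := normr_ge0 x1; have := normr_ge0 (m - 1)%R; lra.
    by rewrite ler_pdivrMr// => h; lra.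
  apply: le_trans (loss_lb lH y); rewrite lee_fin.
  rewrite (ltr0_norm y0) in Xy; have := ler_norm (- (m - 1))%R; rewrite normrN => h.
  have : (`|m - 1| <= X)%R by rewrite /X; have := normr_ge0 x1; have := normr_ge0 ((C + 1) / e)%R; lra.
  lra.
(* between [x1] and [x], concavity puts [y - H y] above the smaller endpoint value *)
have key (x y l : R) : (0 < l < 1)%R -> (y = l * x1 + (1 - l) * x)%R -> (X <= `|y|)%R ->
    forall r, H x = r%:E -> H y <= (r - (x - y))%:E.
  move=> l01 yE Xy r Hx; have := cH x1 x l l01; rewrite -yE Hx.
  have fy := far _ Xy; move: hx1 (loss_lb lH x1); case: (H x1) => [r1| |]//=.
  rewrite lte_fin => h1 _; rewrite -EFinM -EFinM -EFinD => h2.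
  have : exists ry, H y = ry%:E.
    by move: h2 fy; case: (H y) => [ry| |]//=; exists ry.
  move=> [ry Hy]; rewrite Hy lee_fin in h2; rewrite Hy lee_fin in fy; rewrite Hy lee_fin.
  have /andP[l0 l1] := l01; rewrite leNgt; apply/negP => h3.
  have : (l * r1 < l * (x1 + 1))%R by rewrite ltr_pM2l.
  have : ((1 - l) * r < (1 - l) * (ry + (x - y)))%R by rewrite ltr_pM2l ?subr_gt0//; lra.
  move=> h5 h6; have h7 : (ry < l * (x1 + 1) + (1 - l) * (ry + (x - y)))%R by lra.
  have h8 : (l * (ry - (y + 1)) >= 0)%R by rewrite mulr_ge0 ?(ltW l0)// subr_ge0.
  have h9 : (l * (x1 - y) + (1 - l) * (x - y) = 0)%R by rewrite yE; ring.
  move: h7 h8 h9; move: (ry) (y) => a b; nra.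
exists X; split => //.
- move=> x y Xy yx; case Hx : (H x) => [r| |]; last 2 first.
  + by rewrite addye// leey.
  + by have := loss_lb lH x; rewrite Hx.
  rewrite -EFinB; have [yx'|yx'] := eqVneq y x; first by rewrite yx' subrr subr0 Hx.
  have lt1 : (x1 < y)%R by apply: lt_le_trans Xy; apply: le_lt_trans Xgt; exact: ler_norm.
  have lt2 : (y < x)%R by rewrite lt_neqAle yx'.
  have d0 : (0 < x - x1)%R by lra.
  apply: (key x y ((x - y) / (x - x1))%R _ _ _ r Hx).
  + apply/andP; split; first by rewrite divr_gt0// subr_gt0.
    by rewrite ltr_pdivrMr// mul1r; lra.
  + by apply: conv_coeff; rewrite gt_eqF.
  + by rewrite (le_trans Xy)// ler_norm.
- move=> x y Xy yx; case Hx : (H x) => [r| |]; last 2 first.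
  + by rewrite addye// leey.
  + by have := loss_lb lH x; rewrite Hx.
  rewrite -EFinD; have [yx'|yx'] := eqVneq y x; first by rewrite yx' subrr addr0 Hx.
  have lt1 : (y < x1)%R.
    apply: (le_lt_trans Xy); rewrite ltrNl; apply: le_lt_trans Xgt; rewrite -normrN; exact: ler_norm.
  have lt2 : (x < y)%R by rewrite lt_neqAle eq_sym yx'.
  have d0 : (0 < x1 - x)%R by lra.
  have -> : (r + (y - x) = r - (x - y))%R by ring.
  apply: (key x y ((y - x) / (x1 - x))%R _ _ _ r Hx).
  + apply/andP; split; first by rewrite divr_gt0// subr_gt0.
    by rewrite ltr_pdivrMr// mul1r; lra.
  + have -> : ((y - x) / (x1 - x) = (x - y) / (x - x1))%R by rewrite -[in RHS]opprB -[(x - x1)%R]opprB invrN mulrNN.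
    by apply: conv_coeff; rewrite lt_eqF// subr_lt0 -subr_gt0.
  + by rewrite -normrN (le_trans _ (ler_norm _))// lerNr.
Qed.

Definition iconv (Ha Hp : R -> \bar R) z : \bar R := ereal_inf (range (fun x => Ha x + Hp (z - x)%R)).

Lemma iconv_le Ha Hp z x : iconv Ha Hp z <= Ha x + Hp (z - x)%R.
Proof. by apply: ereal_inf_lbound; exists x. Qed.

Section iconv_loss.
Context (Ha Hp : R -> \bar R) (ma ea Ca sa mp ep Cp sp : R).
Hypotheses (lHa : loss Ha ma ea Ca sa) (lHp : loss Hp mp ep Cp sp).

Lemma iconv_lb z : (ma + mp)%:E <= iconv Ha Hp z.
Proof.
apply: le_ereal_inf_tmp => _ [x _ <-]; rewrite EFinD.
by apply: leeD; [exact: loss_lb lHa _|exact: loss_lb lHp _].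
Qed.

Lemma iconv_nd : nondecreasing_ext (iconv Ha Hp).
Proof.
move=> z z' zz'; apply: le_ereal_inf_tmp => _ [x _ <-]; apply: le_trans (iconv_le _ _ z x) _.
by apply: leeD => //; apply: loss_nd lHp _ _ _; rewrite lerB.
Qed.

(** The two losses must be given a common slope for their bounds at [x] and [z - x] to add up to a
    bound in [z]. Lowering the slope fails for negative [s]; there [loss_id] takes over, which is
    why [C] becomes its absolute value. *)
Lemma loss_up_le (H : R -> \bar R) m e C s0 e' (s : R) : loss H m e C s0 -> (0 <= e')%R -> (e' <= e)%R ->
  ((1 + e') * s - `|C|)%:E <= H s.
Proof.
move=> lH e0 ee; have [s'|s'] := leP 0%R s.
  apply: le_trans (loss_up lH s); rewrite lee_fin.
  by have := ler_norm C; have : (e' * s <= e * s)%R by [rewrite ler_wpM2r]; lra.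
apply: le_trans (loss_id lH s); rewrite lee_fin.
have : (e' * s <= 0)%R by rewrite mulr_ge0_le0// ltW.
by have := normr_ge0 C; lra.
Qed.

Lemma iconv_id z : z%:E <= iconv Ha Hp z.
Proof.
apply: le_ereal_inf_tmp => _ [x _ <-]; have -> : z%:E = x%:E + (z - x)%:E by rewrite -EFinD addrC subrK.
by apply: leeD; [exact: loss_id lHa _|exact: loss_id lHp _].
Qed.

Lemma iconv_up z : ((1 + Num.min ea ep) * z - (`|Ca| + `|Cp|))%:E <= iconv Ha Hp z.
Proof.
apply: le_ereal_inf_tmp => _ [x _ <-]; set e := Num.min ea ep.
have -> : ((1 + e) * z - (`|Ca| + `|Cp|) = ((1 + e) * x - `|Ca|) + ((1 + e) * (z - x) - `|Cp|))%R by ring.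
have e0 : (0 <= e)%R by rewrite le_min (ltW (loss_e lHa)) (ltW (loss_e lHp)).
by rewrite EFinD; apply: leeD; [apply: loss_up_le lHa _ _|apply: loss_up_le lHp _ _];
  rewrite // /e ge_min lexx ?orbT.
Qed.

Lemma iconv_fin : iconv Ha Hp (sa + sp) < +oo.
Proof.
apply: le_lt_trans (iconv_le _ _ _ sa) _; rewrite addrAC subrr add0r.
by apply: lte_add_pinfty; [exact: loss_fin lHa|exact: loss_fin lHp].
Qed.

(** Far to the right, lowering [x] to [y] saves at least [x - y] in [Ha], while [Hp] near its left
    end rises by at most that amount. Both slope estimates hold down to [y = max Xa (z + Xp)], and
    the left side is symmetric; this gives the size of [B]. *)
Lemma iconv_box (Z : R) : convex_ext Ha -> convex_ext Hp -> tight Ha -> tight Hp ->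
  exists2 B : R, (0 <= B)%R & forall z, (`|z| <= Z)%R -> forall x, exists2 x', (`|x'| <= B)%R &
    Ha x' + Hp (z - x')%R <= Ha x + Hp (z - x)%R.
Proof.
move=> cHa cHp tHa tHp.
have [Xa [Xa0 a1 a2]] := loss_slopes lHa cHa tHa.
have [Xp [Xp0 p1 p2]] := loss_slopes lHp cHp tHp.
exists (Xa + Xp + `|Z|)%R; first by rewrite !addr_ge0.
move=> z; rewrite ler_norml => /andP[z1 z2] x; have Z1 := ler_norm Z.
have [xB|xB] := leP `|x|%R (Xa + Xp + `|Z|)%R; first by exists x.
have E (a b : \bar R) (r : R) : (a - r%:E) + (b + r%:E) = a + b.
  by rewrite addeACA -EFinN -EFinD addNr adde0.
have E' (a b : \bar R) (r : R) : (a + r%:E) + (b - r%:E) = a + b.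
  by rewrite addeACA -EFinN -EFinD subrr adde0.
have [x0|x0] := leP 0%R x.
  rewrite (ger0_norm x0) in xB; pose y := Num.max Xa (z + Xp)%R.
  have y1 : (Xa <= y)%R by rewrite /y le_max lexx.
  have y2 : (z + Xp <= y)%R by rewrite /y le_max lexx orbT.
  have y3 : (y <= Xa + Xp + `|Z|)%R by rewrite /y ge_max; apply/andP; split; lra.
  exists y; first by rewrite ger0_norm//; lra.
  rewrite -[leRHS](E _ _ (x - y)%R); apply: leeD; first by apply: a1 => //; lra.
  have -> : (x - y = (z - y) - (z - x))%R by ring.
  by apply: p2; lra.
rewrite (ltr0_norm x0) in xB; pose y := Num.min (- Xa)%R (z - Xp)%R.
have y1 : (y <= - Xa)%R by rewrite /y ge_min lexx.
have y2 : (y <= z - Xp)%R by rewrite /y ge_min lexx orbT.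
have y3 : (- (Xa + Xp + `|Z|) <= y)%R by rewrite /y le_min; apply/andP; split; lra.
exists y; first by rewrite ler0_norm//; lra.
rewrite -[leRHS](E' _ _ (y - x)%R); apply: leeD; first by apply: a2 => //; lra.
have -> : (y - x = (z - x) - (z - y))%R by ring.
by apply: p1; lra.
Qed.

Section selection.
Context (Z B : R).
Hypothesis B0 : (0 <= B)%R.
Hypothesis hB : forall z, (`|z| <= Z)%R -> forall x, exists2 x', (`|x'| <= B)%R &
    Ha x' + Hp (z - x')%R <= Ha x + Hp (z - x)%R.

(** An upper bound of [- (Ha x + Hp (z - x))] on the cell: each loss is taken at the least value of
    its own argument, one at the lower end and the other at the upper end. Along a branch both
    arguments increase, as left continuity requires. *)
Definition cellval (z : R) (u : seq bool) : \bar R :=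
  - (Ha ((box 1 B u).1 0%N) + Hp (z - (box 1 B u).2 0%N)%R).

Lemma cellval_dec z : tdec (cellval z).
Proof.
move=> b u; rewrite /cellval leeN2; apply: leeD; first by apply: loss_nd lHa _ _ _; exact: box_lo.
by apply: loss_nd lHp _ _ _; rewrite lerB// box_hi.
Qed.

Definition argmin (z : R) : R := limn (fun k => (box 1 B (tpath (cellval z) k [::])).1 0%N).

Lemma lossD_def x y : Ha x +? Hp y.
Proof. by move: (loss_lb lHa x) (loss_lb lHp y); case: (Ha x) => [?| |]; case: (Hp y) => [?| |]. Qed.

Lemma argmin_spec z : (`|argmin z| <= B)%R /\ tinf (cellval z) [::] <= - (Ha (argmin z) + Hp (z - argmin z)%R).
Proof.
have [x [xin xlo xhi mon]] := box_cvg 1 B0 (w := fun k => tpath (cellval z) k [::]) erefl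
    (fun k => ex_intro _ _ (tpathS (cellval z) k [::])).
have xE : argmin z = x 0%N by apply/cvg_lim => //; exact: xlo.
rewrite xE; split; first by have := xin 0%N 0%N; rewrite /= -ler_norml.
have [nd ni] := mon 0%N.
have cv : cellval z (tpath (cellval z) k [::]) @[k --> \oo] --> - (Ha (x 0%N) + Hp (z - x 0%N)%R).
  apply: cvgeN; apply: cvgeD; first exact: lossD_def.
    by apply: loss_lc lHa _ _ nd _; exact: xlo.
  apply: (loss_lc lHp).
    by move=> i j ij; rewrite lerB//; exact: ni.
  by apply: cvgB; [exact: cvg_cst|exact: xhi].
by apply: cvge_ge cv; apply: nearW => k; exact: tinf_tpath (cellval_dec z).
Qed.

Lemma tinf_ge z x : (`|x| <= B)%R -> - (Ha x + Hp (z - x)%R) <= tinf (cellval z) [::].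
Proof.
move=> xB; apply: le_ereal_inf_tmp => _ [k _ <-].
apply: (@tmax_ge_inbox _ 1 B (cellval z) _ (fun=> x)); last by move=> j /=; rewrite -ler_norml.
move=> u' xu; rewrite /cellval leeN2; have /andP[h1 h2] := xu 0%N.
apply: leeD; first by apply: loss_nd lHa _ _ _.
by apply: loss_nd lHp _ _ _; rewrite lerB.
Qed.

Lemma argmin_iconv z : (`|z| <= Z)%R -> Ha (argmin z) + Hp (z - argmin z)%R = iconv Ha Hp z.
Proof.
move=> zZ; apply/eqP; rewrite eq_le iconv_le andbT; apply: le_ereal_inf_tmp => _ [x _ <-].
have [x' x'B] := hB zZ x; apply: le_trans; rewrite -leeN2.
exact: le_trans (tinf_ge _ x'B) (argmin_spec z).2.
Qed.

Lemma tinf_iconv z : (`|z| <= Z)%R -> tinf (cellval z) [::] = - iconv Ha Hp z.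
Proof.
move=> zZ; rewrite -argmin_iconv//; apply/eqP; rewrite eq_le (argmin_spec z).2/=.
by apply: tinf_ge; exact: (argmin_spec z).1.
Qed.

Lemma measurable_argmin : measurable_fun setT argmin.
Proof.
have cv z : (box 1 B (tpath (cellval z) k [::])).1 0%N @[k --> \oo] --> argmin z.
  have [x [_ xlo _ _]] := box_cvg 1 B0 (w := fun k => tpath (cellval z) k [::]) erefl
    (fun k => ex_intro _ _ (tpathS (cellval z) k [::])).
  by apply/cvg_ex; exists (x 0%N); exact: xlo.
apply: (@measurable_fun_cvg _ _ _ _ (fun k z => (box 1 B (tpath (cellval z) k [::])).1 0%N)) => [k|z _]; last exact: cv.
apply: (@measurable_tpath _ _ _ (fun u z => cellval z u) _ _ _ (fun u => (box 1 B u).1 0%N)) => u.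
rewrite /cellval; apply: measurableT_comp => //; apply: emeasurable_funD; first exact: measurable_cst.
apply: measurableT_comp; first exact: nondecreasing_ext_measurable (loss_nd lHp).
by apply: measurable_funB => //; exact: measurable_cst.
Qed.

(** Leaves are left continuous in [z]. At a maximum of two children, if each fell below [c] at some
    index, both would do so at the larger index, since the values decrease in [z]. *)
Lemma tmax_left_cvg k u (c : \bar R) z (v : nat -> R) : nondecreasing_seq v -> v n @[n --> \oo] --> z ->
  (forall n, c <= tmax (cellval (v n)) k u) -> c <= tmax (cellval z) k u.
Proof.
move=> ndv vz; elim: k u => [|k IH] u /= h.
  have cv : cellval (v n) u @[n --> \oo] --> cellval z u.
    apply: cvgeN; apply: cvgeD; [exact: lossD_def|exact: cvg_cst|].
    apply: (loss_lc lHp); first by move=> i j ij; rewrite lerB//; exact: ndv.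
    by apply: cvgB => //; exact: cvg_cst.
  by apply: cvge_ge cv; exact: nearW.
have mono i j b : (i <= j)%N -> tmax (cellval (v j)) k (b :: u) <= tmax (cellval (v i)) k (b :: u).
  move=> ij; elim: k (b :: u) {IH h} => [|k IHk] w /=.
    rewrite leeN2; apply: leeD => //; apply: loss_nd lHp _ _ _; rewrite lerB//; exact: ndv.
  by rewrite ge_max !le_max !IHk orbT.
have [h1|/existsNP[i1 /negP]] := pselect (forall n, c <= tmax (cellval (v n)) k (false :: u)).
  by rewrite le_max IH.
rewrite -ltNge => h1.
have [h2|/existsNP[i2 /negP]] := pselect (forall n, c <= tmax (cellval (v n)) k (true :: u)).
  by rewrite le_max [X in _ || X]IH ?orbT.
rewrite -ltNge => h2.
have := h (maxn i1 i2); rewrite leNgt gt_max.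
by rewrite (le_lt_trans (mono _ _ _ (leq_maxl i1 i2)) h1) (le_lt_trans (mono _ _ _ (leq_maxr i1 i2)) h2).
Qed.

End selection.

(** An infimum of left continuous functions is in general not left continuous from below. Here all
    near-optimal splits lie in one box, so [- iconv] is the infimum over the depth of the finite
    maxima [tmax], to each of which [tmax_left_cvg] applies. *)
Lemma iconv_lc : convex_ext Ha -> convex_ext Hp -> tight Ha -> tight Hp ->
  forall z (u : nat -> R), nondecreasing_seq u -> u n @[n --> \oo] --> z ->
    iconv Ha Hp (u n) @[n --> \oo] --> iconv Ha Hp z.
Proof.
move=> cHa cHp tHa tHp z u ndu uz.
have uleq n : (u n <= z)%R.
  by rewrite -(cvg_lim _ uz)//; apply: nondecreasing_cvgn_le => //; apply/cvg_ex; exists z.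
have [B B0 hB] := iconv_box (`|u 0%N| + `|z|)%R cHa cHp tHa tHp.
have zZ : (`|z| <= `|u 0%N| + `|z|)%R by rewrite lerDr.
have uZ n : (`|u n| <= `|u 0%N| + `|z|)%R.
  rewrite ler_norml; apply/andP; split.
    apply: (@le_trans _ _ (u 0%N)); last exact: ndu.
    have := ler_norm (- u 0%N)%R; rewrite normrN; have := normr_ge0 z; lra.
  apply: (le_trans (uleq n)); apply: (le_trans (ler_norm _)); exact: zZ.
have nd : nondecreasing_seq (iconv Ha Hp \o u) by move=> i j ij; apply: iconv_nd; exact: ndu.
have := ereal_nondecreasing_cvgn nd; set l := ereal_sup _ => cl.
suff -> : iconv Ha Hp z = l by [].
have ul n : iconv Ha Hp (u n) <= l by apply: ereal_sup_ubound; exists n.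
apply/eqP; rewrite eq_le; apply/andP; split; last first.
  by apply: ge_ereal_sup => _ [n _ <-]; apply: iconv_nd.
rewrite -leeN2 -(tinf_iconv B0 hB zZ); apply: le_ereal_inf_tmp => _ [k _ <-].
apply: (tmax_left_cvg ndu uz) => n.
by apply: le_trans (tinf_le _ k _); rewrite (tinf_iconv B0 hB (uZ n)) leeN2.
Qed.

Lemma loss_iconv : convex_ext Ha -> convex_ext Hp -> tight Ha -> tight Hp ->
  loss (iconv Ha Hp) (ma + mp) (Num.min ea ep) (`|Ca| + `|Cp|) (sa + sp).
Proof.
move=> cHa cHp tHa tHp; split.
- by rewrite lt_min (loss_e lHa) (loss_e lHp).
- exact: iconv_lb.
- exact: iconv_up.
- exact: iconv_id.
- exact: iconv_nd.
- exact: iconv_lc.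
- exact: iconv_fin.
Qed.

Lemma iconv_argmin (Z : R) : convex_ext Ha -> convex_ext Hp -> tight Ha -> tight Hp ->
  exists B (xs : R -> R), [/\ measurable_fun setT xs, forall z, (`|xs z| <= B)%R &
    forall z, (`|z| <= Z)%R -> Ha (xs z) + Hp (z - xs z)%R = iconv Ha Hp z].
Proof.
move=> cHa cHp tHa tHp; have [B B0 hB] := iconv_box Z cHa cHp tHa tHp.
exists B, (argmin B); split.
- exact: measurable_argmin.
- by move=> z; have [] := argmin_spec B0 z.
- exact: (argmin_iconv B0 hB).
Qed.

End iconv_loss.

End InfConv.

(** * The first-best problem over one period *)

Section ConvexCost.
Context {R : realType} (N : nat) (c : 'rV[R]_N -> R).
Hypothesis sc : strictly_convex c.

Lemma strictly_convexW (x y : 'rV[R]_N) (l : R) : 0 <= l <= 1 ->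
  c (l *: x + (1 - l) *: y) <= l * c x + (1 - l) * c y.
Proof.
move=> /andP[l0 l1]; have [->|xy] := eqVneq x y.
  by rewrite -scalerDl -mulrDl addrC subrK scale1r mul1r.
have [->|l0'] := eqVneq l 0; first by rewrite scale0r mul0r subr0 scale1r mul1r !add0r.
have [->|l1'] := eqVneq l 1; first by rewrite subrr scale0r mul0r scale1r mul1r !addr0.
by apply/ltW/sc => //; rewrite !lt_neqAle l0 l1 eq_sym l0' l1'.
Qed.

(* one coordinate at a time: [x + v] lies between the two points whose [k]-th coordinate is pushed to the faces *)
Lemma convex_box_ub (r : R) (x : 'rV[R]_N) : 0 < r -> exists M, forall v : 'rV[R]_N,
  (forall i, `|v ord0 i| <= r) -> c (x + v) <= M.
Proof.
move=> r0; suff H k : (k <= N)%N -> forall x, exists M, forall v : 'rV[R]_N,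
    (forall i, `|v ord0 i| <= r) -> (forall i : 'I_N, (k <= i)%N -> v ord0 i = 0) -> c (x + v) <= M.
  have [M hM] := H N (leqnn N) x; exists M => v hv; apply: hM => // i.
  by rewrite leqNgt ltn_ord.
elim: k => [_ y|k IH kN y].
  exists (c y) => v _ h; suff -> : v = 0 by rewrite addr0.
  by apply/rowP => i; rewrite mxE h.
pose i0 := Ordinal kN; pose e : 'rV[R]_N := delta_mx ord0 i0.
have [M1 h1] := IH (ltnW kN) (y + r *: e); have [M2 h2] := IH (ltnW kN) (y - r *: e).
exists (Num.max M1 M2) => v hv v0.
pose v' := v - v ord0 i0 *: e.
have v'E (i : 'I_N) : v' ord0 i = if i == i0 then 0 else v ord0 i.
  by rewrite !mxE eqxx /=; case: eqP => [->|_]; rewrite ?mulr1 ?subrr// mulr0 subr0.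
have hv' (i : 'I_N) : `|v' ord0 i| <= r by rewrite v'E; case: eqP => // _; rewrite normr0 ltW.
have v'0 (i : 'I_N) : (k <= i)%N -> v' ord0 i = 0.
  rewrite v'E; case: eqP => // /eqP ii0; rewrite leq_eqVlt => /orP[/eqP ki|/v0//].
  by case/eqP: ii0; apply: val_inj; rewrite /= ki.
pose l := (v ord0 i0 + r) / (r + r).
have := hv i0; rewrite ler_norml => /andP[w1 w2].
have rr : 0 < r + r by lra.
have l01 : 0 <= l <= 1.
  by rewrite /l ler_pdivlMr// ler_pdivrMr// mul0r mul1r; lra.
have E : y + v = l *: (y + r *: e + v') + (1 - l) *: (y - r *: e + v').
  apply/rowP => i; rewrite !mxE eqxx/= /l; case: (i == i0) => /=; rewrite ?mulr1 ?mulr0; by field; lra.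
rewrite E; apply: le_trans (strictly_convexW _ _ l01) _.
have b1 := h1 _ hv' v'0; have b2 := h2 _ hv' v'0; have /andP[l0 l1] := l01.
have m1 : M1 <= Num.max M1 M2 by rewrite le_max lexx.
have m2 : M2 <= Num.max M1 M2 by rewrite le_max lexx orbT.
move: (Num.max M1 M2) m1 m2 => M m1 m2.
have g1 : l * c (y + r *: e + v') <= l * M by rewrite ler_wpM2l// (le_trans b1).
have g2 : (1 - l) * c (y - r *: e + v') <= (1 - l) * M by rewrite ler_wpM2l ?subr_ge0// (le_trans b2).
by lra.
Qed.

(** [x] lies between [x + v] and [x - v / r], and the latter is in the unit box around [x], where
    the cost is at most [M]. Small [r] gives lower semicontinuity at [x] with an explicit rate; a
    fixed [r] gives lower bounds on boxes. *)
Lemma convex_lower (x : 'rV[R]_N) : exists M, forall (r : R) (v : 'rV[R]_N), 0 < r ->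
  (forall i, `|v ord0 i| <= r) -> (1 + r) * c x - r * M <= c (x + v).
Proof.
have [M hM] := convex_box_ub x ltr01; exists M => r v r0 hv.
have E : x = (1 + r)^-1 *: (x + v) + (1 - (1 + r)^-1) *: (x - r^-1 *: v).
  apply/rowP => i; rewrite !mxE; field; lra.
have r1 : 0 < 1 + r by lra.
have l01 : 0 <= (1 + r)^-1 <= 1 by rewrite invr_ge0 (ltW r1) invf_le1//; lra.
have := strictly_convexW (x + v) (x - r^-1 *: v) l01; rewrite -E.
have : c (x - r^-1 *: v) <= M.
  apply: hM => i; rewrite !mxE normrN normrM gtr0_norm ?invr_gt0// mulrC ler_pdivrMr// mul1r; exact: hv.
move=> b1 b2.
have b3 : (1 + r) * c x <= (1 + r) * ((1 + r)^-1 * c (x + v) + (1 - (1 + r)^-1) * c (x - r^-1 *: v)).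
  by rewrite ler_wpM2l// ltW.
have b4 : (1 + r) * ((1 + r)^-1 * c (x + v) + (1 - (1 + r)^-1) * c (x - r^-1 *: v)) =
  c (x + v) + r * c (x - r^-1 *: v) by field; lra.
have b5 : r * c (x - r^-1 *: v) <= r * M by rewrite ler_wpM2l// ltW.
by rewrite b4 in b3; lra.
Qed.

Lemma convex_box_lb (r : R) : 0 < r -> exists L, forall v : 'rV[R]_N,
  (forall i, `|v ord0 i| <= r) -> L <= c v.
Proof.
move=> r0; have [M hM] := convex_lower 0; exists ((1 + r) * c 0 - r * M) => v hv.
by rewrite -[v]add0r; apply: hM.
Qed.

End ConvexCost.

Section RealCvg.
Context {R : realType}.

Lemma cvg_sumr (I : Type) (l : seq I) (f : I -> nat -> R) (g : I -> R) :
  (forall i, f i k @[k --> \oo] --> g i) ->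
  \sum_(i <- l) f i k @[k --> \oo] --> \sum_(i <- l) g i.
Proof.
move=> fg; elim: l => [|i l IH].
  by rewrite big_nil; under eq_fun do rewrite big_nil; exact: cvg_cst.
by rewrite big_cons; under eq_fun do rewrite big_cons; apply: cvgD.
Qed.

Lemma cvg_maxr (u v : nat -> R) (a b : R) :
  u k @[k --> \oo] --> a -> v k @[k --> \oo] --> b ->
  Num.max (u k) (v k) @[k --> \oo] --> Num.max a b.
Proof.
move=> ua vb; rewrite maxr_absE; under eq_fun do rewrite maxr_absE.
by apply: cvgMl; apply: cvgD; [exact: cvgD|apply: cvg_norm; exact: cvgB].
Qed.

End RealCvg.

Section FirstBest.
Context d (Omega : measurableType d) (R : realType) (Pr : probability Omega R).
Variable Gen : set (set Omega).
Hypothesis Gsub : <<s Gen >> `<=` (@measurable _ Omega).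
Local Notation G := (<<s Gen >>).
Local Notation OG := (g_sigma_algebraType Gen).
Context (N : nat) (c : 'rV[R]_N -> R) (H : R -> \bar R) (m e C s0 : R).
Hypotheses (sc : strictly_convex c) (lH : loss H m e C s0).
Context (hn : Omega -> R) (b : R) (rho : 'I_N -> Omega -> R) (K : R).
Hypotheses (mhn : measurable_fun setT hn) (hnb : forall w, `|hn w| <= b).
Hypotheses (mrho : forall i, measurable_fun setT (rho i)) (K0 : 0 <= K).
Hypothesis rhoK : {ae Pr, forall w, forall i, `|rho i w| <= K}.

Definition lin (a : 'rV[R]_N) w := \sum_(i < N) a ord0 i * rho i w.

Lemma measurable_lin (A : Omega -> 'rV[R]_N) :
  (forall i, measurable_fun setT (fun w => A w ord0 i)) -> measurable_fun setT (fun w => lin (A w) w).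
Proof. by move=> mA; apply: measurable_sum => i; apply: measurable_funM. Qed.

Lemma lin_le (a : 'rV[R]_N) (r : R) w : (forall i, `|rho i w| <= K) ->
  (forall i, `|a ord0 i| <= r) -> `|lin a w| <= N%:R * (r * K).
Proof.
move=> rK ar; apply: le_trans (ler_norm_sum _ _ _) _.
rewrite -[X in X%:R * _]card_ord -sumr_const mulr_suml; apply: ler_sum => i _.
by rewrite normrM mul1r ler_pM.
Qed.

Lemma condexp_H_exists (z : Omega -> R) : measurable_fun setT z ->
  exists V, condexp Pr G (fun w => H (z w)) V.
Proof.
move=> mz; apply: (@ce_exists _ _ _ Pr _ Gsub _ m) => [|w]; last exact: loss_lb lH _.
by apply: measurableT_comp mz; apply: nondecreasing_ext_measurable; exact: loss_nd lH.
Qed.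

Section tree.
Variable B : R.
Hypothesis B0 : 0 < B.
Local Notation bx := (box N.+1 B).
Local Notation ib := (inbox N.+1 B).

(** A point of the tree of dimension [N + 1] packs the effort into the coordinates below [N] and the
    number [s] into coordinate [N]. *)
Definition vec (x : nat -> R) : 'rV[R]_N := \row_(i < N) x i.

(* on the cell [u], [s - hn - a.rho] is at least [cell u] *)
Definition cell u w : R := (bx u).1 N - hn w -
  \sum_(i < N) Num.max ((bx u).1 i * rho i w) ((bx u).2 i * rho i w).

(** The cost is not monotone in the coordinates, so no corner of the cell bounds it; the infimum
    does. *)
Definition cmin u : R := inf [set c (vec x) | x in ib u].

Lemma ib_vec u x : ib u x -> forall i, `|vec x ord0 i| <= B.
Proof.
move=> xu i; rewrite mxE ler_norml; have /andP[h1 h2] := xu i.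
have [g1 g2] := box_bnd N.+1 (ltW B0) u i.
by rewrite (le_trans g1 h1) (le_trans h2 g2).
Qed.

Lemma cmin_has_inf u : has_inf [set c (vec x) | x in ib u].
Proof.
have [L hL] := convex_box_lb sc B0; split.
  exists (c (vec (bx u).1)), (bx u).1 => // j; rewrite lexx/=; exact: box_le (ltW B0) _ _.
by exists L => _ [x xu <-]; apply: hL; exact: ib_vec xu.
Qed.

Lemma cmin_le u x : ib u x -> cmin u <= c (vec x).
Proof. by move=> xu; apply: ge_inf; [exact: (cmin_has_inf u).2|exists x]. Qed.

Lemma cmin_sub b' u : cmin u <= cmin (b' :: u).
Proof.
apply: lb_le_inf; first exact: (cmin_has_inf _).1.
by move=> _ [x xu <-]; apply: cmin_le; exact: inbox_sub (ltW B0) _ _ _ xu.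
Qed.

Lemma measurable_cell u : measurable_fun setT (cell u).
Proof.
apply: measurable_funB; first by apply: measurable_funB => //; exact: measurable_cst.
apply: measurable_sum => i; apply: measurable_maxr; apply: measurable_funM => //; exact: measurable_cst.
Qed.

Lemma mul_itv_le (l h x r : R) : l <= x <= h -> x * r <= Num.max (l * r) (h * r).
Proof.
move=> /andP[lx xh]; rewrite le_max; have [r0|r0] := leP 0 r.
  by rewrite [X in _ || X]ler_wpM2r// orbT.
by rewrite ler_wnM2r// ltW.
Qed.

Lemma cell_le u x w : ib u x -> cell u w <= x N - hn w - lin (vec x) w.
Proof.
move=> xu; apply: lerB; first by rewrite lerB//; have /andP[] := xu N.
by apply: ler_sum => i _; rewrite mxE; apply: mul_itv_le; exact: xu.
Qed.

Lemma cell_sub b' u w : cell u w <= cell (b' :: u) w.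
Proof.
apply: lerB; first by rewrite lerB//; exact: (box_lo _ (ltW B0)).
apply: ler_sum => i _; rewrite ge_max; apply/andP; split; apply: mul_itv_le; apply/andP; split.
- exact: (box_lo _ (ltW B0)).
- exact: le_trans (box_le _ (ltW B0) _ _) (box_hi _ (ltW B0) _ _ _).
- exact: le_trans (box_lo _ (ltW B0) _ _ _) (box_le _ (ltW B0) _ _).
- exact: (box_hi _ (ltW B0)).
Qed.

Variable V : seq bool -> Omega -> \bar R.
Hypothesis cV : forall u, condexp Pr G (fun w => H (cell u w)) (V u).

(** An upper bound of [s - c a - E[H (s - hn - a.rho) | G]] over the cell, each of the three terms
    being estimated separately. A single conditional expectation per cell is used. *)
Definition phi u w : \bar R := (((bx u).2 N - cmin u)%:E - V u w)%E.

Lemma measurable_phi u : measurable_fun [set: OG] (phi u : OG -> \bar R).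
Proof. by apply: emeasurable_funB; [exact: measurable_cst|exact: ce_meas (cV u)]. Qed.

Lemma phi_dec : {ae Pr, forall w, tdec (phi ^~ w)}.
Proof.
have : {ae Pr, forall w, forall bu : bool * seq bool, phi (bu.1 :: bu.2) w <= phi bu.2 w}%E.
  apply: ae_forall_count => -[b' u]; rewrite [(_, _).1]/= [(_, _).2]/=.
  have : {ae Pr, forall w, V u w <= V (b' :: u) w}%E.
    by apply: (ce_leT Gsub (cV _) (cV _)); apply: aeW => w; apply: loss_nd lH _ _ _; exact: cell_sub.
  apply: filterS => w h; rewrite /phi; apply: leeB => //; rewrite lee_fin lerB//.
    exact: (box_hi _ (ltW B0)).
  exact: cmin_sub.
by apply: filterS => w h b' u; exact: (h (b', u)).
Qed.

Definition upath w k := tpath (phi ^~ w) k [::].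

Definition xlim w (j : nat) : R := limn (fun k => (bx (upath w k)).1 j).

Lemma measurable_upath d' (T' : measurableType d') (f : seq bool -> T') k :
  measurable_fun [set: OG] (fun w : OG => f (upath w k)).
Proof. by apply: (@measurable_tpath R _ OG phi); exact: measurable_phi. Qed.

Lemma xlim_spec w : [/\ forall k, ib (upath w k) (xlim w),
    forall j, (fun k => (bx (upath w k)).1 j) @ \oo --> xlim w j,
    forall j, (j < N.+1)%N -> (fun k => (bx (upath w k)).2 j) @ \oo --> xlim w j &
    forall j, nondecreasing_seq (fun k => (bx (upath w k)).1 j) /\
      nonincreasing_seq (fun k => (bx (upath w k)).2 j)].
Proof.
have [x [xin xlo xhi mon]] := box_cvg N.+1 (ltW B0) (w := upath w) erefl
  (fun k => ex_intro _ _ (tpathS (phi ^~ w) k [::])).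
suff -> : xlim w = x by split.
by apply/funext => j; apply/cvg_lim => //; exact: xlo.
Qed.

Lemma measurable_xlim j : measurable_fun [set: OG] (fun w : OG => xlim w j).
Proof.
apply: (@measurable_fun_cvg _ OG R setT (fun k (w : OG) => (bx (upath w k)).1 j)) => [k|w _].
  exact: (measurable_upath (fun u => (bx u).1 j)).
by have [_ + _ _] := xlim_spec w; exact.
Qed.

Lemma cmin_cvg w : cmin (upath w k) @[k --> \oo] --> c (vec (xlim w)).
Proof.
have [xin xlo xhi mon] := xlim_spec w.
have [M hM] := convex_lower sc (vec (xlim w)).
apply/cvgrPdist_le => eps eps0.
pose cx := c (vec (xlim w)).
(* By [convex_lower], a cell of width at most [r] around the limit changes the cost downwards by at
   most [r * (|cx| + |M|)], hence by less than [eps]. *)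
pose r := eps / (1 + `|cx| + `|M|).
have den : 0 < 1 + `|cx| + `|M| by rewrite -addrA ltr_wpDr// addr_ge0.
have r0 : 0 < r by rewrite divr_gt0.
near=> k; have up : cmin (upath w k) <= cx by apply: cmin_le; exact: xin.
rewrite ger0_norm ?subr_ge0// lerBlDr -lerBlDl.
apply: lb_le_inf; first exact: (cmin_has_inf _).1.
move=> _ [x xu <-].
have wk : forall i : 'I_N, (bx (upath w k)).2 i - (bx (upath w k)).1 i <= r.
  near: k; apply: filter_forall => i.
  have : (bx (upath w k)).2 i - (bx (upath w k)).1 i @[k --> \oo] --> xlim w i - xlim w i.
    by apply: cvgB; [apply: xhi; apply: leq_trans (ltn_ord i) _|exact: xlo].
  by rewrite subrr => /(cvgr_lt 0) /(_ _ r0); apply: filterS => k /ltW.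
have := hM r (vec x - vec (xlim w)) r0; rewrite [vec (xlim w) + _]addrC subrK => h.
have hx : forall i, `|(vec x - vec (xlim w)) ord0 i| <= r.
  move=> i; rewrite !mxE.
  have /andP[x1 x2] := xu i; have /andP[y1 y2] := xin k i.
  by have hw := wk i; rewrite ler_norml; apply/andP; split; lra.
apply: le_trans (h hx); rewrite -/cx.
have c1 : r * (1 + `|cx| + `|M|) = eps by rewrite /r divfK// gt_eqF.
have c2 := ler_norm (- cx); have c3 := ler_norm M; rewrite normrN in c2.
have c4 : r * (- cx) <= r * `|cx| by rewrite ler_pM2l.
have c5 : r * M <= r * `|M| by rewrite ler_pM2l.
by lra.
Unshelve. all: by end_near. Qed.

Lemma ib_event u (A : Omega -> nat -> R) :
  (forall j, measurable_fun [set: OG] (fun w : OG => A w j)) -> G [set w | ib u (A w)].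
Proof.
move=> mA; have -> : [set w | ib u (A w)] = \bigcap_j ((fun w => A w j) @^-1` `[(bx u).1 j, (bx u).2 j]%classic).
  apply/seteqP; split => w /= h j; first by move=> _ /=; rewrite in_itv/=; exact: h.
  by have := h j I; rewrite /= in_itv/=.
apply: (@bigcap_measurable _ OG) => [|j _]; first by exists 0%N.
by have := mA j measurableT _ (measurable_itv `[(bx u).1 j, (bx u).2 j]); rewrite setTI.
Qed.

Lemma phi_le_value (A : Omega -> nat -> R) (W : Omega -> \bar R) u :
  (forall j, measurable_fun [set: OG] (fun w : OG => A w j)) ->
  condexp Pr G (fun w => H (A w N - hn w - lin (vec (A w)) w)) W ->
  {ae Pr, forall w, ib u (A w) -> ((A w N)%:E - W w - (c (vec (A w)))%:E <= phi u w)%E}.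
Proof.
move=> mA cW.
have GE := ib_event u mA.
have : {ae Pr, forall w, ib u (A w) -> (V u w <= W w)%E}.
  by apply: (ce_le Gsub (cV u) cW GE); apply: aeW => w /= h; apply: loss_nd lH _ _ _; exact: cell_le.
apply: filterS => w h wu; rewrite addeAC -EFinB; apply: leeB; last exact: h.
rewrite lee_fin lerB//; first by have /andP[] := wu N.
exact: cmin_le.
Qed.

Lemma value_le_tinf (A : Omega -> nat -> R) (W : Omega -> \bar R) :
  (forall j, measurable_fun [set: OG] (fun w : OG => A w j)) ->
  condexp Pr G (fun w => H (A w N - hn w - lin (vec (A w)) w)) W ->
  {ae Pr, forall w, ib [::] (A w) ->
    ((A w N)%:E - W w - (c (vec (A w)))%:E <= tinf (phi ^~ w) [::])%E}.
Proof.
move=> mA cW.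
have : {ae Pr, forall w, forall u, ib u (A w) -> ((A w N)%:E - W w - (c (vec (A w)))%:E <= phi u w)%E}.
  by apply: ae_forall_count => u; exact: phi_le_value.
apply: filterS => w h w0; apply: le_ereal_inf_tmp => _ [k _ <-].
exact: (@tmax_ge_inbox _ N.+1 B (phi ^~ w) _ (A w) k [::] h w0).
Qed.

(** [V] is indexed by fixed cells, whereas the node reached is random. Splitting [E] along the next
    turn, an event of [G], makes the node deterministic after [k] splits. *)
Lemma V_upath k u (E : set Omega) (X W : Omega -> \bar R) : G E -> condexp Pr G X W ->
  (forall w, E w -> X w = H (cell (tpath (phi ^~ w) k u) w)) ->
  {ae Pr, forall w, E w -> W w = V (tpath (phi ^~ w) k u) w}.
Proof.
move=> GE cW; elim: k u E GE => [|k IH] u E GE XE.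
  have h1 : {ae Pr, forall w, E w -> (W w <= V u w)%E}.
    by apply: (ce_le Gsub cW (cV u) GE); apply: aeW => w /XE ->.
  have h2 : {ae Pr, forall w, E w -> (V u w <= W w)%E}.
    by apply: (ce_le Gsub (cV u) cW GE); apply: aeW => w /XE ->.
  by apply: filterS2 h1 h2 => w a1 a2 Ew; apply/eqP; rewrite eq_le a1// a2.
have mch : measurable_fun [set: OG] (fun w : OG => tchoice (phi ^~ w) u).
  by apply: measurable_tchoice; exact: measurable_phi.
have Gb b' : G (E `&` [set w | tchoice (phi ^~ w) u = b']).
  apply: Gcap => //; have := mch measurableT [set b'] (I : measurable [set b']).
  by rewrite setTI.
have h b' : {ae Pr, forall w, E w /\ tchoice (phi ^~ w) u = b' -> W w = V (tpath (phi ^~ w) k (b' :: u)) w}.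
  by apply: IH (Gb b') _ => w [Ew wb]; rewrite XE//= wb.
apply: filterS2 (h true) (h false) => w ht hf Ew /=.
by case E' : (tchoice (phi ^~ w) u); [apply: ht|apply: hf].
Qed.

(** Along the chosen branch the cell bounds increase to the loss argument at the limit point, so
    their conditional losses converge by monotone convergence, while [cmin] and the upper corner
    converge as well. The bounds [phi] stay above [tinf] and tend to the true value. *)
Lemma tinf_le_value (W : Omega -> \bar R) :
  condexp Pr G (fun w => H (xlim w N - hn w - lin (vec (xlim w)) w)) W ->
  {ae Pr, forall w, (tinf (phi ^~ w) [::] <= (xlim w N)%:E - W w - (c (vec (xlim w)))%:E)%E}.
Proof.
move=> cW.
pose z k w := cell (upath w k) w.
have mz k : measurable_fun setT (z k).
  have mf (f : seq bool -> R) : measurable_fun setT (fun w => f (upath w k)).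
    by apply: (@meas_wrt_measurable _ _ _ Gsub); apply/meas_wrtP; exact: measurable_upath.
  apply: measurable_funB; first by apply: measurable_funB => //; exact: (mf (fun u => (bx u).1 N)).
  apply: measurable_sum => i; apply: measurable_maxr; apply: measurable_funM => //.
    exact: (mf (fun u => (bx u).1 i)).
  exact: (mf (fun u => (bx u).2 i)).
have /choice[Wk cWk] k := condexp_H_exists (mz k).
have WkV : {ae Pr, forall w, forall k, Wk k w = V (upath w k) w}.
  apply: ae_forall_count => k; have GT : G setT by exact: (@measurableT _ OG).
  have := @V_upath k [::] setT _ _ GT (cWk k) (fun _ _ => erefl).
  by apply: filterS => w; exact.
have ndz w : nondecreasing_seq (z ^~ w).
  by apply/nondecreasing_seqP => k; rewrite /z /upath tpathS; exact: cell_sub.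
have cz w : z k w @[k --> \oo] --> xlim w N - hn w - lin (vec (xlim w)) w.
  have [xin xlo xhi mon] := xlim_spec w.
  apply: cvgB; first by apply: cvgB; [exact: xlo|exact: cvg_cst].
  apply: cvg_sumr => i; rewrite mxE -[X in _ --> X]maxxx.
  apply: cvg_maxr; apply: cvgMl; first exact: xlo.
  by apply: xhi; apply: leq_trans (ltn_ord i) _.
have WkW : {ae Pr, forall w, Wk k w @[k --> \oo] --> W w}.
  apply: (@ce_mono _ _ _ Pr _ Gsub m (fun k w => H (z k w)) _ _ _ _ _ _ _ cWk cW).
  - by move=> k; apply: measurableT_comp (mz k); exact: nondecreasing_ext_measurable (loss_nd lH).
  - by move=> k w; exact: loss_lb lH _.
  - by move=> w i j ij; apply: loss_nd lH _ _ _; exact: ndz.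
  - by move=> w; apply: loss_lc lH _ _ _ (cz w); exact: ndz.
apply: filterS3 WkV WkW phi_dec => w h1 h2 dec.
have [xin xlo xhi mon] := xlim_spec w.
have cphi : phi (upath w k) w @[k --> \oo] --> ((xlim w N)%:E - W w - (c (vec (xlim w)))%:E)%E.
  rewrite addeAC -EFinB; apply: cvgeB; first exact: fin_num_adde_defr.
    by apply: cvg_EFin; [exact: nearW|apply: cvgB; [exact: xhi|exact: cmin_cvg]].
  by under eq_fun do rewrite -h1.
by apply: cvge_ge cphi; apply: nearW => k; exact: tinf_tpath.
Qed.

End tree.
Lemma enorm_ge (a : 'rV[R]_N) i : `|a ord0 i| <= enorm a.
Proof.
rewrite /enorm -sqrtr_sqr ler_wsqrtr// (bigD1 i)//= lerDl sumr_ge0// => j _; exact: sqr_ge0.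
Qed.

Lemma sum_le_enorm (a : 'rV[R]_N) : \sum_(i < N) `|a ord0 i| <= N%:R * enorm a.
Proof.
rewrite -[X in X%:R * _]card_ord -sumr_const mulr_suml; apply: ler_sum => i _.
by rewrite mul1r enorm_ge.
Qed.

(** The three lower bounds on the conditional loss [W] have separate tasks: the one of slope 1
    cancels [s] and leaves the cost against a linear gain, bounding [a]; the one of slope [1 + e]
    then bounds [s] above by [S1]; the constant [m] bounds [s] below through [S2]. *)
Lemma coercive (Lo : R) : superlinear c -> exists2 B : R, 0 < B &
  forall (a : 'rV[R]_N) (s : R) (W : \bar R),
    ((s - b - K * \sum_(i < N) `|a ord0 i|)%:E <= W)%E ->
    (((1 + e) * (s - b - K * \sum_(i < N) `|a ord0 i|) - C)%:E <= W)%E ->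
    (m%:E <= W)%E -> (Lo%:E < s%:E - W - (c a)%:E)%E ->
    (forall i, `|a ord0 i| <= B) /\ `|s| <= B.
Proof.
move=> sl; have e0 := loss_e lH.
(* The gain grows at most at rate [N * K] in [enorm a]; the extra 1 makes the net value fall at
   least as fast as the norm. *)
have [r0 hr0] := sl (N%:R * K + 1).
pose r1 := Num.max 1 (Num.max r0 (b - Lo)).
have r11 : 1 <= r1 by rewrite le_max lexx.
have r1r0 : r0 <= r1 by rewrite !le_max lexx !orbT.
have r1b : b - Lo <= r1 by rewrite !le_max lexx !orbT.
have [Lc hLc] := convex_box_lb sc (lt_le_trans ltr01 r11).
pose y1 := b + K * (N%:R * r1).
pose S1 := ((1 + e) * y1 + C - Lc - Lo) / e.
pose S2 := Lo + m + Lc.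
exists (r1 + `|S1| + `|S2|); first by rewrite -addrA ltr_wpDr ?addr_ge0// (lt_le_trans ltr01).
move=> a s W W1 W2 W3 big.
have nS1 := normr_ge0 S1; have nS2 := normr_ge0 S2.
have [W' WE] : exists W' : R, W = W'%:E.
  by move: W3 big; case: (W) => [r| |]//= _; exists r.
move: W1 W2 W3 big; rewrite {}WE -!EFinB !lee_fin lte_fin => W1 W2 W3 big.
set SA := \sum_(i < N) `|a ord0 i| in W1 W2.
have ar : forall i, `|a ord0 i| <= r1.
  move=> i; rewrite leNgt; apply/negP => ai.
  have en : r1 < enorm a by apply: lt_le_trans ai (enorm_ge a i).
  have en0 : 0 < enorm a by apply: lt_trans en; exact: lt_le_trans ltr01 r11.
  have := hr0 a (le_trans r1r0 (ltW en)); rewrite ler_pdivlMr// => ca.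
  have : K * SA <= K * (N%:R * enorm a) by rewrite ler_wpM2l// sum_le_enorm.
  move: ca W1 big en r1b; move: (enorm a) (c a) => ea ca h1 h2 h3 h4 h5 h6.
  have : s - W' - ca <= b - ea by lra.
  by lra.
have SAr : K * SA <= K * (N%:R * r1).
  rewrite ler_wpM2l// -[X in X%:R * _]card_ord -sumr_const mulr_suml; apply: ler_sum => i _.
  by rewrite mul1r.
have ca := hLc a ar.
split; first by move=> i; apply: le_trans (ar i) _; lra.
have s1 : s <= `|S1|.
  apply: le_trans (ler_norm S1); rewrite /S1 ler_pdivlMr//.
  have : (1 + e) * (s - y1) <= (1 + e) * (s - b - K * SA).
    by rewrite ler_wpM2l; [|lra|rewrite /y1; lra].
  by lra.
have s2 : - s <= `|S2|.
  by have := ler_norm (- S2); rewrite normrN /S2 => h; apply: le_trans h; lra.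
by rewrite ler_norml; apply/andP; split; lra.
Qed.

Lemma first_best : superlinear c ->
  exists (A : Omega -> 'rV[R]_N) (s M : Omega -> R) (BB : R),
  [/\ (forall i, measurable_fun [set: OG] (fun w : OG => A w ord0 i)) /\
      measurable_fun [set: OG] (s : OG -> R),
      measurable_fun [set: OG] (M : OG -> R) /\
      measurable_fun [set: OG] (fun w : OG => c (A w)),
      (forall w, [/\ forall i, `|A w ord0 i| <= BB, `|s w| <= BB, `|M w| <= BB & `|c (A w)| <= BB]),
      (forall V, condexp Pr G (fun w => H (s w - hn w - lin (A w) w)) V ->
        {ae Pr, forall w, ((s w)%:E - V w - (c (A w))%:E = (M w)%:E)%E}) &
      (forall (A' : Omega -> 'rV[R]_N) (s' : Omega -> R) V',
        (forall i, measurable_fun [set: OG] (fun w : OG => A' w ord0 i)) ->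
        measurable_fun [set: OG] (s' : OG -> R) ->
        condexp Pr G (fun w => H (s' w - hn w - lin (A' w) w)) V' ->
        {ae Pr, forall w, ((s' w)%:E - V' w - (c (A' w))%:E <= (M w)%:E)%E})].
Proof.
move=> sl; have nd := loss_nd lH.
pose s1 := s0 - b.
have /fineK h0 : H s0 \is a fin_num.
  by rewrite fin_numElt (lt_le_trans _ (loss_lb lH _)) ?ltNyr//= (loss_fin lH).
(* A guaranteed value: no effort and [s = s0 - b], for which the loss argument is at most [s0]. Any
   pair with a larger value lies in the box of [coercive], and the box is enlarged to contain this
   reference point. *)
pose Lo := s1 - fine (H s0) - c 0.
have [B1 B10 hB1] := coercive Lo sl.
pose B := B1 + `|s1|.
have B0 : 0 < B by rewrite ltr_wpDr.
have B1B : B1 <= B by rewrite lerDl.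
have /choice[V cV] u : exists V, condexp Pr G (fun w => H (cell B u w)) V.
  by apply: condexp_H_exists; exact: measurable_cell.
pose ph := phi B V; pose tin w := tinf (ph ^~ w) [::].
pose p0 (j : nat) : R := if j == N then s1 else 0.
have p0N : p0 N = s1 by rewrite /p0 eqxx.
have vp0 : vec p0 = 0.
  by apply/rowP => i; rewrite !mxE /p0 ltn_eqF.
have ibp0 : inbox N.+1 B [::] p0.
  move=> j /=; rewrite -ler_norml /p0; case: eqP => _; last by rewrite normr0 ltW.
  by rewrite /B lerDr ltW.
have lin0 w : lin 0 w = 0 by rewrite /lin big1// => i _; rewrite mxE mul0r.
have Lotin : {ae Pr, forall w, (Lo%:E <= tin w)%E}.
  have [W0 cW0] : exists W, condexp Pr G (fun w => H (p0 N - hn w - lin (vec p0) w)) W.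
    apply: condexp_H_exists; apply: measurable_funB; last first.
      by apply: (@measurable_lin (fun=> vec p0)) => i; exact: measurable_cst.
    by apply: measurable_funB => //; exact: measurable_cst.
  have m0 j : measurable_fun [set: OG] (fun w : OG => p0 j) by exact: measurable_cst.
  have W0le : {ae Pr, forall w, (W0 w <= (fine (H s0))%:E)%E}.
    apply: (ce_leT Gsub cW0 (ce_cst Pr _ _)); apply: aeW => w; rewrite h0; apply: nd.
    rewrite p0N vp0 lin0 subr0 /s1; have := hnb w; rewrite ler_norml => /andP[? ?]; lra.
  have := @value_le_tinf B B0 V cV (fun=> p0) W0 m0 cW0.
  move: W0le; apply: filterS2 => w h1 h2; apply: le_trans (h2 ibp0).
  rewrite p0N vp0 /Lo !EFinB; apply: leeB => //; exact: leeB.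
pose Up := B - m - cmin B [::].
have tinUp : {ae Pr, forall w, (tin w <= Up%:E)%E}.
  have : {ae Pr, forall w, (m%:E <= V [::] w)%E}.
    by apply: (ce_ge_cst Gsub (cV [::])); apply: aeW => w; exact: loss_lb lH _.
  apply: filterS => w h; apply: le_trans (tinf_le _ 0%N _) _.
  have -> : Up%:E = ((B - cmin B [::])%:E - m%:E)%E by rewrite -EFinB /Up addrAC.
  by rewrite /= /ph /phi/=; apply: leeD => //; rewrite EFinN leeN2.
pose M w := Num.max (Num.min (fine (tin w)) Up) Lo.
have tinM : {ae Pr, forall w, tin w = (M w)%:E}.
  apply: filterS2 Lotin tinUp => w h1 h2.
  have ft : tin w \is a fin_num.
    by rewrite fin_numElt (lt_le_trans _ h1) ?ltNyr// (le_lt_trans h2)// ltry.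
  rewrite /M; move: h1 h2; rewrite -(fineK ft)/= !lee_fin => h1 h2.
  by rewrite min_l// max_l.
pose A w := vec (xlim B V w) : 'rV[R]_N; pose s w := xlim B V w N.
have As w : (forall i, `|A w ord0 i| <= B) /\ `|s w| <= B.
  have [xin _ _ _] := @xlim_spec B B0 V w; split; first by move=> i; exact: (ib_vec B0 (xin 0%N)).
  by have := xin 0%N N; rewrite /= -ler_norml.
have [Lc hLc] := convex_box_lb sc B0; have [Uc hUc] := convex_box_ub sc 0 B0.
exists A, s, M, (B + `|Up| + `|Lo| + `|Lc| + `|Uc|).
have nUp := normr_ge0 Up; have nLo := normr_ge0 Lo; have nLc := normr_ge0 Lc; have nUc := normr_ge0 Uc.
split.
- split; last exact: measurable_xlim.
  by move=> i; under eq_fun do rewrite mxE; exact: measurable_xlim.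
- split.
    apply: measurable_maxr; last exact: measurable_cst.
    apply: measurable_minr; last exact: measurable_cst.
    apply: measurableT_comp => //; apply: (@measurable_tinf R _ OG ph) => u.
    exact: measurable_phi.
  apply: (@measurable_fun_cvg _ OG R setT (fun k (w : OG) => cmin B (upath B V w k))) => [k|w _].
    exact: (measurable_upath cV (cmin B)).
  exact: cmin_cvg.
- move=> w; have [h1 h2] := As w; split.
  + by move=> i; apply: le_trans (h1 i) _; lra.
  + by apply: le_trans h2 _; lra.
  + have g1 : Lo <= M w by rewrite /M le_max lexx orbT.
    have g2 : M w <= Num.max Up Lo by rewrite /M ge_max !le_max ge_min lexx orbT lexx !orbT.
    have l1 := ler_norm Up; have l2 := ler_norm (- Lo); rewrite normrN in l2; have l3 := ler_norm Lo.
    rewrite ler_norml; apply/andP; split; first by lra.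
    by apply: (le_trans g2); rewrite ge_max; apply/andP; split; lra.
  + have g1 := hLc _ h1; have g2 := hUc _ h1; rewrite add0r in g2.
    have l1 := ler_norm (- Lc); rewrite normrN in l1; have l2 := ler_norm Uc.
    by rewrite ler_norml; apply/andP; split; lra.
- move=> W cW.
  have := @tinf_le_value B B0 V cV W cW.
  have := @value_le_tinf B B0 V cV (xlim B V) W (fun j => measurable_xlim B0 cV j) cW.
  move: tinM; apply: filterS3 => w e1 e2 e3.
  have [xin _ _ _] := @xlim_spec B B0 V w.
  by rewrite -e1; apply/eqP; rewrite eq_le e3 e2//; exact: (xin 0%N).
- move=> A' s' W mA' ms' cW.
  pose X' w (j : nat) : R := if @insub nat (fun j => (j < N)%N) 'I_N j is Some i then A' w ord0 i
    else if j == N then s' w else 0.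
  have X'N w : X' w N = s' w by rewrite /X' insubF ?ltnn// eqxx.
  have vX' w : vec (X' w) = A' w by apply/rowP => i; rewrite mxE /X' valK.
  have mX' j : measurable_fun [set: OG] (fun w : OG => X' w j).
    by rewrite /X'; case: insub => [i|]//; case: eqP => // _; exact: measurable_cst.
  pose E : set Omega := [set w | inbox N.+1 B [::] (X' w)].
  have GE : G E by exact: ib_event.
  (* The tree bound concerns points of the box, so the competitor is replaced by the reference point
     off the event [E]. On [E] the conditional losses compare by locality; off [E] a value above
     [Lo] would contradict [coercive]. *)
  pose X2 w j := if `[< E w >] then X' w j else p0 j.
  have mE : measurable_fun [set: OG] (fun w : OG => `[< E w >]).
    apply: (measurable_fun_bool true); rewrite setTI.
    by rewrite (_ : _ @^-1` _ = E)//; apply/seteqP; split => w /=; rewrite ?asboolE; move/asboolP.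
  have mX2 j : measurable_fun [set: OG] (fun w : OG => X2 w j).
    by apply: measurable_fun_ifT => //; exact: measurable_cst.
  have tom (f : Omega -> R) : measurable_fun [set: OG] (f : OG -> R) -> measurable_fun setT f.
    by move=> mf; apply: (@meas_wrt_measurable _ _ _ Gsub); exact/meas_wrtP.
  have [W2 cW2] : exists W2, condexp Pr G (fun w => H (X2 w N - hn w - lin (vec (X2 w)) w)) W2.
    apply: condexp_H_exists; apply: measurable_funB.
      by apply: measurable_funB => //; exact: tom (mX2 N).
    by apply: measurable_lin => i; under eq_fun do rewrite mxE; exact: tom (mX2 i).
  have in2 w : inbox N.+1 B [::] (X2 w) by rewrite /X2; case: asboolP.
  have E12 w : E w -> H (X2 w N - hn w - lin (vec (X2 w)) w) = H (s' w - hn w - lin (A' w) w).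
    by move=> Ew; rewrite /X2 asboolT// X'N vX'.
  have W2W : {ae Pr, forall w, E w -> (W2 w <= W w)%E}.
    by apply: (ce_le Gsub cW2 cW GE); apply: aeW => w /E12 ->.
  have onE := @value_le_tinf B B0 V cV X2 W2 mX2 cW2.
  (* A [G]-measurable lower bound of the loss argument: functions of it are their own conditional
     expectations, which turns the bounds on [H] into the premises of [coercive]. *)
  pose Q w := s' w - b - K * \sum_(i < N) `|A' w ord0 i|.
  have mQ : measurable_fun [set: OG] (Q : OG -> R).
    apply: measurable_funB; first by apply: measurable_funB => //; exact: measurable_cst.
    apply: measurable_funM; first exact: measurable_cst.
    by apply: measurable_sum => i; apply: measurableT_comp.
  have Qz : {ae Pr, forall w, Q w <= s' w - hn w - lin (A' w) w}.
    apply: filterS rhoK => w rK; have := hnb w; rewrite ler_norml => /andP[_ hb].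
    have : `|lin (A' w) w| <= K * \sum_(i < N) `|A' w ord0 i|.
      rewrite /lin mulr_sumr; apply: le_trans (ler_norm_sum _ _ _) _; apply: ler_sum => i _.
      by rewrite normrM mulrC ler_wpM2r.
    by rewrite ler_norml => /andP[_ lb']; rewrite /Q; lra.
  have cQ (f : R -> R) : measurable_fun setT f -> condexp Pr G (fun w => (f (Q w))%:E) (fun w => (f (Q w))%:E).
    by move=> mf; apply: ce_self; apply/meas_wrtP/measurable_EFinP; exact: measurableT_comp mf mQ.
  have W1 : {ae Pr, forall w, ((Q w)%:E <= W w)%E}.
    apply: (ce_leT Gsub (cQ id _) cW) => //.
    by apply: filterS Qz => w h; apply: le_trans (loss_id lH _); rewrite lee_fin.
  have W2' : {ae Pr, forall w, (((1 + e) * Q w - C)%:E <= W w)%E}.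
    apply: (ce_leT Gsub (cQ (fun x => (1 + e) * x - C) _) cW).
      by apply: measurable_funB.
    apply: filterS Qz => w h; apply: le_trans (loss_up lH _); rewrite lee_fin lerB// ler_wpM2l//.
    by have := loss_e lH; lra.
  have W3 : {ae Pr, forall w, (m%:E <= W w)%E}.
    by apply: (ce_ge_cst Gsub cW); apply: aeW => w; exact: loss_lb lH _.
  apply: filterS3 (filterI (filterI W1 W2') (filterI W3 W2W)) (filterI onE Lotin) tinM
    => w [[w1 w2] [w3 w4]] [w5 w6] w7.
  rewrite -w7; have [Ew|nEw] := pselect (E w).
    have := w5 (in2 w); rewrite /X2 asboolT// X'N vX'; apply: le_trans.
    by apply: leeB => //; apply: leeB => //; exact: w4.
  apply: le_trans w6; rewrite leNgt; apply/negP => big.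
  have [a1 a2] := hB1 _ _ _ w1 w2 w3 big.
  apply: nEw => j /=; rewrite -ler_norml /X'.
  case: insub => [i|]; first exact: le_trans (a1 i) B1B.
  by case: eqP => _; [exact: le_trans a2 B1B|rewrite normr0 ltW].
Qed.

End FirstBest.

(** * The optimal contract over one period *)

Section EReal.
Context {R : realType}.
Local Open Scope ereal_scope.

Lemma adde_le_sube (a b : \bar R) (r : R) : b < +oo -> a + b <= r%:E -> a <= r%:E - b.
Proof.
case: a b => [a| |] [b| |] //=; rewrite ?leey ?leNye// => _.
by rewrite -EFinD -EFinB !lee_fin; lra.
Qed.

Lemma le_sube_adde (a b : \bar R) (r : R) : a <= r%:E - b -> a + b <= r%:E.
Proof.
case: a b => [a| |] [b| |] //=; rewrite ?leey ?leNye//.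
by rewrite -!EFinD !lee_fin; lra.
Qed.

Lemma le_sube_swap (a b : \bar R) (r : R) : a <= r%:E - b -> b < +oo -> b <= r%:E - a.
Proof.
case: a b => [a| |] [b| |] //=; rewrite ?leey ?leNye//.
by rewrite -!EFinD !lee_fin => h _; lra.
Qed.

(** When the limits are infinite of opposite signs their sum is [-oo] by convention, so the bound
    holds without any limit theorem. *)
Lemma cvg_adde_le (u v : nat -> \bar R) (a b : \bar R) (r : R) :
  u n @[n --> \oo] --> a -> v n @[n --> \oo] --> b ->
  (forall n, u n + v n <= r%:E) -> a + b <= r%:E.
Proof.
move=> ua vb h; have [ab|nab] := boolP (a +? b).
  by apply: cvge_le (cvgeD ab ua vb); exact: nearW.
by move: nab; case: (a) (b) => [?| |] [?| |]//; rewrite ?leNye.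
Qed.

End EReal.

Section OneStep.
Context d (Omega : measurableType d) (R : realType) (Pr : probability Omega R).
Context (N : nat) (P : nat -> Omega -> 'rV[R]_N) (t : nat).
Hypotheses (Fsub : Filt P t `<=` (@measurable _ Omega)) (Fsub1 : Filt P t.+1 `<=` (@measurable _ Omega)).
Hypothesis Fle : Filt P t `<=` Filt P t.+1.
Context (c : 'rV[R]_N -> R) (Ha Hp : R -> \bar R) (ma ea Ca sa mp ep Cp sp : R).
Hypotheses (sc : strictly_convex c) (sl : superlinear c).
Hypotheses (lHa : loss Ha ma ea Ca sa) (lHp : loss Hp mp ep Cp sp).
Hypotheses (cHa : convex_ext Ha) (cHp : convex_ext Hp) (tHa : tight Ha) (tHp : tight Hp).
Let rho (i : 'I_N) w := (P t.+1 w ord0 i - P t w ord0 i) / P t w ord0 i.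
Hypothesis mrho : forall i, meas_wrt (Filt P t.+1) (rho i).
Context (hn : Omega -> R) (b K : R).
Hypotheses (mhn : meas_wrt (Filt P t.+1) hn) (hnb : forall w, `|hn w| <= b).
Hypotheses (K0 : 0 <= K) (rhoK : {ae Pr, forall w, forall i, `|rho i w| <= K}).
Local Notation F := (Filt P t).

Definition ae_measurable (X : Omega -> \bar R) :=
  exists2 X', measurable_fun setT X' & {ae Pr, forall w, X w = X' w}.

Lemma iconv_le_loss_ext (g1 g2 : R) (x1 x2 : \bar R) (y : R) n : (x1 + x2 <= y%:E)%E ->
  (iconv Ha Hp (g1 + g2 - y) <=
   loss_ext Ha (g1%:E - mine x1 n%:R%:E) + loss_ext Hp (g2%:E - mine x2 n%:R%:E))%E.
Proof.
have inf1 (x : \bar R) : (+oo + loss_ext Hp x = +oo)%E.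
  by apply: addye; rewrite -ltNye (lt_le_trans _ (loss_ext_lb _ lHp)) ?ltNyr.
have inf2 (x : \bar R) : (loss_ext Ha x + +oo = +oo)%E.
  by apply: addey; rewrite -ltNye (lt_le_trans _ (loss_ext_lb _ lHa)) ?ltNyr.
have mN : mine -oo%E n%:R%:E = -oo%E :> \bar R by rewrite min_l ?leNye.
have eN (g : R) (H : R -> \bar R) : loss_ext H (g%:E - mine -oo%E n%:R%:E)%E = +oo%E by rewrite mN.
case: x1 x2 => [x1| |] [x2| |] // xy; rewrite ?eN ?inf1 ?inf2 ?leey//.
rewrite -!EFin_min -!EFinB/=.
set a := Num.min x1 _; set a' := Num.min x2 _.
have h1 : a <= x1 by rewrite ge_min lexx.
have h2 : a' <= x2 by rewrite ge_min lexx.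
move: xy; rewrite -EFinD lee_fin => xy.
apply: (@le_trans _ _ (iconv Ha Hp (g1 + g2 - (a + a')))).
  by apply: iconv_nd lHp _ _ _; lra.
have -> : g2 - a' = (g1 + g2 - (a + a')) - (g1 - a) by ring.
exact: iconv_le.
Qed.

Lemma first_best_upper (ht : Omega -> R) :
  (forall (A' : Omega -> 'rV[R]_N) (s' : Omega -> R) V',
     (forall i, meas_wrt F (fun w => A' w ord0 i)) -> meas_wrt F s' ->
     condexp Pr F (fun w => iconv Ha Hp (s' w - hn w - gain P (A' w) t w)) V' ->
     {ae Pr, forall w, ((s' w)%:E - V' w - (c (A' w))%:E <= (ht w)%:E)%E}) ->
  forall (Ab : Omega -> 'rV[R]_N) (D : Omega -> R) (G1 X1 Ya Yp : Omega -> \bar R),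
    adapted_vec P t Ab -> meas_wrt F D -> ae_measurable G1 -> ae_measurable X1 ->
    OCE1ext Pr P Ha t G1 Ya -> OCE1ext Pr P Hp t X1 Yp ->
    {ae Pr, forall w, (G1 w + X1 w <= (hn w + gain P (Ab w) t w + D w)%:E)%E} ->
    {ae Pr, forall w, (Ya w + Yp w <= (ht w + c (Ab w) + D w)%:E)%E}.
Proof.
move=> FB Ab D G1' X1' Ya Yp mAb mD [G1 mG1 eG1] [X1 mX1 eX1] oG oX GX'.
have {oG}oG : OCE1ext Pr P Ha t G1 Ya by apply: OCE1ext_ae oG => //; exact: aeW.
have {oX}oX : OCE1ext Pr P Hp t X1 Yp by apply: OCE1ext_ae oX => //; exact: aeW.
have GX : {ae Pr, forall w, (G1 w + X1 w <= (hn w + gain P (Ab w) t w + D w)%:E)%E}.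
  by apply: filterS3 eG1 eX1 GX' => w -> ->.
have [Wa cWa upa] := OCE1ext_up Fsub lHa mG1 oG.
have [Wp cWp upp] := OCE1ext_up Fsub lHp mX1 oX.
pose r w := ht w + c (Ab w) + D w.
have key n (g1 g2 : R) V1 V2 :
    condexp Pr F (fun w => loss_ext Ha (g1%:E - mine (G1 w) n%:R%:E)%E) V1 ->
    condexp Pr F (fun w => loss_ext Hp (g2%:E - mine (X1 w) n%:R%:E)%E) V2 ->
    {ae Pr, forall w, ((g1%:E - V1 w) + (g2%:E - V2 w) <= (r w)%:E)%E /\ (g2%:E - V2 w < +oo)%E}.
  move=> cV1 cV2.
  have mD' : measurable_fun setT D by exact: (meas_wrt_measurable Fsub).
  have mg : measurable_fun setT (fun w => gain P (Ab w) t w).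
    apply: (@measurable_lin _ _ _ _ rho) => [i|i]; first exact: (meas_wrt_measurable Fsub1 (mrho i)).
    exact: (meas_wrt_measurable Fsub (mAb i)).
  have lI := loss_iconv lHa lHp cHa cHp tHa tHp.
  have [Vs cVs] : exists V, condexp Pr F (fun w => iconv Ha Hp ((g1 + g2 - D w) - hn w - gain P (Ab w) t w)) V.
    apply: (ce_loss_exists Pr Fsub lI (X := fun w => (g1 + g2 - D w) - hn w - gain P (Ab w) t w)).
    apply: measurable_funB => //; apply: measurable_funB; last exact: (meas_wrt_measurable Fsub1).
    by apply: measurable_funB => //; exact: measurable_cst.
  have ms : meas_wrt F (fun w => g1 + g2 - D w).
    by apply/meas_wrtP; apply: measurable_funB; [exact: measurable_cst|exact/meas_wrtP].
  have fb := FB Ab _ _ mAb ms cVs.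
  have m1 : measurable_fun setT (fun w => loss_ext Ha (g1%:E - mine (G1 w) n%:R%:E)%E)
    by exact: (measurable_loss_ext _ _ lHa).
  have m2 : measurable_fun setT (fun w => loss_ext Hp (g2%:E - mine (X1 w) n%:R%:E)%E)
    by exact: (measurable_loss_ext _ _ lHp).
  pose m := Num.min ma mp.
  have l1 w : (m%:E <= loss_ext Ha (g1%:E - mine (G1 w) n%:R%:E))%E.
    by apply: le_trans (loss_ext_lb _ lHa); rewrite lee_fin ge_min lexx.
  have l2 w : (m%:E <= loss_ext Hp (g2%:E - mine (X1 w) n%:R%:E))%E.
    by apply: le_trans (loss_ext_lb _ lHp); rewrite lee_fin ge_min lexx orbT.
  have [Z cZ eZ] := ce_add Fsub m1 m2 l1 l2 cV1 cV2.
  have VZ : {ae Pr, forall w, (Vs w <= Z w)%E}.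
    apply: (ce_leT Fsub cVs cZ); apply: filterS GX => w h.
    have -> : (g1 + g2 - D w) - hn w - gain P (Ab w) t w = g1 + g2 - (hn w + gain P (Ab w) t w + D w) by ring.
    exact: iconv_le_loss_ext.
  have V1m : {ae Pr, forall w, (m%:E <= V1 w)%E} by apply: (ce_ge_cst Fsub cV1); exact: aeW.
  have V2m : {ae Pr, forall w, (m%:E <= V2 w)%E} by apply: (ce_ge_cst Fsub cV2); exact: aeW.
  apply: filterS3 (filterI V1m V2m) (filterI eZ VZ) fb => w [h1 h2] [h3 h4] h5.
  move: h1 h2 h3 h4 h5; rewrite /r; case: (V1 w) => [v1| |]//=; last first.
    move=> _ m2' _ _ _; rewrite addNye leNye; split=> //; move: m2'.
    by case: (V2 w) => [v2| |]//= _; rewrite -EFinB ltry.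
  case: (V2 w) => [v2| |]//= _ _ ->; last by rewrite addeNy leNye.
  rewrite -!EFinD lee_fin ltry; case: (Vs w) => [v| |]//=.
  by rewrite -?EFinB -?EFinD ?lee_fin => h4 h5; split=> //; lra.
(* The joint bound over pairs [(g1, g2)] is turned into a bound on the sum of two suprema one
   variable at a time: with [g2] fixed it bounds [Wa], and after a swap the resulting inequality
   bounds [Wp]. *)
have main n : {ae Pr, forall w, (Wa n w + Wp n w <= (r w)%:E)%E}.
  have : {ae Pr, forall w, (Wp n w <= (r w)%:E - Wa n w)%E}.
    apply: upp => g2 V2 cV2.
    have h1 : {ae Pr, forall w, (Wa n w <= (r w)%:E - (g2%:E - V2 w))%E}.
      apply: upa => g1 V1 cV1; apply: filterS (key n g1 g2 V1 V2 cV1 cV2) => w [h1 h2].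
      exact: adde_le_sube.
    have h2 : {ae Pr, forall w, (g2%:E - V2 w < +oo)%E}.
      have V2m : {ae Pr, forall w, (mp%:E <= V2 w)%E}.
        by apply: (ce_ge_cst Fsub cV2); apply: aeW => w; exact: (loss_ext_lb _ lHp).
      by apply: filterS V2m => w; case: (V2 w) => [v| |]//= _; rewrite -EFinB ltry.
    by apply: filterS2 h1 h2 => w a1 a2; exact: le_sube_swap.
  by apply: filterS => w h; rewrite addeC; exact: le_sube_adde.
have main' : {ae Pr, forall w, forall n, (Wa n w + Wp n w <= (r w)%:E)%E} by exact: ae_forall_count.
by apply: filterS3 main' cWa cWp => w h1 h2 h3; exact: cvg_adde_le h2 h3 h1.
Qed.

Lemma meas_gain (A : Omega -> 'rV[R]_N) : adapted_vec P t A ->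
  meas_wrt (Filt P t.+1) (fun w => gain P (A w) t w).
Proof.
move=> mA; apply/meas_wrtP; apply: measurable_sum => i; apply: measurable_funM.
  by apply/meas_wrtP => B mB; apply: Fle; exact: mA.
by apply/meas_wrtP; exact: (mrho i).
Qed.

Lemma clamp_exists (V : Omega -> \bar R) (k : R) : meas_wrt F V -> {ae Pr, forall w, `|V w| <= k%:E}%E ->
  exists v : Omega -> R, [/\ meas_wrt F v, forall w, `|v w| <= `|k| & {ae Pr, forall w, V w = (v w)%:E}].
Proof.
move=> mV Vk; exists (fun w => Num.max (- `|k|) (Num.min (fine (V w)) `|k|)); split.
- apply/meas_wrtP; apply: measurable_maxr; first exact: measurable_cst.
  apply: measurable_minr; last exact: measurable_cst.
  by apply: measurableT_comp => //; exact/meas_wrtP.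
- move=> w; have k0 : - `|k| <= `|k| by apply: le_trans (normr_ge0 k); rewrite oppr_le0.
  by rewrite ler_norml le_max lexx/= ge_max k0 ge_min lexx orbT.
- apply: filterS Vk => w; case: (V w) => [v| |]//=.
  rewrite lee_fin => vk; have {vk} : `|v| <= `|k| by exact: le_trans vk (ler_norm _).
  by rewrite ler_norml => /andP[h1 h2]; rewrite min_l// max_r.
Qed.

(** All that the dynamic argument retains of a period. The normalisation pays the agent exactly his
    cost and leaves the surplus [ht] to the principal. [D] is cash known at [t], moved between the
    two in the third clause and added to the total in the fourth; wealth accumulated earlier will
    play its part. *)
Definition optimal_step (A : Omega -> 'rV[R]_N) (Gam ht : Omega -> R) (BB : R) :=
  [/\ [/\ adapted_vec P t A, meas_wrt (Filt P t.+1) Gam, meas_wrt F ht & meas_wrt F (fun w => c (A w))],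
    (forall w, [/\ forall i, `|A w ord0 i| <= BB, `|Gam w| <= BB, `|ht w| <= BB & `|c (A w)| <= BB]),
    (forall (D : Omega -> R) (b' : R), meas_wrt F D -> {ae Pr, forall w, `|D w| <= b'} ->
      OCE1ext Pr P Ha t (fun w => (Gam w + D w)%:E) (fun w => (c (A w) + D w)%:E) /\
      OCE1ext Pr P Hp t (fun w => (hn w + gain P (A w) t w - Gam w - D w)%:E) (fun w => (ht w - D w)%:E)) &
    (forall (Ab : Omega -> 'rV[R]_N) (D : Omega -> R) (G1 X1 Ya Yp : Omega -> \bar R),
      adapted_vec P t Ab -> meas_wrt F D -> ae_measurable G1 -> ae_measurable X1 ->
      OCE1ext Pr P Ha t G1 Ya -> OCE1ext Pr P Hp t X1 Yp ->
      {ae Pr, forall w, (G1 w + X1 w <= (hn w + gain P (Ab w) t w + D w)%:E)%E} ->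
      {ae Pr, forall w, (Ya w + Yp w <= (ht w + c (Ab w) + D w)%:E)%E})].

Lemma optimal_step_exists : exists A Gam ht BB, optimal_step A Gam ht BB.
Proof.
have lI := loss_iconv lHa lHp cHa cHp tHa tHp.
have mhn' := meas_wrt_measurable Fsub1 mhn.
have mrho' i := meas_wrt_measurable Fsub1 (mrho i).
have [A [s [M [BB [[mA ms] [mM mcA] bnd opt fb]]]]] := first_best Fsub sc lI mhn' hnb mrho' K0 rhoK sl.
have {fb}UB := first_best_upper (fun A' s' V' h1 h2 h3 =>
  fb A' s' V' (fun i => (meas_wrtP _ _).1 (h1 i)) ((meas_wrtP _ _).1 h2) h3).
have {}mA : adapted_vec P t A by move=> i; apply/meas_wrtP; exact: (mA i).
move: ms mM mcA => /meas_wrtP ms /meas_wrtP mM /meas_wrtP mcA.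
pose z w := s w - hn w - gain P (A w) t w.
have mg1 := meas_gain mA.
have mz : meas_wrt (Filt P t.+1) z.
  apply/meas_wrtP; apply: measurable_funB; last exact/meas_wrtP.
  by apply: measurable_funB; apply/meas_wrtP => // B mB; apply: Fle; exact: ms.
pose Z := BB + b + N%:R * (BB * K).
have zZ : {ae Pr, forall w, `|z w| <= Z}.
  apply: filterS rhoK => w hr; have [h1 h2 _ _] := bnd w; have h3 := hnb w.
  have h4 : `|gain P (A w) t w| <= N%:R * (BB * K) by exact: (lin_le hr).
  rewrite /z /Z; apply: le_trans (ler_normB _ _) _; apply: lerD => //.
  by apply: le_trans (ler_normB _ _) _; exact: lerD.
have [B [xs [mxs xsB xsE]]] := iconv_argmin lHa lHp Z cHa cHp tHa tHp.
pose x w := xs (z w).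
have mx : meas_wrt (Filt P t.+1) x by apply/meas_wrtP; apply: measurableT_comp mxs _; exact/meas_wrtP.
have mx' := meas_wrt_measurable Fsub1 mx.
have mz' := meas_wrt_measurable Fsub1 mz.
have mzx' : measurable_fun setT (fun w => z w - x w) by exact: measurable_funB.
have [Va cVa] := ce_loss_exists Pr Fsub lHa mx'.
have [Vp cVp] := ce_loss_exists Pr Fsub lHp mzx'.
pose m := Num.min ma mp.
have [Vs cVs VsE] : exists2 Vs, condexp Pr F (fun w => Ha (x w) + Hp (z w - x w))%E Vs &
    {ae Pr, forall w, Vs w = (Va w + Vp w)%E}.
  apply: (ce_add Fsub (c := m) _ _ _ _ cVa cVp).
  - by apply: measurableT_comp mx'; apply: nondecreasing_ext_measurable; exact: loss_nd lHa.
  - by apply: measurableT_comp mzx'; apply: nondecreasing_ext_measurable; exact: loss_nd lHp.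
  - by move=> w; apply: le_trans (loss_lb lHa _); rewrite lee_fin ge_min lexx.
  - by move=> w; apply: le_trans (loss_lb lHp _); rewrite lee_fin ge_min lexx orbT.
have {cVs}cVs : condexp Pr F (fun w => iconv Ha Hp (z w)) Vs.
  by apply: ce_ae cVs; apply: filterS zZ => w; exact: xsE.
have {}opt := opt _ cVs.
have Vam : {ae Pr, forall w, (m%:E <= Va w)%E}.
  apply: (ce_ge_cst Fsub cVa); apply: aeW => w.
  by apply: le_trans (loss_lb lHa _); rewrite lee_fin ge_min lexx.
have Vpm : {ae Pr, forall w, (m%:E <= Vp w)%E}.
  apply: (ce_ge_cst Fsub cVp); apply: aeW => w.
  by apply: le_trans (loss_lb lHp _); rewrite lee_fin ge_min lexx orbT.
(* The sum of the two conditional losses is finite by optimality and each is bounded below, so each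
   is finite. This also bounds [Va] by [|m|] plus the bounds on [s], the cost and [M], hence the
   constant in the next clamp. *)
have key : {ae Pr, forall w, [/\ Va w \is a fin_num, m <= fine (Va w),
    Vp w = (s w - c (A w) - M w - fine (Va w))%:E & m <= fine (Vp w)]}.
  apply: filterS3 (filterI VsE opt) Vam Vpm => w [-> ].
  case: (Va w) (Vp w) => [va| |] [vp| |] //=.
  rewrite -!EFinD => -[<-]; rewrite !lee_fin => h1 h2; split => //; congr EFin; ring.
have [va [mva vaB vaE]] : exists va : Omega -> R, [/\ meas_wrt F va,
    forall w, `|va w| <= `| `|m| + 3 * BB + `|m| | & {ae Pr, forall w, Va w = (va w)%:E}].
  apply: clamp_exists; first exact: cVa.1.
  apply: filterS key => w [/fineK <- h1 ->] /=; rewrite lee_fin => h2.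
  have [_ /ler_normlP[? ?] /ler_normlP[? ?] /ler_normlP[? ?]] := bnd w.
  have /ler_normlP[? ?] := lexx `|m|; move: h1 h2 => /= h1 h2.
  by rewrite ler_norml; apply/andP; split; lra.
(* The cash term is fixed by the normalisation: with [s = D0] the agent's loss argument is [x], so
   his objective equals [D0 - va = c (A w)]. *)
pose D0 w := va w + c (A w); pose Gam w := D0 w - x w.
have mD0 : meas_wrt F D0 by apply/meas_wrtP; apply: measurable_funD; exact/meas_wrtP.
pose B0 := `| `|m| + 3 * BB + `|m| |; rewrite -/B0 in vaB.
have GamB w : `|Gam w| <= B0 + BB + B.
  have [_ _ _ h] := bnd w; apply: le_trans (ler_normB _ _) _; apply: lerD; last exact: xsB.
  by apply: le_trans (ler_normD _ _) _; exact: lerD.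
have mGam : meas_wrt (Filt P t.+1) Gam.
  apply/meas_wrtP; apply: measurable_funB; last exact/meas_wrtP.
  by apply/meas_wrtP => E mE; apply: Fle; exact: mD0.
exists A, Gam, M, (Num.max BB (B0 + BB + B)).
split; [by []| | |exact: UB].
  move=> w; have [h1 h2 h3 h4] := bnd w.
  by split; [move=> i| | |]; rewrite le_max ?h1 ?h3 ?h4 ?GamB ?orbT.
move=> D b' mD Db.
have mGam' := meas_wrt_measurable Fsub1 mGam.
have mg' := meas_wrt_measurable Fsub1 mg1.
have mD' := meas_wrt_measurable Fsub mD.
have mX1 : measurable_fun setT (fun w => (Gam w + D w)%:E) by apply/measurable_EFinP; exact: measurable_funD.
have mX2 : measurable_fun setT (fun w => (hn w + gain P (A w) t w - Gam w - D w)%:E).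
  apply/measurable_EFinP; apply: measurable_funB => //; apply: measurable_funB => //.
  exact: measurable_funD.
have [Y1 [mY1 _ oY1 LB1]] : exists Y : Omega -> R, [/\ meas_wrt F Y, exists b', forall w, (`|Y w| <= b')%R,
    OCE1ext Pr P Ha t (fun w => (Gam w + D w)%:E) (EFin \o Y) &
    forall (s : Omega -> R) V, meas_wrt F s ->
      condexp Pr F (fun w => Ha (s w - (Gam w + D w))%R) V ->
      {ae Pr, forall w, ((s w)%:E - V w <= (Y w)%:E)%E}].
  apply: (OCE1ext_exists Fsub lHa mX1 (b := B0 + BB + B + b')).
  apply: filterS Db => w h; rewrite lee_fin; apply: le_trans (ler_normD _ _) _; exact: lerD.
have [Y2 [mY2 _ oY2 LB2]] : exists Y : Omega -> R, [/\ meas_wrt F Y, exists b', forall w, (`|Y w| <= b')%R,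
    OCE1ext Pr P Hp t (fun w => (hn w + gain P (A w) t w - Gam w - D w)%:E) (EFin \o Y) &
    forall (s : Omega -> R) V, meas_wrt F s ->
      condexp Pr F (fun w => Hp (s w - (hn w + gain P (A w) t w - Gam w - D w))%R) V ->
      {ae Pr, forall w, ((s w)%:E - V w <= (Y w)%:E)%E}].
  apply: (OCE1ext_exists Fsub lHp mX2 (b := b + N%:R * (BB * K) + (B0 + BB + B) + b')).
  apply: filterS2 Db rhoK => w h hr; rewrite lee_fin; have [h1 _ _ _] := bnd w.
  have h4 : `|gain P (A w) t w| <= N%:R * (BB * K) by exact: (lin_le hr).
  apply: le_trans (ler_normB _ _) _; apply: lerD => //.
  apply: le_trans (ler_normB _ _) _; apply: lerD => //.
  by apply: le_trans (ler_normD _ _) _; exact: lerD.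
have lb1 : {ae Pr, forall w, c (A w) + D w <= Y1 w}.
  have mS : meas_wrt F (fun w => D0 w + D w) by apply/meas_wrtP; apply: measurable_funD; exact/meas_wrtP.
  have : condexp Pr F (fun w => Ha ((D0 w + D w) - (Gam w + D w))) Va.
    by apply: ce_ae cVa; apply: aeW => w; congr Ha; rewrite /Gam; ring.
  move=> /(LB1 _ _ mS); apply: filterS2 vaE => w ->.
  by rewrite -EFinB lee_fin /D0; lra.
have lb2 : {ae Pr, forall w, M w - D w <= Y2 w}.
  have mS : meas_wrt F (fun w => s w - D0 w - D w).
    by apply/meas_wrtP; apply: measurable_funB; [apply: measurable_funB|]; exact/meas_wrtP.
  have : condexp Pr F (fun w => Hp (s w - D0 w - D w - (hn w + gain P (A w) t w - Gam w - D w))) Vp.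
    by apply: ce_ae cVp; apply: aeW => w; congr Hp; rewrite /Gam /z; ring.
  move=> /(LB2 _ _ mS); apply: filterS3 vaE key => w -> [_ _ -> _].
  by rewrite -EFinB lee_fin /D0/=; lra.
(* The bounds [lb1] and [lb2] add up to exactly the first-best total, so this upper bound on the sum
   forces equality in both. *)
have ub : {ae Pr, forall w, ((EFin \o Y1) w + (EFin \o Y2) w <= (M w + c (A w) + 0)%:E)%E}.
  apply: (UB A (fun=> 0) _ _ _ _ mA _ _ _ oY1 oY2).
  - by apply/meas_wrtP; exact: measurable_cst.
  - by exists (fun w => (Gam w + D w)%:E) => //; exact: aeW.
  - by exists (fun w => (hn w + gain P (A w) t w - Gam w - D w)%:E) => //; exact: aeW.
  - by apply: aeW => w; rewrite -EFinD lee_fin; lra.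
split.
  apply: OCE1ext_ae oY1; first exact: aeW.
  by apply: filterS3 lb1 lb2 ub => w /= h1 h2; rewrite -EFinD lee_fin => h3; congr EFin; lra.
apply: OCE1ext_ae oY2; first exact: aeW.
by apply: filterS3 lb1 lb2 ub => w /= h1 h2; rewrite -EFinD lee_fin => h3; congr EFin; lra.
Qed.

End OneStep.

(** * The dynamic problem *)

Section Filtration.
Context d (Omega : measurableType d) (R : realType) (N T : nat).
Context (P : nat -> Omega -> 'rV[R]_N).

Lemma Filt_mono s t : (s <= t)%N -> Filt P s `<=` Filt P t.
Proof.
move=> st; apply: sub_sigma_algebra2 => A [r [i [B [rs mB ->]]]].
by exists r, i, B; split => //; exact: leq_trans st.
Qed.

Lemma meas_wrt_Filt s t d' (T' : measurableType d') (X : Omega -> T') : (s <= t)%N ->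
  meas_wrt (Filt P s) X -> meas_wrt (Filt P t) X.
Proof. by move=> st mX B mB; apply: (Filt_mono st); exact: mX. Qed.

Lemma meas_price s t i : (s <= t)%N -> meas_wrt (Filt P t) (fun w => P s w ord0 i).
Proof. by move=> st B mB; apply: sub_sigma_algebra; exists s, i, B. Qed.

Hypothesis mP : forall t (i : 'I_N), (t <= T)%N -> measurable_fun setT (fun w => P t w ord0 i).

Lemma Filt_measurable t : (t <= T)%N -> Filt P t `<=` (@measurable _ Omega).
Proof.
move=> tT; apply: smallest_sub; first exact: sigma_algebra_measurable.
by move=> A [s [i [B [st mB ->]]]]; rewrite -[_ @^-1` _]setTI; apply: mP => //; exact: leq_trans tT.
Qed.

Hypothesis P_gt0 : forall t (i : 'I_N) w, (t <= T)%N -> 0 < P t w ord0 i.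

Lemma meas_return t i : (t < T)%N ->
  meas_wrt (Filt P t.+1) (fun w => (P t.+1 w ord0 i - P t w ord0 i) / P t w ord0 i).
Proof.
move=> tT; have m0 := meas_price i (leqnSn t); have m1 := meas_price i (leqnn t.+1).
(* Positivity of prices at every [w] allows the reciprocal to be written as a real power, a
   measurable function. *)
have -> : (fun w => (P t.+1 w ord0 i - P t w ord0 i) / P t w ord0 i) =
    (fun w => (P t.+1 w ord0 i - P t w ord0 i) * P t w ord0 i `^ (-1)).
  by apply/funext => w; rewrite powR_inv1// ltW// P_gt0// ltnW.
apply/meas_wrtP; apply: measurable_funM; last first.
  by apply: measurableT_comp (measurable_powR _) _; exact/meas_wrtP.
by apply: measurable_funB; exact/meas_wrtP.
Qed.

Context (Pr : probability Omega R) (pminus pplus : R).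
Hypothesis pm0 : 0 < pminus.
Hypothesis P_bounded : forall t (i : 'I_N), (t <= T)%N ->
  {ae Pr, forall w, pminus <= P t w ord0 i <= pplus}.

Lemma return_bounded t : (t < T)%N -> {ae Pr, forall w, forall i,
  `|(P t.+1 w ord0 i - P t w ord0 i) / P t w ord0 i| <= pplus / pminus}.
Proof.
move=> tT; apply: ae_forall_count => i.
apply: filterS2 (P_bounded i (ltnW tT)) (P_bounded i tT) => w /andP[h1 h2] /andP[h3 h4].
have p0 : 0 < P t w ord0 i by exact: lt_le_trans h1.
rewrite normrM normfV (gtr0_norm p0); apply: ler_pM => //; first by rewrite invr_ge0 ltW.
  move: pm0 h1 h2 h3 h4; move: (P t w ord0 i) (P t.+1 w ord0 i) => x y *.
  by rewrite ler_norml; apply/andP; split; lra.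
by rewrite lef_pV2.
Qed.

Lemma gainB (a a' : 'rV[R]_N) t w : gain P (a - a') t w = gain P a t w - gain P a' t w.
Proof. by rewrite /gain -sumrB; apply: eq_bigr => i _; rewrite !mxE mulrBl. Qed.

End Filtration.

(** * Reduction of the pasted functionals to a single period *)

Section Pasting.
Context d (Omega : measurableType d) (R : realType) (Pr : probability Omega R).
Context (N T : nat) (P : nat -> Omega -> 'rV[R]_N).
Hypothesis Fsub : forall t, (t <= T)%N -> Filt P t `<=` (@measurable _ Omega).
Context (H : nat -> R -> \bar R).
Hypothesis lH : forall t, (t < T)%N -> exists m e C s0, loss (H t) m e C s0.
Hypothesis tH : forall t, (t < T)%N -> tight (H t).

(** Pasting starts at [T] even when [X] is known at [t + 1]. Going backwards from [T], each step
    after [t] evaluates a known variable and returns it by [OCE1ext_adapted]. *)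
Lemma pasted_OCE1ext t (X X' Y : Omega -> \bar R) : (t < T)%N ->
  meas_wrt (Filt P t.+1) X' -> {ae Pr, forall w, X w = X' w} ->
  pasted Pr P H T t X Y -> OCE1ext Pr P (H t) t X Y.
Proof.
move=> tT mX' eX [Z [ZT hZ ZY]].
suff E k : (t < T - k)%N -> {ae Pr, forall w, Z (T - k)%N w = X w}.
  have tk : (T - (T - t.+1) = t.+1)%N by rewrite subKn.
  have /E : (t < T - (T - t.+1))%N by rewrite tk.
  rewrite tk => e; rewrite -ZY; apply: OCE1ext_ae e _ (hZ _ _); first exact: aeW.
  by rewrite leqnn.
elim: k => [_|k IH tk]; first by rewrite subn0 ZT; exact: aeW.
have kT : (k < T)%N by apply: ltnW; rewrite -subn_gt0; exact: leq_ltn_trans tk.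
have e : ((T - k.+1).+1 = T - k)%N by rewrite subnSK.
rewrite -e in IH; have {}IH := IH (ltnW tk).
have sT : (T - k.+1 < T)%N by rewrite e leq_subr.
have [m [ee [C [s0 l]]]] := lH sT.
have h := hZ (T - k.+1)%N; rewrite sT (ltnW tk) in h; have {}h := h isT.
have IH' : {ae Pr, forall w, Z (T - k.+1).+1 w = X' w} by apply: filterS2 IH eX => w ->.
have {h} := OCE1ext_adapted (Fsub (ltnW sT)) l (tH sT) (meas_wrt_Filt tk mX') IH' h.
by apply: filterS2 IH => w ->.
Qed.

(** The witness is constantly [X] after time [t]. Boundedness provides a one-step value of [X],
    which adaptedness then identifies with [X] itself. *)
Lemma OCE1ext_pasted t (X X' Y : Omega -> \bar R) (b : R) : (t < T)%N ->
  meas_wrt (Filt P t.+1) X' -> {ae Pr, forall w, X w = X' w} ->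
  {ae Pr, forall w, (`|X w| <= b%:E)%E} ->
  OCE1ext Pr P (H t) t X Y -> pasted Pr P H T t X Y.
Proof.
move=> tT mX' eX Xb hX; exists (fun s => if (s <= t)%N then Y else X); split.
- by rewrite leqNgt tT.
- move=> s /andP[]; rewrite leq_eqVlt => /orP[/eqP <- _|ts sT]; first by rewrite leqnn ltnn.
  rewrite ltnNge (ltnW ts)/= leqNgt ts/=.
  have mX's := meas_wrt_Filt ts mX'; have Fs := Fsub (ltnW sT).
  have Xb' : {ae Pr, forall w, (`|X' w| <= b%:E)%E} by apply: filterS2 eX Xb => w ->.
  have [m [e [C [s0 l]]]] := lH sT.
  have [Y' [_ _ oY' _]] := OCE1ext_exists Fs l (meas_wrt_measurable Fs mX's) Xb'.
  have XX : {ae Pr, forall w, X' w = X' w} by exact: aeW.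
  have e' := OCE1ext_adapted Fs l (tH sT) mX's XX oY'.
  apply: OCE1ext_ae oY'; first by apply: filterS eX.
  by apply: filterS2 e' eX => w -> ->.
- by rewrite leqnn.
Qed.

Lemma pasted_ae t (X X' Y : Omega -> \bar R) : (t < T)%N -> {ae Pr, forall w, X w = X' w} ->
  pasted Pr P H T t X Y -> pasted Pr P H T t X' Y.
Proof.
move=> tT e [Z [ZT hZ ZY]]; exists (fun s => if s == T then X' else Z s); split.
- by rewrite eqxx.
- move=> s /[dup] h /andP[_ sT]; rewrite (ltn_eqF sT); have {}h := hZ _ h.
  case: eqP => // sT'; apply: OCE1ext_ae h; last exact: aeW.
  by apply: filterS e => w <-; rewrite sT' ZT.
- by rewrite (ltn_eqF tT).
Qed.

End Pasting.

(** * Verification of the contract assembled from the optimal steps *)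

Section Dynamics.
Context d (Omega : measurableType d) (R : realType) (Pr : probability Omega R).
Context (N T : nat) (P : nat -> Omega -> 'rV[R]_N).
Context (c : nat -> 'rV[R]_N -> R) (Ha Hp : nat -> R -> \bar R) (K : R).
Hypothesis Fsub : forall t, (t <= T)%N -> Filt P t `<=` (@measurable _ Omega).
Hypothesis mrho : forall t i, (t < T)%N ->
  meas_wrt (Filt P t.+1) (fun w => (P t.+1 w ord0 i - P t w ord0 i) / P t w ord0 i).
Hypothesis rhoK : forall t, (t < T)%N -> {ae Pr, forall w, forall i,
  `|(P t.+1 w ord0 i - P t w ord0 i) / P t w ord0 i| <= K}.
Hypothesis lHa : forall t, (t < T)%N -> exists m e C s0, loss (Ha t) m e C s0.
Hypothesis lHp : forall t, (t < T)%N -> exists m e C s0, loss (Hp t) m e C s0.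
Hypotheses (tHa : forall t, (t < T)%N -> tight (Ha t)) (tHp : forall t, (t < T)%N -> tight (Hp t)).
Context (A : nat -> Omega -> 'rV[R]_N) (Gam h : nat -> Omega -> R) (BB : nat -> R).
Hypothesis hT : h T = fun=> 0.
Hypothesis opt : forall t, (t < T)%N ->
  optimal_step Pr P t (c t) (Ha t) (Hp t) (h t.+1) (A t) (Gam t) (h t) (BB t).

Local Notation F t := (Filt P t).

Lemma meas_h t : (t <= T)%N -> meas_wrt (F t) (h t).
Proof.
rewrite leq_eqVlt => /orP[/eqP ->|tT]; last by have [[]] := opt tT.
by rewrite hT; apply/meas_wrtP; exact: measurable_cst.
Qed.

Lemma h_bounded t : (t <= T)%N -> exists b, forall w, `|h t w| <= b.
Proof.
rewrite leq_eqVlt => /orP[/eqP ->|tT]; first by exists 0 => w; rewrite hT normr0.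
by have [_ B _ _] := opt tT; exists (BB t) => w; have [] := B w.
Qed.

Lemma meas_gain_t t (A' : Omega -> 'rV[R]_N) : (t < T)%N -> adapted_vec P t A' ->
  meas_wrt (F t.+1) (fun w => gain P (A' w) t w).
Proof. by move=> tT mA'; apply: meas_gain mA'; [exact: Filt_mono|move=> i; exact: mrho]. Qed.

Lemma gain_bounded t : (t < T)%N -> exists b, {ae Pr, forall w, `|gain P (A t w) t w| <= b}.
Proof.
move=> tT; exists (N%:R * (BB t * K)); apply: filterS (rhoK tT) => w rK.
have [_ B _ _] := opt tT; have [hA _ _ _] := B w.
exact: (lin_le (rho := fun i w => (P t.+1 w ord0 i - P t w ord0 i) / P t w ord0 i) rK hA).
Qed.

Lemma meas_wrt_ae_measurable t (X : Omega -> \bar R) : (t <= T)%N -> meas_wrt (F t) X -> ae_measurable Pr X.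
Proof. by move=> tT mX; exists X; [exact: (meas_wrt_measurable (Fsub tT))|exact: aeW]. Qed.

Lemma meas_cst t d' (T' : measurableType d') (x : T') : meas_wrt (F t) (fun=> x).
Proof. by apply/meas_wrtP; exact: measurable_cst. Qed.

Lemma meas_principal_share t : (t < T)%N ->
  meas_wrt (F t.+1) (fun w => (h t.+1 w + gain P (A t w) t w - Gam t w)%:E).
Proof.
move=> tT; have [[mA mG _ _] _ _ _] := opt tT.
have mg := meas_gain_t tT mA; have mh := meas_h tT.
apply/meas_wrtP/measurable_EFinP; apply: measurable_funB; last exact/meas_wrtP.
by apply: measurable_funD; exact/meas_wrtP.
Qed.

Lemma optimal_values t : (t < T)%N ->
  OCE1ext Pr P (Ha t) t (fun w => (Gam t w)%:E) (fun w => (c t (A t w))%:E) /\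
  OCE1ext Pr P (Hp t) t (fun w => (h t.+1 w + gain P (A t w) t w - Gam t w)%:E) (fun w => (h t w)%:E).
Proof.
move=> tT; have [_ _ ex _] := opt tT.
have [|h1 h2] := ex (fun=> 0) 0 (@meas_cst t _ R 0); first by apply: aeW => w; rewrite normr0.
by split; [apply: OCE1ext_ae h1|apply: OCE1ext_ae h2]; apply: aeW => w; rewrite ?addr0 ?subr0.
Qed.

(* Give the principal the share he has at the optimum, worth [h t]: the bound on the sum of the two
   values becomes a bound on the agent's. *)
Lemma agent_upper t (Ab : Omega -> 'rV[R]_N) (D : Omega -> R) (G1 Y : Omega -> \bar R) :
  (t < T)%N -> adapted_vec P t Ab -> meas_wrt (F t) D -> meas_wrt (F t.+1) G1 ->
  (forall w, G1 w = (Gam t w + gain P (Ab w) t w - gain P (A t w) t w + D w)%:E) ->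
  pasted Pr P Ha T t G1 Y -> {ae Pr, forall w, (Y w <= (c t (Ab w) + D w)%:E)%E}.
Proof.
move=> tT mAb mD mG E pY; have [_ _ _ UB] := opt tT; have [_ oX] := optimal_values tT.
have oG : OCE1ext Pr P (Ha t) t G1 Y.
  by apply: (pasted_OCE1ext Fsub lHa tHa tT mG _ pY); exact: aeW.
have := UB Ab D G1 _ Y _ mAb mD (meas_wrt_ae_measurable tT mG)
  (meas_wrt_ae_measurable tT (meas_principal_share tT)) oG oX.
have X : {ae Pr, forall w, (G1 w + (h t.+1 w + gain P (A t w) t w - Gam t w)%:E <=
   (h t.+1 w + gain P (Ab w) t w + D w)%:E)%E}.
  by apply: aeW => w; rewrite E -EFinD lee_fin; lra.
move=> /(_ X); apply: filterS => w; case: (Y w) => [y| |]//=; last by rewrite !leNye.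
by rewrite -EFinD !lee_fin; lra.
Qed.

Lemma agent_value t : (t < T)%N -> forall Y, pasted Pr P Ha T t (fun w => (Gam t w)%:E) Y ->
  {ae Pr, forall w, Y w = (c t (A t w))%:E}.
Proof.
move=> tT Y pY; have [oG _] := optimal_values tT; have [[_ mG _ _] _ _ _] := opt tT.
have [m [e [C [s0 l]]]] := lHa tT.
apply: (OCE1ext_unique (Fsub (ltnW tT)) (loss_nd l) _ oG).
apply: (pasted_OCE1ext Fsub lHa tHa tT _ _ pY); last exact: aeW.
by apply/meas_wrtP/measurable_EFinP/meas_wrtP.
Qed.

Lemma inC_opt t : (t < T)%N -> inC Pr P Ha c T t (fun=> 1) (A t) (Gam t).
Proof.
move=> tT; have [[mA mG _ mc] _ _ _] := opt tT; split => // Ab mAb Y Y' pY pY'.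
have mg := meas_gain_t tT mA; have mgb := meas_gain_t tT mAb.
have E w : (Gam t w + 1 * gain P (Ab w - A t w) t w)%:E =
    (Gam t w + gain P (Ab w) t w - gain P (A t w) t w + 0)%:E.
  by rewrite gainB mul1r addr0 addrA.
have mG1 : meas_wrt (F t.+1) (fun w => (Gam t w + 1 * gain P (Ab w - A t w) t w)%:E).
  rewrite (funext E); apply/meas_wrtP/measurable_EFinP.
  apply: measurable_funD; last exact: measurable_cst.
  by apply: measurable_funB; [apply: measurable_funD|]; exact/meas_wrtP.
have h1 := agent_upper tT mAb (@meas_cst t _ R 0) mG1 E pY'.
apply: filterS2 h1 (agent_value tT pY) => w hw ->.
by rewrite addr0 in hw; rewrite subee// leeBlDr// add0e.
Qed.

Lemma pasted_agent t : (t < T)%N -> pasted Pr P Ha T t (fun w => (Gam t w)%:E) (fun w => (c t (A t w))%:E).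
Proof.
move=> tT; have [[_ mG _ _] B _ _] := opt tT; have [oG _] := optimal_values tT.
apply: (OCE1ext_pasted Fsub lHa tHa tT (b := BB t) _ _ _ oG); try exact: aeW.
  by apply/meas_wrtP/measurable_EFinP/meas_wrtP.
by apply: aeW => w; have [_ b _ _] := B w; rewrite lee_fin.
Qed.

Lemma pasted_principal t : (t < T)%N ->
  pasted Pr P Hp T t (fun w => (h t.+1 w + gain P (A t w) t w - Gam t w)%:E) (fun w => (h t w)%:E).
Proof.
move=> tT; have [[_ mG _ _] B _ _] := opt tT; have [_ oX] := optimal_values tT.
have [b hb] := h_bounded tT; have [b' gb] := gain_bounded tT.
apply: (OCE1ext_pasted Fsub lHp tHp tT (b := b + b' + BB t) (meas_principal_share tT) _ _ oX); first exact: aeW.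
apply: filterS gb => w g; have [_ b1 _ _] := B w; rewrite lee_fin.
apply: le_trans (ler_normB _ _) _; apply: lerD => //.
by apply: le_trans (ler_normD _ _) _; exact: lerD.
Qed.

Lemma principal_upper t Z : (t < T)%N ->
  principal_family Pr P Ha Hp c T t (EFin \o h t.+1) Z -> {ae Pr, forall w, (Z w <= (h t w)%:E)%E}.
Proof.
move=> tT [beta [A' [G' [Ya [Yp [_ [mA' mG' _] pa pp ->]]]]]].
have [_ _ _ UB] := opt tT.
have mg := meas_gain_t tT mA'; have mh := meas_h tT.
have mG1 : meas_wrt (F t.+1) (fun w => (G' w)%:E) by apply/meas_wrtP/measurable_EFinP/meas_wrtP.
have mX1 : meas_wrt (F t.+1) (fun w => (EFin \o h t.+1) w + (gain P (A' w) t w - G' w)%:E)%E.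
  apply/meas_wrtP/measurable_EFinP; apply: measurable_funD; first exact/meas_wrtP.
  by apply: measurable_funB; exact/meas_wrtP.
have oa := pasted_OCE1ext Fsub lHa tHa tT mG1 (aeW _ (fun=> erefl)) pa.
have op := pasted_OCE1ext Fsub lHp tHp tT mX1 (aeW _ (fun=> erefl)) pp.
have := UB A' (fun=> 0) _ _ _ _ mA' (@meas_cst t _ R 0) (meas_wrt_ae_measurable tT mG1)
  (meas_wrt_ae_measurable tT mX1) oa op.
have X : {ae Pr, forall w, ((G' w)%:E + ((EFin \o h t.+1) w + (gain P (A' w) t w - G' w)%:E) <=
   (h t.+1 w + gain P (A' w) t w + 0)%:E)%E}.
  by apply: aeW => w /=; rewrite -!EFinD lee_fin; lra.
move=> /(_ X); apply: filterS => w.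
case: (Ya w) (Yp w) => [a| |] [p| |]//=; rewrite ?leNye//.
by rewrite -!EFinD !lee_fin; lra.
Qed.

Lemma principal_esssup t : (t < T)%N ->
  esssup Pr (F t) (principal_family Pr P Ha Hp c T t (EFin \o h t.+1)) (EFin \o h t).
Proof.
move=> tT; have mh := meas_h (ltnW tT); split.
- by apply/meas_wrtP/measurable_EFinP/meas_wrtP.
- by move=> Z fZ; exact: (principal_upper tT fZ).
move=> W _ hW.
have /hW : principal_family Pr P Ha Hp c T t (EFin \o h t.+1)
    (fun w => (c t (A t w))%:E - (c t (A t w))%:E + (h t w)%:E)%E.
  exists (fun=> 1), (A t), (Gam t), (fun w => (c t (A t w))%:E), (fun w => (h t w)%:E); split => //.
  - exact: (@meas_cst t _ R 1).
  - exact: inC_opt.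
  - exact: pasted_agent.
  - have := pasted_principal tT; congr pasted; apply/funext => w /=; by rewrite -EFinD addrA.
by apply: filterS => w; rewrite subee// add0e.
Qed.

Lemma principal_recursion_h : principal_recursion Pr P Ha Hp c T (fun t => EFin \o h t).
Proof. by split; [rewrite hT|exact: principal_esssup]. Qed.

Lemma principal_family_ae t (h1 h2 : Omega -> \bar R) : (t < T)%N ->
  {ae Pr, forall w, h1 w = h2 w} ->
  principal_family Pr P Ha Hp c T t h1 `<=` principal_family Pr P Ha Hp c T t h2.
Proof.
move=> tT e Z [beta [A' [G' [Ya [Yp [mb i pa pp ->]]]]]].
exists beta, A', G', Ya, Yp; split => //; apply: (pasted_ae tT _ pp).
by apply: filterS e => w ->.
Qed.

(** Attainment is claimed for every solution of the recursion, while the optimal steps are built on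
    one of them. Backward induction identifies the two almost surely, as equal continuations have
    equal families. *)
Lemma principal_recursion_unique h' : principal_recursion Pr P Ha Hp c T h' ->
  forall t, (t <= T)%N -> {ae Pr, forall w, h' t w = (h t w)%:E}.
Proof.
move=> [h'T rec] t tT; rewrite -(subKn tT); elim: (T - t)%N (leq_subr t T) => [_|k IH kT].
  by rewrite subn0 h'T hT; exact: aeW.
have {}IH := IH (ltnW kT); have sT : (T - k.+1 < T)%N by rewrite ltn_subrL (leq_ltn_trans _ kT).
rewrite -(subnSK kT) in IH; set s := (T - k.+1)%N in IH sT *.
have [m1 u1 l1] := rec s sT; have [m2 u2 l2] := principal_esssup sT.
have IH' : {ae Pr, forall w, (h s.+1 w)%:E = h' s.+1 w} by apply: filterS IH.
have a1 : {ae Pr, forall w, (h' s w <= (EFin \o h s) w)%E}.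
  apply: l1 => [|Z fZ]; first exact: (meas_wrt_measurable (Fsub (ltnW sT)) m2).
  by apply: u2; exact: principal_family_ae fZ.
have a2 : {ae Pr, forall w, ((EFin \o h s) w <= h' s w)%E}.
  apply: l2 => [|Z fZ]; first exact: (meas_wrt_measurable (Fsub (ltnW sT)) m1).
  by apply: u1; exact: principal_family_ae fZ.
by apply: filterS2 a1 a2 => w x y; apply/eqP; rewrite eq_le x y.
Qed.

Lemma attained_opt h' : principal_recursion Pr P Ha Hp c T h' ->
  forall t, (t < T)%N -> attained_beta1 Pr P Ha Hp c T t h'.
Proof.
move=> rec t tT; have e := principal_recursion_unique rec tT.
exists (A t), (Gam t), (fun w => (c t (A t w))%:E), (fun w => (h t w)%:E); split.
- exact: inC_opt.
- exact: pasted_agent.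
- apply: pasted_ae tT _ (pasted_principal tT); apply: filterS e => w ->; by rewrite -EFinD addrA.
- by apply: filterS (principal_recursion_unique rec (ltnW tT)) => w ->; rewrite subee// add0e.
Qed.

Section Contract.
Variable Rres : R.

Definition wealth t w := Rres + \sum_(s < t) (Gam s w - gain P (A s w) s w).

Lemma wealthS t w : wealth t.+1 w = wealth t w + Gam t w - gain P (A t w) t w.
Proof. by rewrite /wealth big_ord_recr/= !addrA. Qed.

Lemma meas_wealth t : (t <= T)%N -> meas_wrt (F t) (wealth t).
Proof.
elim: t => [_|t IH tT].
  rewrite (_ : wealth 0 = fun=> Rres); first exact: (@meas_cst 0 _ R Rres).
  by apply/funext => w; rewrite /wealth big_ord0 addr0.
have [[mA mG _ _] _ _ _] := opt tT; have mg := meas_gain_t tT mA.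
have mW := meas_wrt_Filt (leqnSn t) (IH (ltnW tT)).
rewrite (funext (wealthS t)); apply/meas_wrtP; apply: measurable_funB; last exact/meas_wrtP.
by apply: measurable_funD; exact/meas_wrtP.
Qed.

Lemma wealth_bounded t : (t <= T)%N -> exists b, {ae Pr, forall w, `|wealth t w| <= b}.
Proof.
elim: t => [_|t IH tT].
  by exists `|Rres|; apply: aeW => w; rewrite /wealth big_ord0 addr0.
have [b hb] := IH (ltnW tT); have [b' hb'] := gain_bounded tT; have [_ B _ _] := opt tT.
exists (b + BB t + b'); apply: filterS2 hb hb' => w h1 h2; have [_ h3 _ _] := B w.
rewrite wealthS; apply: le_trans (ler_normB _ _) _; apply: lerD => //.
by apply: le_trans (ler_normD _ _) _; exact: lerD.
Qed.

(** With [beta = 1] the continuation plus the agent's gain is [Gam t + wealth t]: the optimal step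
    with cash [D = wealth t], known at [t]. Its normalised value minus the cost is [wealth t]
    again. *)
Lemma IC_wealth : incentive_compatible Pr P Ha c T (wealth T) (fun _ _ => 1) A (fun t => EFin \o wealth t).
Proof.
split => // t tT; have [[mA mG _ mc] B ex _] := opt tT.
have mW := meas_wealth (ltnW tT); have mW1 := meas_wealth tT; have [b Wb] := wealth_bounded (ltnW tT).
have [oG _] := ex _ _ mW Wb.
have EA w : ((EFin \o wealth t.+1) w + (1 * gain P (A t w) t w)%:E = (Gam t w + wealth t w)%:E)%E.
  by rewrite /= -EFinD wealthS; congr EFin; ring.
have pA : pasted Pr P Ha T t (fun w => (EFin \o wealth t.+1) w + (1 * gain P (A t w) t w)%:E)%E
    (fun w => (c t (A t w) + wealth t w)%:E).
  rewrite (funext EA).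
  apply: (OCE1ext_pasted Fsub lHa tHa tT (X' := fun w => (Gam t w + wealth t w)%:E) (b := BB t + b) _ _ _ oG).
  - apply/meas_wrtP/measurable_EFinP; apply: measurable_funD; first exact/meas_wrtP.
    by apply/meas_wrtP; exact: meas_wrt_Filt mW.
  - exact: aeW.
  - apply: filterS Wb => w wb; have [_ gb _ _] := B w; rewrite lee_fin.
    by apply: le_trans (ler_normD _ _) _; exact: lerD.
split => //; last first.
  exists (fun w => (c t (A t w) + wealth t w)%:E); split => //.
  by apply: aeW => w /=; rewrite -EFinB; congr EFin; ring.
split.
- by apply/meas_wrtP/measurable_EFinP/meas_wrtP.
- move=> Z [Ab [Y [mAb pY ->]]].
  have mgb := meas_gain_t tT mAb.
  have E w : ((EFin \o wealth t.+1) w + (1 * gain P (Ab w) t w)%:E =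
     (Gam t w + gain P (Ab w) t w - gain P (A t w) t w + wealth t w)%:E)%E.
    by rewrite /= -EFinD wealthS; congr EFin; ring.
  have mG1 : meas_wrt (F t.+1) (fun w => (EFin \o wealth t.+1) w + (1 * gain P (Ab w) t w)%:E)%E.
    apply/meas_wrtP/measurable_EFinP; apply: measurable_funD; first exact/meas_wrtP.
    by apply: measurable_funM; [exact: measurable_cst|exact/meas_wrtP].
  have := agent_upper tT mAb mW mG1 E pY; apply: filterS => w.
  by rewrite leeBlDr// -EFinD addrC.
- move=> W _ hW.
  have /hW : [set Z | exists (Abar : Omega -> 'rV[R]_N) (Y : Omega -> \bar R),
             [/\ adapted_vec P t Abar,
                 pasted Pr P Ha T t
                   (fun w => ((EFin \o wealth t.+1) w + (1 * gain P (Abar w) t w)%:E)%E) Y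
               & Z = (fun w => Y w - (c t (Abar w))%:E)%E]]
      (fun w => (c t (A t w) + wealth t w)%:E - (c t (A t w))%:E)%E.
    by exists (A t), (fun w => (c t (A t w) + wealth t w)%:E).
  apply: filterS => w; rewrite -EFinB (_ : c t (A t w) + wealth t w - c t (A t w) = wealth t w)//; ring.
Qed.

Lemma pasted_payoff : pasted Pr P Hp T 0
  (fun w => (principal_payoff P T (wealth T) (fun _ _ => 1) A w)%:E) (fun w => (h 0 w - Rres)%:E).
Proof.
exists (fun t w => (h t w - wealth t w)%:E); split.
- apply/funext => w; rewrite hT /principal_payoff; congr EFin.
  by under [X in wealth T w + X]eq_bigr do rewrite mul1r; ring.
- move=> t /andP[_ tT]; have [_ _ ex _] := opt tT.
  have [b Wb] := wealth_bounded (ltnW tT).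
  have [_] := ex _ _ (meas_wealth (ltnW tT)) Wb; apply: OCE1ext_ae; last exact: aeW.
  by apply: aeW => w; rewrite wealthS; congr EFin; ring.
- by apply/funext => w; rewrite /wealth big_ord0 addr0.
Qed.

Section Competitor.
Context (Theta' : Omega -> R) (beta' : nat -> Omega -> R) (A' : nat -> Omega -> 'rV[R]_N).
Context (Hag' Z : nat -> Omega -> \bar R).
Hypothesis ct : Defs.contract P T Theta' beta'.
Hypothesis ic : incentive_compatible Pr P Ha c T Theta' beta' A' Hag'.
Hypothesis ZT : Z T = (fun w => (principal_payoff P T Theta' beta' A' w)%:E).
Hypothesis hZ : forall t, (t < T)%N -> OCE1ext Pr P (Hp t) t (Z t.+1) (Z t).

(** The share of the wealth generated before [t] that a competing contract leaves to the principal;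
    it is cash known at [t]. *)
Definition residual t w := \sum_(s < t) (1 - beta' s w) * gain P (A' s w) s w.

Lemma residualS t w : residual t.+1 w = residual t w + (1 - beta' t w) * gain P (A' t w) t w.
Proof. by rewrite /residual big_ord_recr. Qed.

Lemma meas_residual t : (t <= T)%N -> meas_wrt (F t) (residual t).
Proof.
elim: t => [_|t IH tT].
  rewrite (_ : residual 0 = fun=> 0); first exact: (@meas_cst 0 _ R 0).
  by apply/funext => w; rewrite /residual big_ord0.
have [mA _ _] := ic.2 t tT; have mg := meas_gain_t tT mA.
have mW := meas_wrt_Filt (leqnSn t) (IH (ltnW tT)).
have mb := meas_wrt_Filt (leqnSn t) (ct.2 t tT).
rewrite (funext (residualS t)); apply/meas_wrtP; apply: measurable_funD; first exact/meas_wrtP.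
apply: measurable_funM; last exact/meas_wrtP.
by apply: measurable_funB; [exact: measurable_cst|exact/meas_wrtP].
Qed.

Lemma meas_Hag' t : (t <= T)%N -> meas_wrt (F t) (Hag' t).
Proof.
rewrite leq_eqVlt => /orP[/eqP ->|tT]; last by have [_ [m _ _] _] := ic.2 t tT.
by rewrite ic.1; apply/meas_wrtP/measurable_EFinP/meas_wrtP; exact: ct.1.
Qed.

Lemma meas_payoff : meas_wrt (F T) (principal_payoff P T Theta' beta' A').
Proof.
have E w : principal_payoff P T Theta' beta' A' w = residual T w - Theta' w.
  rewrite /principal_payoff /residual opprD addrA addrAC -sumrB; congr (_ - _).
  by apply: eq_bigr => s _; rewrite mulrBl mul1r.
rewrite (funext E); apply/meas_wrtP; apply: measurable_funB; apply/meas_wrtP.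
  exact: meas_residual.
exact: ct.1.
Qed.

Lemma ae_meas_Z t : (t <= T)%N -> ae_measurable Pr (Z t).
Proof.
rewrite leq_eqVlt => /orP[/eqP ->|tT].
  rewrite ZT; apply: (meas_wrt_ae_measurable (leqnn T)).
  by apply/meas_wrtP/measurable_EFinP/meas_wrtP; exact: meas_payoff.
have [Y mY e] := OCE1ext_meas (hZ tT).
by exists Y => //; exact: (meas_wrt_measurable (Fsub (ltnW tT)) mY).
Qed.

(** At [T] the transfer [Theta'] cancels from the sum. Backwards, the fourth clause of
    [optimal_step] with [D = residual] applies whatever [beta'] is: what it gives the agent is
    missing from the increment of [residual]. At time 0, individual rationality turns this into the
    bound [h 0 - Rres]. *)
Lemma competitor_upper t : (t <= T)%N ->
  {ae Pr, forall w, (Z t w + Hag' t w <= (residual t w + h t w)%:E)%E}.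
Proof.
move=> tT; rewrite -(subKn tT); elim: (T - t)%N (leq_subr t T) => [_|k IH kT].
  rewrite subn0 ZT ic.1 hT; apply: aeW => w; rewrite -EFinD lee_fin /principal_payoff /residual.
  under [X in _ <= X + _]eq_bigr do rewrite mulrBl mul1r.
  by rewrite sumrB; lra.
have {}IH := IH (ltnW kT); have sT : (T - k.+1 < T)%N by rewrite ltn_subrL (leq_ltn_trans _ kT).
rewrite -(subnSK kT) in IH; set s := (T - k.+1)%N in IH sT *.
have [_ _ _ UB] := opt sT; have [mA _ [Y [pY eY]]] := ic.2 s sT.
have mb := meas_wrt_Filt (leqnSn s) (ct.2 s sT); have mg := meas_gain_t sT mA.
have mG : meas_wrt (F s.+1) (fun w => Hag' s.+1 w + (beta' s w * gain P (A' s w) s w)%:E)%E.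
  apply/meas_wrtP; apply: emeasurable_funD; first by apply/meas_wrtP; exact: meas_Hag'.
  by apply/measurable_EFinP; apply: measurable_funM; exact/meas_wrtP.
have oG := pasted_OCE1ext Fsub lHa tHa sT mG (aeW _ (fun=> erefl)) pY.
have X : {ae Pr, forall w, (Hag' s.+1 w + (beta' s w * gain P (A' s w) s w)%:E + Z s.+1 w <=
    (h s.+1 w + gain P (A' s w) s w + residual s w)%:E)%E}.
  apply: filterS IH => w; rewrite residualS.
  case: (Z s.+1 w) (Hag' s.+1 w) => [z| |] [g| |]//=; rewrite ?leNye//.
  by rewrite -!EFinD !lee_fin; lra.
have := UB _ _ _ _ _ _ mA (meas_residual (ltnW sT)) (meas_wrt_ae_measurable sT mG) (ae_meas_Z sT) oG (hZ sT) X.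
apply: filterS2 eY => w -> .
case: (Z s w) (Y w) => [z| |] [y| |]//=; rewrite ?leNye//.
by rewrite -!EFinD !lee_fin; lra.
Qed.

End Competitor.

Lemma optimal_contract : PA_solution Pr P Ha Hp c T Rres (wealth T) (fun _ _ => 1) A.
Proof.
exists (fun t => EFin \o wealth t), (fun w => (h 0 w - Rres)%:E); split.
- by split; [exact: meas_wealth|move=> t _; exact: (@meas_cst t _ R 1)].
- exact: IC_wealth.
- by apply: aeW => w /=; rewrite /wealth big_ord0 addr0.
- exact: pasted_payoff.
move=> Theta' beta' A' Hag' Y' ct ic ir [Z [ZT hZ <-]].
apply: filterS2 ir (competitor_upper ct ic ZT hZ (leq0n T)) => w.
rewrite /residual big_ord0 add0r.
case: (Z 0 w) (Hag' 0 w) => [z| |] [g| |]//=; rewrite ?leNye//.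
by rewrite -EFinD !lee_fin; lra.
Qed.

End Contract.

End Dynamics.

Lemma optimal_steps_exist d (Omega : measurableType d) (R : realType) (Pr : probability Omega R)
    (N T : nat) (P : nat -> Omega -> 'rV[R]_N) (c : nat -> 'rV[R]_N -> R) (Ha Hp : nat -> R -> \bar R) :
  (forall t (hn : Omega -> R) b, (t < T)%N -> meas_wrt (Filt P t.+1) hn -> (forall w, `|hn w| <= b) ->
    exists A Gam ht BB, optimal_step Pr P t (c t) (Ha t) (Hp t) hn A Gam ht BB) ->
  exists A Gam h BB, h T = (fun=> 0) /\ forall t, (t < T)%N ->
    optimal_step Pr P t (c t) (Ha t) (Hp t) (h t.+1) (A t) (Gam t) (h t) (BB t).
Proof.
move=> ex.
(* Each step depends on the value function of the next period, so the choice is made once for all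
   pairs of a date and a continuation, with an arbitrary default where the premises fail. *)
have /choice[f hf] (thn : nat * (Omega -> R)) : exists S : (Omega -> 'rV[R]_N) * (Omega -> R) * (Omega -> R) * R,
    (thn.1 < T)%N -> meas_wrt (Filt P thn.1.+1) thn.2 -> (exists b, forall w, `|thn.2 w| <= b) ->
    optimal_step Pr P thn.1 (c thn.1) (Ha thn.1) (Hp thn.1) thn.2 S.1.1.1 S.1.1.2 S.1.2 S.2.
  have [[tT [mh [b hb]]]|n] := pselect ((thn.1 < T)%N /\ meas_wrt (Filt P thn.1.+1) thn.2 /\
     (exists b, forall w, `|thn.2 w| <= b)).
    by have [A [Gam [ht [BB o]]]] := ex _ _ _ tT mh hb; exists (A, Gam, ht, BB).
  by exists (fun=> 0, fun=> 0, fun=> 0, 0) => h1 h2 h3; case: n.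
(* Backward recursion in the number [k] of periods left before [T]; [g k] is the value function at
   date [T - k]. *)
pose g := fix g k := if k is k'.+1 then (f ((T - k'.+1)%N, g k')).1.2 else fun=> (0 : R).
pose h t := g (T - t)%N.
pose S t := f (t, h t.+1).
have hS t : (t < T)%N -> h t = (S t).1.2.
  move=> tT; rewrite /h /S -(subnSK tT)/= subnSK// subKn ?(ltnW tT)//.
have opt k : (k < T)%N -> optimal_step Pr P (T - k.+1) (c (T - k.+1)%N) (Ha (T - k.+1)%N) (Hp (T - k.+1)%N)
    (h (T - k.+1).+1) (S (T - k.+1)%N).1.1.1 (S (T - k.+1)%N).1.1.2 (S (T - k.+1)%N).1.2 (S (T - k.+1)%N).2.
  elim: k => [|k IH] kT; apply: (hf (_, _)) => /=; rewrite ?ltn_subrL ?(leq_ltn_trans _ kT)//.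
  - by rewrite subnSK// subn0 /h subnn; apply/meas_wrtP; exact: measurable_cst.
  - by exists 0 => w; rewrite subnSK// subn0 /h subnn normr0.
  - rewrite subnSK// -/(h (T - k.+1)%N) hS ?ltn_subrL ?(leq_ltn_trans _ kT)//.
    by have [[]] := IH (ltnW kT).
  - rewrite subnSK// -/(h (T - k.+1)%N) hS ?ltn_subrL ?(leq_ltn_trans _ kT)//.
    by have [_ B _ _] := IH (ltnW kT); exists (S (T - k.+1)%N).2 => w; have [] := B w.
exists (fun t => (S t).1.1.1), (fun t => (S t).1.1.2), h, (fun t => (S t).2); split.
  by rewrite /h subnn.
move=> t tT; have := opt (T - t.+1)%N; rewrite subnSK// subKn ?(ltnW tT)// leq_subr => /(_ isT).
by rewrite -hS.
Qed.

Theorem mainTheorem6 (d : measure_display) (Omega : measurableType d)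
  (R : realType) (Pr : probability Omega R) (T N : nat)
  (P : nat -> Omega -> 'rV[R]_N) (c : nat -> 'rV[R]_N -> R)
  (Ha Hp : nat -> R -> \bar R) (pminus pplus : R) :
  (0 < T)%N ->
  (* price process: random variables, strictly positive *)
  (forall t (i : 'I_N), (t <= T)%N -> measurable_fun setT (fun w => P t w ord0 i)) ->
  (forall t (i : 'I_N) w, (t <= T)%N -> 0 < P t w ord0 i) ->
  (* bounded prices *)
  0 < pminus -> pminus <= pplus ->
  (forall t (i : 'I_N), (t <= T)%N ->
     {ae Pr, forall w, pminus <= P t w ord0 i <= pplus}) ->
  (* strictly convex, superlinear costs *)
  (forall t, (t < T)%N -> strictly_convex (c t)) ->
  (forall t, (t < T)%N -> superlinear (c t)) ->
  (* OCE loss functions *)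
  (forall t, (t < T)%N -> OCE_loss (Ha t) /\ OCE_loss (Hp t)) ->
  (forall t, (t < T)%N ->
     interior (dom_ext (conj_ext (Ha t))) 1 /\
     interior (dom_ext (conj_ext (Hp t))) 1) ->
  (forall t, (t < T)%N ->
     (exists m : R, forall s, (m%:E <= Ha t s)%E) /\
     (exists m : R, forall s, (m%:E <= Hp t s)%E)) ->
  (* conclusion *)
  ((exists h, principal_recursion Pr P Ha Hp c T h) /\
   (forall h, principal_recursion Pr P Ha Hp c T h ->
      forall t, (t < T)%N -> attained_beta1 Pr P Ha Hp c T t h)) /\
  (forall Rres : R, exists (Theta : Omega -> R) (A : nat -> Omega -> 'rV[R]_N),
     PA_solution Pr P Ha Hp c T Rres Theta (fun _ _ => 1) A).
Proof.
move=> _ mP P_gt0 pm0 pmp Pb sc sl oce int01 lb.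
have Fsub := Filt_measurable mP; have mrho t i (tT : (t < T)%N) := meas_return P_gt0 i tT.
have rhoK t (tT : (t < T)%N) := return_bounded pm0 Pb tT.
have K0 : 0 <= pplus / pminus by rewrite divr_ge0 ?ltW// (lt_le_trans pm0).
have lHa t (tT : (t < T)%N) := OCE_loss_loss (oce t tT).1 (int01 t tT).1 (lb t tT).1.
have lHp t (tT : (t < T)%N) := OCE_loss_loss (oce t tT).2 (int01 t tT).2 (lb t tT).2.
have tHa t (tT : (t < T)%N) : tight (Ha t) := OCE_loss_tight (oce t tT).1.
have tHp t (tT : (t < T)%N) : tight (Hp t) := OCE_loss_tight (oce t tT).2.
have [A [Gam [h [BB [hT opt]]]]] : exists A Gam h BB, h T = (fun=> 0) /\ forall t, (t < T)%N ->
    optimal_step Pr P t (c t) (Ha t) (Hp t) (h t.+1) (A t) (Gam t) (h t) (BB t).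
  apply: optimal_steps_exist => t hn b tT mhn hnb.
  have [ma [ea [Ca [sa la]]]] := lHa t tT; have [mp [ep [Cp [sp lp]]]] := lHp t tT.
  have [[cHa _ _ _] [cHp _ _ _]] := oce t tT.
  exact: (optimal_step_exists (Fsub _ (ltnW tT)) (Fsub _ tT) (Filt_mono (leqnSn t)) (sc t tT) (sl t tT)
    la lp cHa cHp (tHa t tT) (tHp t tT) (fun i => mrho t i tT) mhn hnb K0 (rhoK t tT)).
split; first split.
- exists (fun t => EFin \o h t).
  exact: (principal_recursion_h Fsub mrho rhoK lHa lHp tHa tHp hT opt).
- exact: (attained_opt Fsub mrho rhoK lHa lHp tHa tHp hT opt).
(* The wealth process starts at [Rres], so the participation constraint holds with equality. *)
move=> Rres; exists (wealth P A Gam Rres T), A.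
exact: (optimal_contract Fsub mrho rhoK lHa tHa hT opt).
Qed.
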